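(* (1) Each of the hyperspaces $\mathcal S(\mathbb R^2)$ and $\mathcal K_T$ is a strongly infinite-dimensional Cantor manifold, and each of its nonempty open subsets contains a subset that is closed in the hyperspace and homeomorphic to $\hat{c_0}$. (2) Each of the hyperspaces $\mathcal S_P(\mathbb R^2)$ and $\mathcal K_P$ is an infinite-dimensional Cantor manifold, and each of its nonempty open subsets contains a subset that is closed in the hyperspace and homeomorphic to $\sigma$.
   Context: For a space $X$, $C(X)$ denotes the hyperspace of all nonempty continua (compact connected subsets) in $X$ with the Vietoris topology, whose basic open sets are $\langle U_1,\dots,U_n\rangle=\{C\in C(X): C\subset\bigcup_{k=1}^n U_k \text{ and } U_k\cap C\neq\emptyset \text{ for all } k\}$, with $n\in\mathbb N$ and $U_k$ open in $X$ (equivalently, for $X=\mathbb R^n$, the topology of the Hausdorff distance). All hyperspaces below are subspaces of $C(\mathbb R^2)$ or $C(\mathbb R^3)$. $\mathcal S(\mathbb R^2)\subset C(\mathbb R^2)$ is the hyperspace of all simple closed curves (homeomorphic copies of the circle) in $\mathbb R^2$, and $\mathcal S_P(\mathbb R^2)\subset\mathcal S(\mathbb R^2)$ is the hyperspace of simple closed polygons (simple closed curves that are finite unions of straight line segments). Simple closed curves in $\mathbb R^3$ are called knots. $\mathcal K_P\subset C(\mathbb R^3)$ is the hyperspace of polygonal knots (knots that are finite unions of straight line segments). A knot $C$ is tame if there is a homeomorphism of $\mathbb R^3$ onto itself mapping $C$ onto a polygonal knot. $\mathcal K_T\subset C(\mathbb R^3)$ is the hyperspace of tame knots. $\hat{c_0}=\{(x_j)_{j=1}^\infty\in[0,1]^{\mathbb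 N}:\lim_j x_j=0\}$ and $\sigma=\{(x_j)_{j=1}^\infty\in[0,1]^{\mathbb N}: x_j=0 \text{ for all but finitely many } j\}$, both with the topology inherited from the product topology of $[0,1]^{\mathbb N}$. A (separable metrizable) space $X$ is weakly infinite-dimensional if for every sequence $(A_i,B_i)_{i\ge1}$ of pairs of disjoint closed subsets of $X$ there are partitions $L_i$ between $A_i$ and $B_i$ in $X$ with $\bigcap_i L_i=\emptyset$ (finite-dimensional spaces, including the empty one, satisfy this); it is strongly infinite-dimensional otherwise. Here a closed set $L$ is a partition between $A$ and $B$ if $X\setminus L$ is the union of two disjoint open sets, one containing $A$ and the other containing $B$. A closed subset $Z$ separates $X$ if $X\setminus Z$ is the union of two nonempty disjoint open sets. An infinite-dimensional space $X$ is an infinite-dimensional Cantor manifold if no finite-dimensional closed subset separates $X$; it is a strongly infinite-dimensional Cantor manifold if no weakly infinite-dimensional closed subset separates $X$. Dimension is covering dimension (all spaces are separable metrizable). *)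

(* Defs.v *)
From HB Require Import structures.
From mathcomp Require Import all_boot all_order all_algebra.
From mathcomp Require Import all_classical all_reals all_analysis.

Set Implicit Arguments.
Unset Strict Implicit.
Unset Printing Implicit Defensive.

Import Order.TTheory GRing.Theory Num.Theory.
Import numFieldNormedType.Exports.

Local Open Scope classical_set_scope.
Local Open Scope ring_scope.

(** A set [A : set X] used as a type is [set_type A], which the library equips
    with the subspace topology. *)

Section Homeomorphisms.
Context (X Y : topologicalType).

Definition homeomorphism (f : X -> Y) :=
  exists g : Y -> X,
    [/\ cancel f g, cancel g f, continuous f & continuous g].

Definition homeomorphic := exists f : X -> Y, homeomorphism f.

End Homeomorphisms.

Section Hyperspace.
Context (X : topologicalType).

Definition continua : Type :=
  set_type [set C : set X | [/\ C !=set0, compact C & connected C]].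

HB.instance Definition _ := Choice.on continua.

Definition set_of_continuum (C : continua) : set X := set_val C.

Definition vietoris (Us : set (set X)) : set continua :=
  [set C | set_of_continuum C `<=` \bigcup_(U in Us) U /\
           forall U, Us U -> U `&` set_of_continuum C !=set0].

Definition finite_opens : set (set (set X)) :=
  [set Us | finite_set Us /\ Us `<=` open].

Lemma vietoris_cover : \bigcup_(Us in finite_opens) vietoris Us = setT.
Proof.
apply/seteqP; split=> // C _; exists [set setT].
  by split; [exact: finite_set1 | move=> U ->; exact: openT].
split=> [x Cx|U ->]; first by exists setT.
by rewrite setTI; case: (set_valP C).
Qed.

Lemma vietoris_join (Us Vs : set (set X)) (C : continua) :
  finite_opens Us -> finite_opens Vs -> vietoris Us C -> vietoris Vs C ->
  exists Ws, [/\ finite_opens Ws, vietoris Ws C &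
                 vietoris Ws `<=` vietoris Us `&` vietoris Vs].
Proof.
move=> [Ufin Uop] [Vfin Vop] [CU UC] [CV VC].
pose U := \bigcup_(A in Us) A; pose V := \bigcup_(A in Vs) A.
exists ([set A `&` V | A in Us] `|` [set A `&` U | A in Vs]); split.
- split; first by rewrite finite_setU; split; exact: finite_image.
  by move=> _ [|] [A AU <-]; apply: openI; (try exact: Uop); (try exact: Vop);
    apply: bigcup_open => B; [exact: Vop|exact: Uop].
- split=> [x Cx|_ [|] [A AU <-]].
  + have [A UA Ax] := CU x Cx.
    by exists (A `&` V); [left; exists A|split=> //; exact: CV].
  + by have [x [Ax Cx]] := UC A AU; exists x; split=> //; split=> //; exact: CV.
  + by have [x [Ax Cx]] := VC A AU; exists x; split=> //; split=> //; exact: CU.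
- move=> D [DW WD]; split; split=> [x /DW[_ [|] [A AU <-]]|A AU].
  + by move=> [Ax _]; exists A.
  + by move=> [].
  + by have [|x [[Ax _] Dx]] := WD (A `&` V); [left; exists A|exists x].
  + by move=> [].
  + by move=> [Ax _]; exists A.
  + by have [|x [[Ax _] Dx]] := WD (A `&` U); [right; exists A|exists x].
Qed.

HB.instance Definition _ := isBaseTopological.Build continua
  vietoris_cover vietoris_join.

End Hyperspace.

Coercion set_of_continuum : continua >-> set.

Section Curves.
Context (R : realType).

Definition unit_circle : set 'rV[R]_2 := [set x | x 0 0 ^+ 2 + x 0 1 ^+ 2 = 1].

Definition segment n (a b : 'rV[R]_n) : set 'rV[R]_n :=
  [set (1 - t) *: a + t *: b | t in `[0, 1]].

Definition finite_union_of_segments n (A : set 'rV[R]_n) :=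
  exists (m : nat) (a b : nat -> 'rV[R]_n),
    A = \bigcup_(i < m) segment (a i) (b i).

Definition simple_closed_curves n : set (continua 'rV[R]_n) :=
  [set C : continua 'rV[R]_n | homeomorphic (set_type C) (set_type unit_circle)].

Definition polygonal_simple_closed_curves n : set (continua 'rV[R]_n) :=
  [set C : continua 'rV[R]_n |
    simple_closed_curves C /\ finite_union_of_segments C].

Definition tame_knots : set (continua 'rV[R]_3) :=
  [set C : continua 'rV[R]_3 | simple_closed_curves C /\
    exists (h : 'rV[R]_3 -> 'rV[R]_3) (D : continua 'rV[R]_3),
      [/\ homeomorphism h, polygonal_simple_closed_curves D &
          (h @` C = D)%classic]].

Definition hilbert_cube : topologicalType :=
  prod_topology (fun _ : nat => set_type `[0 : R, 1]%classic).

Definition c0_hat : set hilbert_cube :=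
  [set x | (fun j : nat => set_val (x j) : R) @ \oo --> (0 : R)].

Definition sigma : set hilbert_cube :=
  [set x | finite_set [set j : nat | set_val (x j) != 0 :> R]].

End Curves.

Section Dimension.
Context (X : topologicalType).

(** A family of sets has order at most [n] if no [n + 2] distinct members
    have a common point. *)
Definition covering_dim_le (n : nat) :=
  forall Us : set (set X),
    finite_set Us -> Us `<=` open -> \bigcup_(U in Us) U = setT ->
    exists Vs : set (set X),
      [/\ finite_set Vs, Vs `<=` open, \bigcup_(V in Vs) V = setT,
          forall V, Vs V -> exists2 U, Us U & V `<=` U &
          forall Ws : set (set X), Ws `<=` Vs -> (Ws #= `I_n.+2)%card ->
            \bigcap_(W in Ws) W = set0].

Definition finite_dimensional := exists n : nat, covering_dim_le n.

Definition partition_between (A B L : set X) :=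
  closed L /\ exists U V : set X,
    [/\ open U, open V, U `&` V = set0, ~` L = U `|` V & A `<=` U /\ B `<=` V].

Definition weakly_infinite_dimensional :=
  forall A B : nat -> set X,
    (forall i, [/\ closed (A i), closed (B i) & A i `&` B i = set0]) ->
    exists L : nat -> set X,
      (forall i, partition_between (A i) (B i) (L i)) /\
      \bigcap_i L i = set0.

Definition separates (Z : set X) :=
  exists U V : set X,
    [/\ open U, open V, U !=set0 /\ V !=set0, U `&` V = set0 &
        ~` Z = U `|` V].

End Dimension.

Definition infinite_dimensional_Cantor_manifold (X : topologicalType) :=
  ~ finite_dimensional X /\
  forall Z : set X, closed Z -> finite_dimensional (set_type Z) ->
    ~ separates Z.

Definition strongly_infinite_dimensional_Cantor_manifold
    (X : topologicalType) :=
  ~ finite_dimensional X /\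
  forall Z : set X, closed Z -> weakly_infinite_dimensional (set_type Z) ->
    ~ separates Z.

Definition open_sets_contain_closed_copies (X Y : topologicalType) :=
  forall U : set X, open U -> U !=set0 ->
    exists F : set X,
      [/\ F `<=` U, closed F & homeomorphic (set_type F) Y].

(* Main.v *)
(** Let E(B, x) be the union of a polygonal arc B, a frame and, for x in
    [0,1]^N, spikes of heights x_0, x_1, ... over disjoint intervals that
    shrink to a point above which the frame has a vertical segment.  In the
    Hausdorff distance E(B, x) depends continuously on x, it is a simple closed
    curve iff x tends to 0 (and then a vertical homeomorphism of the space
    flattens all the spikes, so that it is tame), and it is moreover polygonal
    iff almost all x_j vanish.  Hence the similar copies w + l E(B, x), with w,
    l and B fixed, meet the four hyperspaces in closed copies of c_0 and sigma.

    Every simple closed curve is approximated by copies w + l E(B, x), for all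
    small l and uniformly in x: round a parametrization to a lattice walk, erase
    its loops, and open the remaining lattice polygon at a highest vertex to
    insert the frame.  Shrinking B to a segment, translating, and growing
    another arc B' joins two such copies, again uniformly in x.  So any two
    nonempty open sets are joined by a map of [0,3] x [0,1]^N into the
    hyperspace from whose values x can be recovered.  If Z separated the two
    open sets, the preimages of Z in the finite-dimensional cubes would, by the
    Poincare-Miranda theorem (a consequence of a mod 2 cubical Sperner lemma),
    contradict the weak infinite-dimensionality, or the covering dimension, of
    Z. *)
Require Import Defs.
From mathcomp Require Import all_boot all_order all_algebra.
From mathcomp Require Import all_classical all_reals all_analysis.
From mathcomp Require Import ring lra zify.
Set Implicit Arguments.
Unset Strict Implicit.
Unset Printing Implicit Defensive.
Import Order.TTheory GRing.Theory Num.Theory.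
Import numFieldNormedType.Exports.
Local Open Scope classical_set_scope.
Local Open Scope ring_scope.

(** The construction is shaped by compactness. E(B, x) is a continuum for every x in the Hilbert
    cube, whether or not it belongs to a hyperspace, because the vertical segment of the frame
    absorbs the spikes of high index: up to a given error only finitely many coordinates of x
    matter. So the whole cube is embedded as a compact set of continua, and its trace on a
    hyperspace is closed there, although c_0 and sigma are not compact.

    The two strengths of the theorem come from one family. Dividing coordinate j by j + 1 sends the
    whole Hilbert cube into c_0, so infinitely many pairs of opposite faces act at once against a
    weakly infinite-dimensional Z. No positive weights do this for sigma, where only cubes of
    arbitrary finite dimension are available.

    In space B may be knotted, so two copies need not be isotopic. Shrinking B to a segment still is
    continuous, since the Hausdorff distance does not see a knot that is pulled small. Reading x off
    a copy uses that the scale l is known, so both ends of a path need the same l; this is why the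
    approximation must work for all small l. *)

Lemma rV_norm_lt (R : realType) n (x : 'rV[R]_n) (e : R) : 0 < e ->
  `|x| < e <-> forall i, `|x 0 i| < e.
Proof.
move=> e0; rewrite /Num.Def.normr /= mx_normrE; split=> [xe i|xe].
  by apply: le_lt_trans xe; apply: (le_bigmax _ (fun ij => `|x ij.1 ij.2|) (0, i)).
by apply/bigmax_ltP; split=> // -[i j] _; rewrite (ord1 i); exact: xe.
Qed.

Lemma rV_norm_le (R : realType) n (x : 'rV[R]_n) (e : R) : 0 <= e ->
  `|x| <= e <-> forall i, `|x 0 i| <= e.
Proof.
move=> e0; rewrite /Num.Def.normr /= mx_normrE; split=> [xe i|xe].
  by apply: le_trans xe; apply: (le_bigmax _ (fun ij => `|x ij.1 ij.2|) (0, i)).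
by apply/bigmax_leP; split=> // -[i j] _; rewrite (ord1 i); exact: xe.
Qed.

Lemma rV_coord_le (R : realType) n (x : 'rV[R]_n) i : `|x 0 i| <= `|x|.
Proof. by move: i; apply/(rV_norm_le x (normr_ge0 x)). Qed.

(** * Continuity of maps built from coordinates *)

Section ContinuousFunctions.
Context (R : realType) (T : topologicalType).
Implicit Types f g : T -> R.

Lemma cts_max f g : continuous f -> continuous g ->
  continuous (fun x => Num.max (f x) (g x)).
Proof. by move=> fc gc x; exact: (continuous_max (fc x) (gc x)). Qed.

Lemma cts_min f g : continuous f -> continuous g ->
  continuous (fun x => Num.min (f x) (g x)).
Proof. by move=> fc gc x; exact: (continuous_min (fc x) (gc x)). Qed.

Lemma ctsM f g : continuous f -> continuous g -> continuous (fun x => f x * g x).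
Proof. by move=> fc gc x; exact: (cvgM (fc x) (gc x)). Qed.

Lemma ctsD (V : normedModType R) (f g : T -> V) : continuous f -> continuous g ->
  continuous (fun x => f x + g x).
Proof. by move=> fc gc x; exact: (cvgD (fc x) (gc x)). Qed.

Lemma ctsB (V : normedModType R) (f g : T -> V) : continuous f -> continuous g ->
  continuous (fun x => f x - g x).
Proof. by move=> fc gc x; exact: (cvgB (fc x) (gc x)). Qed.

Lemma ctsZ (V : normedModType R) (f : T -> R) (g : T -> V) :
  continuous f -> continuous g -> continuous (fun x => f x *: g x).
Proof. by move=> fc gc x; exact: (cvgZ (fc x) (gc x)). Qed.

Lemma cts_cst (U : topologicalType) (c : U) : continuous (fun _ : T => c).
Proof. by move=> x; exact: cvg_cst. Qed.

Lemma cts_comp (U V : topologicalType) (f : T -> U) (g : U -> V) :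
  continuous f -> continuous g -> continuous (fun x => g (f x)).
Proof. by move=> fc gc x; exact: (continuous_comp (fc x) (gc (f x))). Qed.

Lemma cts_pair (U V : topologicalType) (f : T -> U) (g : T -> V) :
  continuous f -> continuous g -> continuous (fun x => (f x, g x)).
Proof. by move=> fc gc x; exact: (cvg_pair (fc x) (gc x)). Qed.

Lemma cts_norm (V : normedModType R) (f : T -> V) : continuous f ->
  continuous (fun x => `|f x|).
Proof. by move=> fc x; exact: (continuous_comp (fc x) (@norm_continuous _ _ _)). Qed.

Lemma cts_sum (V : normedModType R) (I : Type) (s : seq I) (P : pred I) (F : I -> T -> V) :
  (forall i, P i -> continuous (F i)) -> continuous (fun x => \sum_(i <- s | P i) F i x).
Proof. exact: (continuous_big add_continuous). Qed.

Lemma cts_prod (I : Type) (s : seq I) (P : pred I) (F : I -> T -> R) :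
  (forall i, P i -> continuous (F i)) -> continuous (fun x => \prod_(i <- s | P i) F i x).
Proof. exact: (continuous_big (@mul_continuous R)). Qed.

Lemma cts_row n (F : 'I_n -> T -> R) :
  (forall i, continuous (F i)) -> continuous (fun x => \row_i F i x).
Proof.
move=> Fc x; apply/cvgrPdist_lt => e e0; have : \forall y \near x, forall i, `|F i x - F i y| < e.
  by apply: filter_forall => i; have /cvgrPdist_lt := Fc i x; exact.
by apply: filterS => y Fy; apply/rV_norm_lt => // i; rewrite !mxE.
Qed.

Lemma cts_coord n (f : T -> 'rV[R]_n) i : continuous f -> continuous (fun x => f x 0 i).
Proof. by move=> fc; exact: (cts_comp fc (@coord_continuous R 1 n 0 i)). Qed.

End ContinuousFunctions.

Lemma open_bigcap_fin (T : topologicalType) (I : finType) (A : set I) (F : I -> set T) :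
  (forall i, A i -> open (F i)) -> open (\bigcap_(i in A) F i).
Proof.
move=> Fo; rewrite -[X in open X]setCK; apply: closed_openC; rewrite setC_bigcap.
by apply: closed_bigcup => [|i /Fo]; [exact: finite_finset|exact: open_closedC].
Qed.

(** * The Poincare-Miranda theorem *)

Section CubicalSperner.
Variables (m k : nat).
Local Notation point := {ffun 'I_m -> 'I_k.+1}.
Implicit Types (p q : point) (D : {set 'I_m}) (f : point -> 'F_2).

Lemma addF2 (x : 'F_2) : x + x = 0.
Proof. by apply: addrr_pchar2; rewrite inE. Qed.

Lemma addF2_eq0 (x y : 'F_2) : x + y = 0 -> x = y.
Proof. by move=> xy; rewrite -[x]addr0 -(addF2 y) addrA xy add0r. Qed.

Definition step p l : point :=
  [ffun j => if j == l then inord (p j).+1 else p j].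

Lemma stepC p l j : step (step p l) j = step (step p j) l.
Proof.
apply/ffunP => i; rewrite !ffunE.
by case: (eqVneq i j) => [->|nij]; case: (eqVneq _ l) => // ->; rewrite ?eqxx.
Qed.

(* Over 'F_2 this is the cup product df_1 \cup ... \cup df_r, summed over the
   simplices of the Freudenthal triangulation of the cube with lowest vertex
   [p] and edge directions [D]. *)
Fixpoint cup (fs : seq (point -> 'F_2)) p D : 'F_2 :=
  if fs is f :: fs' then
    \sum_(l in D) (f p + f (step p l)) * cup fs' (step p l) (D :\ l)
  else 1.

(** Over 'F_2 the terms of (l, j) and (j, l) cancel; splitting by [j < l] pairs them. *)
Lemma sum_pairs_sym0 D (g : 'I_m -> 'I_m -> 'F_2) :
  (forall l j, g l j = g j l) -> \sum_(l in D) \sum_(j in D :\ l) g l j = 0.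
Proof.
move=> gC.
have E l : \sum_(j in D :\ l) g l j =
    \sum_(j in D | (j < l)%N) g l j + \sum_(j in D | (l < j)%N) g l j.
  rewrite (bigID (fun j : 'I_m => (j < l)%N)) /=; congr (_ + _);
    apply: eq_bigl => j; rewrite !inE; case: (j \in D); rewrite ?andbF //= ?andbT.
    by rewrite -(inj_eq val_inj) /=; case: ltngtP.
  by rewrite -(inj_eq val_inj) /=; case: ltngtP.
rewrite (eq_bigr _ (fun l _ => E l)) big_split /=.
rewrite [X in _ + X](exchange_big_dep (mem D)) /=; last by move=> l j _ /andP[].
rewrite -[RHS](addF2 (\sum_(l in D) \sum_(j in D | (j < l)%N) g l j)).
congr (_ + _); apply: eq_bigr => l lD; apply: eq_big => [j|j _]; last exact: gC.
by rewrite lD.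
Qed.

(** This is the closedness of a cup product of coboundaries. After expanding the first factor, the
    values of [f] at the doubly shifted vertices cancel by symmetry, and so do those at [p] once the
    induction hypothesis is applied; what remains of either half is [s0]. *)
Lemma cup_boundary fs p D : #|D| = (size fs).+1 ->
  \sum_(l in D) (cup fs (step p l) (D :\ l) + cup fs p (D :\ l)) = 0.
Proof.
elim: fs p D => [|f fs IH] p D cD /=.
  rewrite (eq_bigr (fun=> 0)) => [|l _]; last exact: addF2.
  by rewrite big1.
have swapD l j : D :\ l :\ j = D :\ j :\ l by rewrite !finset.setDDl finset.setUC.
have szD l : l \in D -> #|D :\ l| = (size fs).+1.
  by move=> lD; apply/eqP; rewrite -eqSS -cD (cardsD1 l D) lD.
rewrite big_split /=.
pose s0 := \sum_(l in D) \sum_(j in D :\ l)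
  f (step p l) * cup fs (step p l) (D :\ l :\ j).
have -> : \sum_(l in D) \sum_(j in D :\ l)
    (f (step p l) + f (step (step p l) j)) *
      cup fs (step (step p l) j) (D :\ l :\ j) = s0.
  under eq_bigr => l _ do (under eq_bigr => j _ do rewrite mulrDl; rewrite big_split).
  rewrite big_split /= [X in _ + X]sum_pairs_sym0 ?addr0; last first.
    by move=> l j; rewrite stepC swapD.
  apply: eq_bigr => l lD; rewrite -!mulr_sumr; congr (_ * _).
  by apply: addF2_eq0; rewrite -big_split IH ?szD.
have -> : \sum_(l in D) \sum_(j in D :\ l)
    (f p + f (step p j)) * cup fs (step p j) (D :\ l :\ j) = s0.
  under eq_bigr => l _ do (under eq_bigr => j _ do rewrite mulrDl; rewrite big_split).
  rewrite big_split /= [X in X + _](_ : _ = 0) ?add0r.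
    rewrite /s0 (exchange_big_dep (mem D)) /=; last by move=> l j _; rewrite inE => /andP[].
    apply: eq_bigr => l lD; apply: eq_big => [j|j _]; last by rewrite swapD.
    by rewrite !inE lD andbT andbC eq_sym.
  transitivity (\sum_(l in D) \sum_(j in D :\ l) f p * cup fs p (D :\ l :\ j)).
    apply: eq_bigr => l lD; rewrite -!mulr_sumr; congr (_ * _).
    by apply: addF2_eq0; rewrite -big_split IH ?szD.
  by apply: sum_pairs_sym0 => l j; rewrite swapD.
exact: addF2.
Qed.

Definition in_cube p D q :=
  forall j, (q j = p j :> nat) \/ (j \in D /\ q j = inord (p j).+1).

(** A factor that is constant on the cube has zero coboundary there, and the expansion of the
    product never leaves the cube. *)
Lemma cup_const0 (I : eqType) (F : I -> point -> 'F_2) i (s : seq I) p D :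
  i \in s -> (forall q, in_cube p D q -> F i q = F i p) -> cup (map F s) p D = 0.
Proof.
elim: s p D => //= g s IH p D; rewrite inE => /orP[/eqP <-|si] fD.
  apply: big1 => l lD; rewrite fD ?addF2 ?mul0r // => h; rewrite ffunE.
  by case: eqP => [->|]; [right|left].
have stp l q : l \in D -> in_cube (step p l) (D :\ l) q -> in_cube p D q.
  move=> lD H h; case: (H h) => [|].
    by rewrite ffunE; case: eqP => [->|_] E; [right; split=> //; exact: val_inj|left].
  by rewrite !inE ffunE => -[/andP[/negbTE->]]; right.
apply: big1 => l lD; rewrite IH ?mulr0 // => q qD.
rewrite fD; last exact: stp lD qD.
by rewrite (fD (step p l)) //; apply: (stp l) => // h; left.
Qed.

Variable s : 'I_m -> point -> bool.
Hypothesis s0 : forall i p, p i = 0 :> nat -> s i p = false.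
Hypothesis s1 : forall i p, p i = k :> nat -> s i p = true.
Hypothesis k_gt0 : (0 < k)%N.

Let sF i p : 'F_2 := (s i p)%:R.

(** Lowest vertices of the cells of a face of the grid, namely the face on which the coordinates
    outside [ds] equal [k]. These faces are the stages of the induction in [cup_total]. *)
Definition box (ds : seq 'I_m) p :=
  [forall j, if j \in ds then (p j < k)%N else p j == k :> nat].

(** Telescoping along direction [l]: the inner layers are counted twice and vanish mod 2. *)
Lemma sum_step (l : 'I_m) (P : pred point) (g : point -> 'F_2) :
  (forall p x, P [ffun j => if j == l then x else p j] = P p) ->
  \sum_(p | P p && (p l < k)%N) (g (step p l) + g p) =
  \sum_(p | P p && (p l == k :> nat)) g p
    + \sum_(p | P p && (p l == 0%N :> nat)) g p.
Proof.
move=> PP; rewrite big_split /=.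
have -> : \sum_(p | P p && (p l < k)%N) g (step p l) =
    \sum_(p | P p && (0 < p l)%N) g p.
  rewrite [RHS](reindex_onto (fun p => step p l)
    (fun p : point => [ffun j => if j == l then inord (p j).-1 else p j])) /=.
    apply: eq_bigl => p; have -> : P (step p l) = P p.
      rewrite -[RHS](PP _ (inord (p l).+1)); congr P; apply/ffunP => j.
      by rewrite !ffunE; case: eqP => // ->.
    rewrite ffunE eqxx; symmetry.
    have [pk|pk] := ltnP (p l) k; rewrite ?andbT ?andbF.
      rewrite inordK // /=; case: (P p) => //=; apply/eqP/ffunP => j.
      by rewrite !ffunE; case: eqP => // ->; rewrite inordK //= inord_val.
    case: (P p) => //=; apply/negbTE; have -> : (p l).+1 = k.+1.
      by apply/eqP; rewrite eqSS eqn_leq pk -ltnS ltn_ord.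
    by rewrite /inord val_insubd ltnn.
  move=> p /andP[_ p0]; apply/ffunP => j; rewrite !ffunE; case: eqP => // ->.
  by rewrite inordK ?prednK ?inord_val // ltnW // ltn_ord.
have E1 : \sum_(p | P p && (0 < p l)%N) g p =
    \sum_(p | P p && (p l == k :> nat)) g p +
    \sum_(p | P p && (0 < p l < k)%N) g p.
  rewrite (bigID (fun p : point => p l == k :> nat)) /=; congr (_ + _);
    apply: eq_bigl => p; rewrite -andbA; congr andb.
    by case: eqP => [->|]; rewrite ?andbT ?andbF.
  by rewrite [(p l < k)%N]ltn_neqAle leq_ord andbT.
have E2 : \sum_(p | P p && (p l < k)%N) g p =
    \sum_(p | P p && (p l == 0%N :> nat)) g p +
    \sum_(p | P p && (0 < p l < k)%N) g p.
  rewrite (bigID (fun p : point => p l == 0%N :> nat)) /=; congr (_ + _);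
    apply: eq_bigl => p; rewrite -andbA; congr andb.
    by case: eqP => [->|]; rewrite ?andbT ?andbF.
  by rewrite andbC lt0n.
by rewrite E1 E2 addrACA addF2 addr0.
Qed.

(** A discrete Stokes formula. The product is the coboundary of the first label times the remaining
    product, so only the boundary of the box counts. On [p i = k] the first label is 1, which leaves
    the induction hypothesis; on [p i = 0] it is 0; on every other face one of the remaining labels
    is constant. *)
Lemma cup_total (ds : seq 'I_m) : uniq ds ->
  \sum_(p | box ds p) cup (map sF ds) p [set j in ds]%SET = 1.
Proof.
elim: ds => [_|i ds IH] /=.
  rewrite (big_pred1 [ffun=> ord_max]) // => p /=.
  apply/forallP/eqP => [H|-> j]; last by rewrite ffunE.
  by apply/ffunP => j; rewrite ffunE; apply: val_inj; apply/eqP; exact: (H j).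
move=> /andP[ids uds].
set D := [set j in i :: ds]%SET.
have cD l : l \in D -> #|D :\ l| = size (map sF ds).
  move=> lD; apply/eqP; rewrite size_map -eqSS (_ : (size ds).+1 = #|D|).
    by rewrite (cardsD1 l D) lD.
  by rewrite cardsE; symmetry; apply/card_uniqP; rewrite /= ids.
have cDD : #|D| = (size (map sF ds)).+1.
  by rewrite -(cD i) ?inE ?eqxx // (cardsD1 i D) !inE eqxx.
under eq_bigr => p _ do
  (under eq_bigr => l _ do rewrite mulrDl addrC; rewrite big_split /=).
(* Since the remaining product is closed, its shifted values may be replaced by those at [p]; each
   term then becomes a difference along [l]. *)
have E p : \sum_(l in D) sF i p * cup (map sF ds) (step p l) (D :\ l) =
    \sum_(l in D) sF i p * cup (map sF ds) p (D :\ l).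
  rewrite -!mulr_sumr; congr (_ * _).
  by apply: addF2_eq0; rewrite -big_split cup_boundary.
under eq_bigr => p _ do rewrite E -big_split /=.
rewrite exchange_big /=.
pose Pb l (p : point) :=
  [forall (j | j != l), if j \in i :: ds then (p j < k)%N else p j == k :> nat].
have PbE l p x : Pb l [ffun j => if j == l then x else p j] = Pb l p.
  by apply: eq_forallb => j; rewrite ffunE; case: (j == l).
have boxE l p : l \in D -> box (i :: ds) p = Pb l p && (p l < k)%N.
  move=> lD; apply/forallP/andP => [H|[/forallP H pl] j].
    split; first by apply/forallP => j; apply/implyP => _; exact: H.
    by have := H l; move: lD; rewrite inE => ->.
  have [->|jl] := eqVneq j l; first by move: lD; rewrite inE => ->.
  by have := H j; rewrite jl.
pose g l p := sF i p * cup (map sF ds) p (D :\ l).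
have K l : l \in D -> \sum_(p | box (i :: ds) p)
    (sF i (step p l) * cup (map sF ds) (step p l) (D :\ l) +
      sF i p * cup (map sF ds) p (D :\ l)) =
    \sum_(p | Pb l p && (p l == k :> nat)) g l p +
    \sum_(p | Pb l p && (p l == 0%N :> nat)) g l p.
  move=> lD; rewrite (eq_bigl _ _ (fun p => boxE l p lD)).
  exact: (@sum_step l (Pb l) (g l)).
rewrite (bigD1 i) ?inE ?eqxx //= [X in _ + X]big1 ?addr0.
  rewrite K ?inE ?eqxx // [X in _ + X]big1 ?addr0.
    rewrite -[RHS]IH //; apply: eq_big => p.
      apply/andP/forallP => [[/forallP H pi] j|H].
        have [->|ji] := eqVneq j i; first by rewrite (negbTE ids).
        by have := H j; rewrite ji inE (negbTE ji).
      split; last by have := H i; rewrite (negbTE ids).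
      by apply/forallP => j; apply/implyP => ji; have := H j; rewrite inE (negbTE ji).
    move=> /andP[_ /eqP pi]; rewrite /g {1}/sF s1 // mul1r; congr cup.
    by apply/finset.setP => j; rewrite !inE; case: eqP => // ->; rewrite (negbTE ids).
  by move=> p /andP[_ /eqP pi]; rewrite /g {1}/sF s0 // mul0r.
move=> l /andP[lD li]; rewrite K // big1 ?add0r ?big1 //.
all: move=> p /andP[_ /eqP pl]; rewrite /g (@cup_const0 _ _ l) ?mulr0 //.
1,3: by move: lD; rewrite !inE (negbTE li).
all: move=> q /(_ l) [ql|[]]; last by rewrite !inE eqxx.
  by rewrite /sF !s0 // ql.
by rewrite /sF !s1 // ql.
Qed.

Definition unit_cube p q := [forall j, (q j == p j) || (q j == inord (p j).+1)].

(** The total over the grid is 1, so some cell has a nonzero product, and by [cup_const0] no label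
    is constant on that cell. *)
Lemma cubical_sperner : exists p : point, (forall j, (p j < k)%N) /\
  forall i, exists q q', [/\ unit_cube p q, unit_cube p q', s i q & ~~ s i q'].
Proof.
have T1 := cup_total (enum_uniq 'I_m).
have /existsP[p /andP[bp Cp]] : [exists p, box (enum 'I_m) p &&
    (cup (map sF (enum 'I_m)) p [set j in enum 'I_m]%SET != 0)].
  apply: contraT; rewrite negb_exists => /forallP H.
  suff: (1 : 'F_2) = 0 by move/eqP; rewrite oner_eq0.
  rewrite -T1 big1 // => p bp; have := H p; rewrite bp /= negbK => /eqP ->//.
exists p; split.
  by move=> j; have /forallP/(_ j) := bp; rewrite mem_enum.
move=> i; have DT : [set j in enum 'I_m]%SET = finset.setT.
  by apply/finset.setP => j; rewrite !inE mem_enum.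
rewrite DT in Cp.
have cp : unit_cube p p by apply/forallP => j; rewrite eqxx.
have [/existsP[q /andP[pq qs]]|] :=
    boolP [exists q : point, unit_cube p q && (s i q != s i p)].
  have [sp|sp] := boolP (s i p).
    by exists p, q; split=> //; move: qs; rewrite sp; case: (s i q).
  by exists q, p; split=> //; move: qs; rewrite (negbTE sp); case: (s i q).
move=> H; case/eqP: Cp; apply: (@cup_const0 _ _ i); first by rewrite mem_enum.
move=> q qp; move: H; rewrite negb_exists => /forallP/(_ q).
have -> /= : unit_cube p q.
  apply/forallP => j; case: (qp j) => [E|[_ ->]]; rewrite ?eqxx ?orbT //.
  by apply/orP; left; apply/eqP/val_inj.
by rewrite negbK => /eqP; rewrite /sF => ->.
Qed.

End CubicalSperner.

(** Only [x] is confined to [K]; compactness of [K] turns the local radii into a single [d]. *)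
Lemma near_unif_continuous (R : realType) (V W : normedModType R) (K : set V)
    (f : V -> W) (e : R) : compact K -> continuous f -> 0 < e ->
  \forall d \near 0^'+, forall x y, K x -> `|x - y| < d -> `|f x - f y| < e.
Proof.
move=> Kc fc e0; pose P (d : R) x := forall y, `|x - y| < d -> `|f x - f y| < e.
suff: \forall d \near 0^'+, K `<=` P d.
  by apply: filterS => d KP x y Kx; exact: KP.
move/compact_near_coveringP : Kc; apply => x Kx.
have e2 : 0 < e / 2 by rewrite divr_gt0.
have /cvgrPdist_lt/(_ _ e2)/nbhs_ballP[r /= r0 fr] := fc x.
have r2 : 0 < r / 2 by rewrite divr_gt0.
near=> x' d => y x'y.
have xx' : `|x - x'| < r / 2.
  by near: x'; have := nbhsx_ballx x _ r2; rewrite -ball_normE.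
have dr : d < r / 2 by near: d; exact: nbhs_right_lt.
have fxy : `|f x - f y| < e / 2.
  apply: fr; rewrite -ball_normE /=.
  rewrite [_ - _](_ : _ = (x - x') + (x' - y)); last by rewrite addrA subrK.
  by rewrite (le_lt_trans (ler_normD _ _)) // (splitr r) ltrD // (lt_trans x'y).
have fxx' : `|f x - f x'| < e / 2 by apply: fr; rewrite -ball_normE /= (lt_le_trans xx') // ler_pdivrMr //; lra.
rewrite [_ - _](_ : _ = - (f x - f x') + (f x - f y)); last by rewrite opprB addrA subrK.
by rewrite (le_lt_trans (ler_normD _ _)) // normrN (splitr e) ltrD.
Unshelve. all: by end_near. Qed.

Definition cube (R : realType) n : set 'rV[R]_n := [set y | forall i, 0 <= y 0 i <= 1].

Lemma cube_compact (R : realType) n : compact (@cube R n).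
Proof.
apply: bounded_closed_compact.
  exists 1; split => // r r1 y yc; rewrite /= rV_norm_le ?(le_trans _ (ltW r1)) // => i.
  by have := yc i; rewrite ler_norml; move=> /andP[]; lra.
rewrite (_ : @cube R n = \bigcap_i [set y : 'rV[R]_n | 0 <= y 0 i <= 1]).
  apply: closed_bigI => i _.
  have /continuous_closedP/(_ `[0, 1]%classic (@interval_closed R (BLeft 0) (BRight 1) isT isT)) :=
    @coord_continuous R 1 n 0 i.
  by congr closed; apply/seteqP; split=> y /=; rewrite in_itv.
by apply/seteqP; split=> [y yc i _|y yc i]; [exact: yc|exact: (yc i I)].
Qed.

(** Without a common zero, the sum of the [|h i|] would have a positive minimum on the cube. Label a
    fine grid by the signs of the [h i]: the Sperner cell has vertices of both signs for every [i],
    so all [h i] are small on it and their sum drops below the minimum. *)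
Theorem poincare_miranda (R : realType) n (h : 'I_n -> 'rV[R]_n -> R) :
  (forall i, continuous (h i)) ->
  (forall i y, cube y -> y 0 i = 0 -> h i y <= 0) ->
  (forall i y, cube y -> y 0 i = 1 -> 0 <= h i y) ->
  exists2 y, cube y & forall i, h i y = 0.
Proof.
move=> hc h0 h1.
have cube0 : @cube R n 0 by move=> i; rewrite mxE lexx ler01.
pose g y := \sum_i `|h i y|.
have gc : continuous g.
  by apply: cts_sum => i _; apply: cts_norm; exact: hc.
have [y yc ymin] := @EVT_min_rV R n g _ (ex_intro _ _ cube0) (@cube_compact R n)
  (continuous_subspaceT gc).
have yg := set_mem yc.
have [gy0|gyN] := eqVneq (g y) 0.
  exists y => // i; apply/eqP; rewrite -normr_eq0; apply/eqP.
  by have /psumr_eq0P := gy0; apply.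
exfalso; have gy_gt0 : 0 < g y by rewrite lt_def gyN sumr_ge0.
(* Dividing by [n.+1] makes the sum of [n] errors strictly smaller than the minimum, and is safe for
   [n = 0]. *)
set e := g y / n.+1%:R; have e0 : 0 < e by rewrite divr_gt0.
have [d /= d0 dP] : exists2 d : R, 0 < d & forall i (x z : 'rV[R]_n), cube x ->
    `|x - z| < d -> `|h i x - h i z| < e.
  have : \forall d \near 0^'+, forall i (x z : 'rV[R]_n), cube x ->
      `|x - z| < d -> `|h i x - h i z| < e.
    by apply: filter_forall => i; apply: near_unif_continuous => //; exact: cube_compact.
  by move=> H; have [d [d0 Hd]] := filter_ex (filterI (nbhs_right_gt (0 : R)) H); exists d.
pose k := (Num.truncn (d^-1)).+1.
have kd : k%:R^-1 < d.
  by rewrite -[ltRHS]invrK ltf_pV2 ?posrE ?invr_gt0 // truncnS_gt.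
have k0 : 0 < k%:R :> R by rewrite ltr0n.
pose Y (q : {ffun 'I_n -> 'I_k.+1}) : 'rV[R]_n := \row_i ((q i)%:R / k%:R).
have Yc q : cube (Y q).
  move=> i; rewrite mxE divr_ge0 ?ler0n //= ler_pdivrMr // mul1r ler_nat.
  exact: leq_ord.
(* The label is forced on the two faces of direction [i]; the boundary conditions on [h i] make it
   agree with the sign there. *)
pose s i (q : {ffun 'I_n -> 'I_k.+1}) :=
  (q i == k :> nat) || ((q i != 0 :> nat)%N && (0 < h i (Y q))).
have [|||p [pk pP]] := @cubical_sperner n k s.
- by move=> i q q0; rewrite /s q0.
- by move=> i q qk; rewrite /s qk eqxx.
- by [].
have near_p q0 : unit_cube p q0 -> `|Y p - Y q0| < d.
  move=> /forallP pq; rewrite rV_norm_lt // => j; rewrite !mxE.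
  case/orP: (pq j) => /eqP ->; first by rewrite subrr normr0.
  rewrite inordK ?ltnS; last exact: (pk j).
  rewrite -mulrBl -natr1 opprD addrA subrr add0r mulN1r normrN.
  by rewrite gtr0_norm ?invr_gt0.
have : g (Y p) < g y.
  apply: (@le_lt_trans _ _ (\sum_(i < n) e)).
    apply: ler_sum => i _; have [q [q' [pq pq' sq sq']]] := pP i.
    have := dP i _ _ (Yc p) (near_p q pq); have := dP i _ _ (Yc p) (near_p q' pq').
    have : 0 <= h i (Y q).
      move: sq => /orP[/eqP qk|/andP[_ /ltW//]].
      by apply: h1 => //; rewrite mxE qk divff // lt0r_neq0.
    have : h i (Y q') <= 0.
      move: sq'; rewrite /s negb_or negb_and negbK leNgt => /andP[_ /orP[/eqP q0|//]].
      by rewrite -leNgt; apply: h0 => //; rewrite mxE q0 mul0r.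
    by rewrite !ltr_norml !ler_norml => ? ? /andP[? ?] /andP[? ?]; apply/andP; split; lra.
  rewrite sumr_const card_ord -[ltLHS]mulr_natr /e mulrAC ltr_pdivrMr //.
  by rewrite ltr_pM2l // ltr_nat.
by rewrite ltNge ymin //; apply: mem_set; exact: Yc.
Qed.

(** * Partitions and covering dimension in cubes *)

Section DistanceToSet.
Context (R : realType) (V : normedModType R).
Implicit Types (A : set V) (x y : V).

(* Capping at 1 keeps the infimum over a nonempty set when [A] is empty. *)
Definition dist_to A y : R := inf ([set 1] `|` [set `|y - a| | a in A]).

Let lb A y : has_lbound ([set 1] `|` [set `|y - a| | a in A]).
Proof. by exists 0 => _ [->|[a _ <-]]; rewrite ?ler01. Qed.

Lemma dist_to_ge0 A y : 0 <= dist_to A y.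
Proof.
apply: lb_le_inf; first by exists 1; left.
by move=> _ [->|[a _ <-]]; rewrite ?ler01.
Qed.

Lemma dist_to_mem A y : A y -> dist_to A y = 0.
Proof.
move=> Ay; apply/eqP; rewrite eq_le dist_to_ge0 andbT.
by apply: ge_inf => //; right; exists y => //; rewrite subrr normr0.
Qed.

Lemma dist_to_eq0 A y : closed A -> dist_to A y = 0 -> A y.
Proof.
move=> cA d0; apply: cA => B /nbhs_ballP[e /= e0 yB].
have me : 0 < Num.min e 1 by rewrite lt_min e0 ltr01.
have [|_ [->|[a Aa <-]]] := inf_adherent me (conj _ (lb A y)).
- by exists 1; left.
- by rewrite -/(dist_to A y) d0 add0r lt_min ltxx andbF.
rewrite -/(dist_to A y) d0 add0r lt_min => /andP[ae _].
by exists a; split=> //; apply: yB; rewrite -ball_normE.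
Qed.

Lemma dist_to_lip A x y : dist_to A x <= dist_to A y + `|x - y|.
Proof.
rewrite -lerBlDr; apply: lb_le_inf; first by exists 1; left.
move=> _ [->|[a Aa <-]]; rewrite lerBlDr.
  by rewrite (@le_trans _ _ 1) ?lerDl //; apply: ge_inf => //; left.
apply: (@le_trans _ _ `|x - a|); first by apply: ge_inf => //; right; exists a.
by rewrite [leRHS]addrC; exact: ler_distD.
Qed.

Lemma dist_to_continuous A : continuous (dist_to A).
Proof.
move=> x; apply/cvgrPdist_le => e e0; near=> y.
have xy : `|x - y| <= e.
  by near: y; apply: cvgr_dist_le => //; exact: cvg_id.
have := dist_to_lip A x y; have := dist_to_lip A y x; rewrite (distrC y x).
by rewrite ler_norml => ? ?; apply/andP; split; lra.
Unshelve. all: by end_near. Qed.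

End DistanceToSet.

Section CubeSeparation.
Context (R : realType) (n : nat) (X : topologicalType) (g : 'rV[R]_n.+1 -> X).
Hypothesis gc : continuous g.

Let face_closed (i : 'I_n.+1) (a : R) : closed (@cube R n.+1 `&` [set y | y 0 i = a]).
Proof.
apply: closedI.
  by apply: compact_closed; [exact: norm_hausdorff|exact: cube_compact].
have /continuous_closedP/(_ [set a] (@closed_eq _ _)) := @coord_continuous R 1 n.+1 0 i.
exact.
Qed.

(** Poincare-Miranda for differences of distances: a zero in direction 0 lies in [K], and zeros in
    the other directions avoid [O i] and [O' i]. In the application [K] is the preimage of a
    separating set and [O i], [O' i] come from a partition inside that set, hence disjointness is
    asked on [K] only. *)
Lemma cube_partitions (U V : set X) (O O' : 'I_n -> set 'rV[R]_n.+1) :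
  open U -> open V -> (forall y, U y -> V y -> False) ->
  (forall y, cube y -> y 0 0 = 0 -> U (g y)) ->
  (forall y, cube y -> y 0 0 = 1 -> V (g y)) ->
  let K := [set y | [/\ cube y, ~ U (g y) & ~ V (g y)]] in
  (forall i, open (O i)) -> (forall i, open (O' i)) ->
  (forall i y, K y -> O i y -> O' i y -> False) ->
  (forall i y, K y -> y 0 (lift ord0 i) = 0 -> O i y) ->
  (forall i y, K y -> y 0 (lift ord0 i) = 1 -> O' i y) ->
  exists2 y, K y & forall i, ~ O i y /\ ~ O' i y.
Proof.
move=> oU oV UV gU gV K oO oO' OO' KO KO'.
have oUV (W : set X) : open W -> closed (~` (g @^-1` W)).
  by move=> oW; apply: open_closedC; move/continuousP : gc; exact.
have Kc : closed K.
  rewrite (_ : K = @cube R n.+1 `&` (~` (g @^-1` U) `&` ~` (g @^-1` V))).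
    apply: closedI; first by apply: compact_closed; [exact: norm_hausdorff|exact: cube_compact].
    by apply: closedI; exact: oUV.
  by apply/seteqP; split=> y /=; [case|case=> ? []].
(* The faces are added to get the right signs on the whole cube. Their points in [K] lie in [O i],
   respectively [O' i], so they create no unwanted zero. *)
pose E i := (K `&` ~` O' i) `|` (@cube R n.+1 `&` [set y | y 0 (lift ord0 i) = 0]).
pose E' i := (K `&` ~` O i) `|` (@cube R n.+1 `&` [set y | y 0 (lift ord0 i) = 1]).
have cE i : closed (E i).
  by apply: closedU; [apply: closedI => //; exact: open_closedC|exact: face_closed].
have cE' i : closed (E' i).
  by apply: closedU; [apply: closedI => //; exact: open_closedC|exact: face_closed].
pose h (j : 'I_n.+1) y := if unlift ord0 j is Some i
  then dist_to (E i) y - dist_to (E' i) y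
  else dist_to (~` (g @^-1` V)) y - dist_to (~` (g @^-1` U)) y.
have hc j : continuous (h j).
  by rewrite /h; case: (unlift _ _) => [i|]; apply: ctsB; exact: dist_to_continuous.
have [||y yc hy] := poincare_miranda hc.
- move=> j y yc; rewrite /h; case: unliftP => [i ->|->] yj; rewrite subr_le0 dist_to_mem ?dist_to_ge0 //.
    by right.
  by move=> Vy; exact: (UV _ (gU y yc yj)).
- move=> j y yc; rewrite /h; case: unliftP => [i ->|->] yj; rewrite subr_ge0 [leLHS]dist_to_mem ?dist_to_ge0 //.
    by right.
  by move=> /UV; apply; exact: gV.
have Ky : K y.
  have := hy ord0; rewrite /h unlift_none => /eqP; rewrite subr_eq0 => /eqP UVy.
  split=> // [Uy|Vy].
    suff /(dist_to_eq0 (oUV _ oU)) : dist_to (~` (g @^-1` U)) y = 0 by [].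
    by rewrite -UVy dist_to_mem // => Vy; exact: UV Uy Vy.
  suff /(dist_to_eq0 (oUV _ oV)) : dist_to (~` (g @^-1` V)) y = 0 by [].
  by rewrite UVy dist_to_mem // => Uy; exact: UV Uy Vy.
exists y => // i; have := hy (lift ord0 i); rewrite /h liftK => /eqP; rewrite subr_eq0 => /eqP EE.
split=> [Oy|Oy].
  have : E' i y.
    by apply: dist_to_eq0 => //; rewrite -EE dist_to_mem //; left; split=> // /(OO' i y Ky Oy).
  by case=> [[_]//|[_ /(KO' i y Ky)]]; exact: OO'.
have : E i y.
  by apply: dist_to_eq0 => //; rewrite EE dist_to_mem //; left; split=> // /(OO' i y Ky); exact.
by case=> [[_]//|[_ /(KO i y Ky)]] /(OO' i y Ky); exact.
Qed.

End CubeSeparation.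

Section Ostrand.
Context (R : realType) (T : topologicalType) (N : nat) (phi : 'I_N -> T -> R).
Implicit Types S : {set 'I_N}.

(* As in Ostrand's theorem: [dominance S] is supported where all [phi k] with
   [k] in [S] exceed the others, so sets [S] of equal size have disjoint supports. *)
Definition dominance S y : R :=
  (\prod_(k in S) phi k y) *
  \prod_(k in S) \prod_(j in finset.setC S) Num.max 0 (phi k y - phi j y).

Hypothesis phi_ge0 : forall k y, 0 <= phi k y.

Lemma dominance_ge0 S y : 0 <= dominance S y.
Proof.
apply: mulr_ge0; first exact: prodr_ge0.
by apply: prodr_ge0 => k _; apply: prodr_ge0 => j _; rewrite le_max lexx.
Qed.

Lemma dominance_pos S y k : dominance S y != 0 -> k \in S -> 0 < phi k y.
Proof.
rewrite mulf_eq0 negb_or => /andP[/prodf_neq0 H _] kS.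
by rewrite lt_def phi_ge0 H.
Qed.

(** With [k] only in [S] and [j] only in [S'], each of [phi j y] and [phi k y] would be smaller than
    the other. *)
Lemma dominance_disjoint S S' y : #|S| = #|S'| ->
  dominance S y != 0 -> dominance S' y != 0 -> S = S'.
Proof.
move=> cS FS FS'.
have lt (A : {set 'I_N}) k j : dominance A y != 0 -> k \in A -> j \notin A -> phi j y < phi k y.
  rewrite mulf_eq0 negb_or => /andP[_ /prodf_neq0 H] kA jA.
  have /prodf_neq0/(_ j) := H k kA; rewrite finset.in_setC jA => /(_ isT).
  by rewrite ltNge; apply: contra => kj; rewrite max_l // subr_le0.
apply/eqP; rewrite eqEcard cS leqnn andbT; apply/negPn/negP => /subsetPn[k kS kS'].
have /subsetPn[j jS' jS] : ~~ (S' \subset S).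
  apply/negP => S'S; have /eqP SS : S' == S by rewrite eqEcard S'S cS leqnn.
  by rewrite SS kS in kS'.
by have := lt_trans (lt _ _ _ FS kS jS) (lt _ _ _ FS' jS' kS'); rewrite ltxx.
Qed.

Lemma dominance_support y : dominance [set k | 0 < phi k y]%SET y != 0.
Proof.
rewrite mulf_eq0 negb_or; apply/andP; split; apply/prodf_neq0 => k; rewrite inE => pk.
  exact: lt0r_neq0.
apply/prodf_neq0 => j; rewrite !inE -leNgt => pj.
by rewrite lt0r_neq0 // lt_max subr_gt0 (le_lt_trans pj) // orbT.
Qed.

Hypothesis phi_cont : forall k, continuous (phi k).

Lemma dominance_continuous S : continuous (dominance S).
Proof.
apply: ctsM; first by apply: cts_prod => k _.
apply: cts_prod => k _; apply: cts_prod => j _.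
by apply: cts_max; [exact: cts_cst|exact: ctsB].
Qed.

End Ostrand.

(** Cover [Y] by open sets that miss, in each of [n.+1] directions, one of two opposite faces, and
    refine to order at most [n]. Sets of indices of the refinement are grouped by size, one size
    among 1, ..., [n.+1] per direction, and [sgn] gives the dominance of each set the sign allowed
    by the face it misses. At a common zero, the indices with positive [phi] form a nonempty set of
    at most [n.+1] elements whose dominance is the only nonzero term in its direction, a
    contradiction. *)
Lemma covering_dim_cube (R : realType) (n : nat) (X Y : topologicalType)
    (i : Y -> X) (g : 'rV[R]_n.+2 -> X) (h0 : 'rV[R]_n.+2 -> R) :
  hausdorff_space X ->
  continuous i -> (forall V, open V -> exists2 O, open O & V = i @^-1` O) ->
  continuous g -> continuous h0 ->
  (forall y, cube y -> y 0 0 = 0 -> h0 y <= 0) ->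
  (forall y, cube y -> y 0 0 = 1 -> 0 <= h0 y) ->
  (forall y, cube y -> h0 y = 0 -> exists z, i z = g y) ->
  (forall (j : 'I_n.+1) y y', cube y -> cube y' -> g y = g y' ->
     y 0 (lift ord0 j) = 0 -> y' 0 (lift ord0 j) = 1 -> False) ->
  ~ covering_dim_le Y n.
Proof.
move=> TX ic iopen gc h0c h00 h01 h0Y gj dimY.
pose face (j : 'I_n.+1) (a : R) := @cube R n.+2 `&` [set y | y 0 (lift ord0 j) = a].
have facec j a : compact (face j a).
  apply: compact_closedI; first exact: cube_compact.
  have /continuous_closedP/(_ [set a] (@closed_eq _ _)) :=
    @coord_continuous R 1 n.+2 0 (lift ord0 j).
  exact.
pose A j (b : bool) : set Y := i @^-1` (g @` face j b%:R).
have Ac j b : closed (A j b).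
  have /continuous_closedP := ic; apply; apply: compact_closed => //.
  by apply: continuous_compact => //; exact/continuous_subspaceT.
pose Us : set (set Y) := range (fun a : {ffun 'I_n.+1 -> bool} => \bigcap_j ~` A j (a j)).
have [|||Vs [Vfin Vop Vcov VU Vord]] := dimY Us.
- by apply: finite_image; exact: finite_finset.
- by move=> _ [a _ <-]; apply: open_bigcap_fin => j _; exact: closed_openC.
- apply/seteqP; split=> // z _.
  exists (\bigcap_j ~` A j ([ffun j => ~~ `[< A j true z >]] j)); first by eexists.
  move=> j _; rewrite ffunE; case: asboolP => //= Aj [y [yc yj] gy].
  by case: Aj => y' [y'c y'j] gy'; apply: (gj j y y') => //; rewrite gy gy'.
have [s0 sE] := (finite_seqP Vs).1 Vfin.
(* Duplicates are removed because the order bound counts distinct members, while [S] below counts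
   indices. *)
pose s := undup s0; pose N := size s.
have Vk (k : 'I_N) : Vs (nth set0 s k).
  by rewrite sE /= -mem_undup mem_nth.
have /boolp.choice[Og OP] (k : 'I_N) : exists W, open W /\ nth set0 s k = i @^-1` W.
  by have [W ? ?] := iopen _ (Vop _ (Vk k)); exists W.
pose miss (k : 'I_N) j b := `[< forall z, nth set0 s k z -> ~ A j b z >].
have missP k j : miss k j false || miss k j true.
  have [U [a _ <-] kU] := VU _ (Vk k).
  by case aj : (a j); apply/orP; [right|left]; apply/asboolP => z /kU/(_ j I); rewrite aj.
(* Off the image of [Y], the open set [Og k] may meet faces that the [k]-th member misses; they are
   cut out again. *)
pose G k : set 'rV[R]_n.+2 := g @^-1` (Og k) `&`
  \bigcap_(jb in [set jb : 'I_n.+1 * bool | miss k jb.1 jb.2])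
    [set y | y 0 (lift ord0 jb.1) != jb.2%:R].
have Gop k : open (G k).
  apply: openI; first by have /continuousP := gc; apply; case: (OP k).
  apply: open_bigcap_fin => jb _.
  have /continuousP/(_ (~` [set jb.2%:R])) :=
    @coord_continuous R 1 n.+2 0 (lift ord0 jb.1).
  move=> /(_ (closed_openC (@closed_eq _ _))); congr open.
  by apply/seteqP; split=> y /= /eqP.
pose phi k y := dist_to (~` G k) y.
have phi0 k y : 0 <= phi k y by exact: dist_to_ge0.
have phiG k y : 0 < phi k y <-> G k y.
  rewrite lt_def phi0 andbT; split=> [/eqP pk|Gk].
    by apply: contrapT => nG; apply: pk; exact: dist_to_mem.
  by apply/eqP => /(dist_to_eq0 (open_closedC (Gop k))).
have phic k : continuous (phi k) by exact: dist_to_continuous.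
(* If no member of [S] misses face 0, then by [missP] all of them miss face 1. *)
pose sgn j (S : {set 'I_N}) : R := if [exists k in S, miss k j false] then 1 else -1.
pose h (j : 'I_n.+2) y := if unlift ord0 j is Some j'
  then \sum_(S : {set 'I_N} | #|S| == j'.+1) sgn j' S * dominance phi S y
  else h0 y.
have hc j : continuous (h j).
  rewrite /h; case: (unlift _ _) => [j'|] //.
  apply: cts_sum => S _.
  by apply: ctsM; [exact: cts_cst|exact: dominance_continuous].
have [||y yc hy] := poincare_miranda hc.
- move=> j y yc; rewrite /h; case: unliftP => [j' ->|->] yj; last exact: h00.
  apply: sumr_le0 => S _; have [->|FS] := eqVneq (dominance phi S y) 0; first by rewrite mulr0.
  rewrite /sgn; case: ifP => [/existsP[k /andP[kS kj]]|_].
    have /phiG[_ /(_ (j', false) kj)] := dominance_pos phi0 FS kS.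
    by rewrite /= yj eqxx.
  by rewrite mulN1r oppr_le0 dominance_ge0.
- move=> j y yc; rewrite /h; case: unliftP => [j' ->|->] yj; last exact: h01.
  apply: sumr_ge0 => S /eqP cS; have [->|FS] := eqVneq (dominance phi S y) 0; first by rewrite mulr0.
  rewrite /sgn; case: ifPn => [_|/existsPn nS]; first by rewrite mul1r dominance_ge0.
  have [k kS] : exists k, k \in S by apply/set0Pn; rewrite -cards_eq0 cS.
  have /phiG[_ kG] := dominance_pos phi0 FS kS.
  have := missP k j'; have := nS k; rewrite kS /= => /negbTE -> /= /(kG (j', true)).
  by rewrite /= yj eqxx.
have [z zy] : exists z, i z = g y by apply: h0Y => //; have := hy ord0; rewrite /h unlift_none.
pose S := [set k | 0 < phi k y]%SET.
have kS k : k \in S -> nth set0 s k z.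
  by rewrite inE => /phiG[gk _]; rewrite (OP k).2 /= zy.
have S_gt0 : (0 < #|S|)%N.
  have : (\bigcup_(V in Vs) V) z by rewrite Vcov.
  rewrite sE => -[V /=]; rewrite -mem_undup => sV Vz.
  have kN : (index V s < N)%N by rewrite index_mem.
  have Ez : nth set0 s (Ordinal kN) z by rewrite /= nth_index.
  apply/card_gt0P; exists (Ordinal kN); rewrite inE; apply/phiG; split.
    by have := Ez; rewrite (OP _).2 /= zy.
  move=> [j b] /= /asboolP/(_ _ Ez) mA; apply/eqP => yj; apply: mA.
  by exists y.
have S_le : (#|S| <= n.+1)%N.
  rewrite leqNgt; apply/negP => ltS.
  pose f c := nth set0 s (nth 0%N (map val (enum S)) c).
  have zs : size (map val (enum S)) = #|S| by rewrite size_map -cardE.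
  have cS c : (c < n.+2)%N -> exists2 k, k \in S & nth 0%N (map val (enum S)) c = k :> nat.
    move=> cn; have : nth 0%N (map val (enum S)) c \in map val (enum S).
      by rewrite mem_nth // zs (leq_trans cn).
    by move=> /mapP[k]; rewrite mem_enum => ? ?; exists k.
  have : \bigcap_(W in f @` `I_n.+2) W = set0; first apply: Vord.
  - by move=> _ [c cn <-]; rewrite /f; have [k _ ->] := cS c cn; exact: Vk.
  - apply: inj_card_eq => c d /set_mem cn /set_mem dn; rewrite /f.
    have [k kS' Ek] := cS c cn; have [l lS' El] := cS d dn.
    rewrite Ek El => /eqP; rewrite nth_uniq ?undup_uniq ?ltn_ord //.
    move/eqP; rewrite -Ek -El => /eqP; rewrite nth_uniq ?zs ?(leq_trans cn) ?(leq_trans dn) //.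
      by move/eqP.
    by rewrite map_inj_uniq ?enum_uniq //; exact: val_inj.
  - move=> W0; suff : (set0 : set Y) z by [].
    rewrite -W0 => _ [c cn <-]; rewrite /f.
    have [k ? ->] := cS c cn; exact: kS.
have jS : (#|S|.-1 < n.+1)%N by rewrite prednK.
have := hy (lift ord0 (Ordinal jS)); rewrite /h liftK (bigD1 S) /=; last by rewrite prednK.
have FS := dominance_support phi y.
rewrite big1 ?addr0 => [|S' /andP[/eqP cS' nS']]; last first.
  have [->|FS'] := eqVneq (dominance phi S' y) 0; first by rewrite mulr0.
  case/eqP: nS'; apply: (dominance_disjoint _ FS' FS).
  by rewrite cS' /= prednK.
move/eqP; rewrite mulf_eq0 (negbTE FS) orbF /sgn; case: ifP => _; rewrite ?oppr_eq0 oner_eq0 //.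
Qed.

(** * The Vietoris topology and the Hausdorff distance *)

Definition mk_set_type (T : Type) (A : set T) x (Ax : A x) : set_type A :=
  exist _ x (mem_set Ax).

Section SetTypes.
Context (X : topologicalType).

Lemma set_val_continuous (A : set X) : continuous (set_val : set_type A -> X).
Proof. exact: initial_continuous. Qed.

Lemma set_type_continuous (T : topologicalType) (A : set X) (f : T -> set_type A) :
  continuous (fun t => set_val (f t)) -> continuous f.
Proof. by move=> fc; exact: continuous_comp_initial. Qed.

Lemma set_type_open (A : set X) (V : set (set_type A)) : open V ->
  exists2 W, open W & V = set_val @^-1` W.
Proof. by move=> [W oW <-]; exists W. Qed.

Lemma hausdorff_inj (Y : topologicalType) (f : Y -> X) : continuous f -> injective f ->
  hausdorff_space X -> hausdorff_space Y.
Proof.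
move=> fc fi TX p q pq; apply/fi/TX => A B Ap Bq.
have [y [Ay By]] := pq _ _ (fc p A Ap) (fc q B Bq).
by exists (f y).
Qed.

Lemma set_type_hausdorff (A : set X) : hausdorff_space X -> hausdorff_space (set_type A).
Proof. by apply: hausdorff_inj; [exact: set_val_continuous|exact: val_inj]. Qed.

End SetTypes.

Section HausdorffClose.
Context (R : realType) (V : normedModType R).
Implicit Types (A B C : set V) (e : R).

Definition hclose e A B :=
  (forall a, A a -> exists2 b, B b & `|a - b| < e) /\
  (forall b, B b -> exists2 a, A a & `|a - b| < e).

Lemma hclose_refl e A : 0 < e -> hclose e A A.
Proof. by move=> e0; split=> a Aa; exists a; rewrite ?subrr ?normr0. Qed.

Lemma hcloseU e A A' B B' : hclose e A B -> hclose e A' B' ->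
  hclose e (A `|` A') (B `|` B').
Proof.
move=> [AB BA] [AB' BA']; split=> x [].
- by move=> /AB[b]; exists b => //; left.
- by move=> /AB'[b]; exists b => //; right.
- by move=> /BA[b]; exists b => //; left.
- by move=> /BA'[b]; exists b => //; right.
Qed.

Lemma hclose_image (W : Type) (K : set W) (f g : W -> V) e :
  (forall x, K x -> `|f x - g x| < e) -> hclose e (f @` K) (g @` K).
Proof.
move=> fg; split=> _ [x Kx <-]; first by exists (g x); [exists x|exact: fg].
by exists (f x); [exists x|exact: fg].
Qed.

(** Compactness of [C] gives a uniform margin inside the union of the open sets, and finitely many
    points of [C] witness that each of them is met. *)
Lemma hclose_open (U : set (continua V)) (C : continua V) : open U -> U C ->
  exists2 e, 0 < e & forall D : continua V, hclose e C D -> U D.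
Proof.
move=> [DD DDs <-] [Us UsD [CU UC]].
have [Ufin Uop] := DDs _ UsD.
have [_ Cc _] := set_valP C.
have : \forall e \near 0^'+, forall x y, set_of_continuum C x -> `|x - y| < e ->
    (\bigcup_(W in Us) W) y.
  pose P (d : R) (x : V) := forall y, `|x - y| < d -> (\bigcup_(W in Us) W) y.
  suff: \forall d \near 0^'+, (set_of_continuum C) `<=` P d.
    by apply: filterS => d KP x y Kx; exact: KP.
  move/compact_near_coveringP : Cc; apply => x /CU[W UW Wx].
  have /nbhs_ballP[r /= r0 rW] : nbhs x W by apply: open_nbhs_nbhs; split=> //; exact: Uop.
  have r2 : 0 < r / 2 by rewrite divr_gt0.
  near=> x' d => y x'y; exists W => //; apply: rW; rewrite -ball_normE /=.
  have xx' : `|x - x'| < r / 2.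
    by near: x'; have := nbhsx_ballx x _ r2; rewrite -ball_normE.
  have dr : d < r / 2 by near: d; exact: nbhs_right_lt.
  by rewrite (le_lt_trans (ler_distD x' _ _)) // (splitr r) ltrD // (lt_trans x'y).
have : \forall e \near 0^'+, forall D : continua V, hclose e C D ->
    forall W, Us W -> W `&` set_of_continuum D !=set0.
  have [s sE] := (finite_seqP Us).1 Ufin.
  suff : \forall e \near 0^'+, forall D : continua V, hclose e C D ->
      forall W, W \in s -> W `&` set_of_continuum D !=set0.
    by apply: filterS => e He D CD W; rewrite sE; exact: He.
  have : forall W, W \in s -> Us W by rewrite sE.
  elim: s {sE} => [|W s IH] Ws; first by apply: nearW => e D _ W; rewrite in_nil.
  have UW : Us W by apply: Ws; rewrite mem_head.
  have [x [Wx Cx]] := UC W UW.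
  have /nbhs_ballP[r /= r0 rW] : nbhs x W by apply: open_nbhs_nbhs; split=> //; exact: Uop.
  have := IH (fun W' sW' => Ws W' (@mem_behead _ (W :: s) W' sW')).
  move=> He; near=> e => D CD W'; rewrite inE => /orP[/eqP ->|sW'].
    have [y Dy xy] := CD.1 x Cx; exists y; split=> //; apply: rW; rewrite -ball_normE /=.
    by rewrite (lt_trans xy) //; near: e; exact: nbhs_right_lt.
  by move: D CD W' sW'; near: e.
move=> H1 H2; have [e [e0 [eC eD]]] :=
  filter_ex (filterI (nbhs_right_gt (0 : R)) (filterI H1 H2)).
exists e => // D CD; exists Us => //; split; last exact: eC.
by move=> y /CD.2[x Cx xy]; exact: eD xy.
Unshelve. all: by end_near. Qed.

(** Stated for plain sets, so that unions and images can be treated apart from compactness and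
    connectedness. *)
Definition hcont (T : topologicalType) (E : T -> set V) :=
  forall t e, 0 < e -> \forall t' \near t, hclose e (E t) (E t').

Lemma hcont_continuous (T : topologicalType) (E : T -> continua V) :
  hcont (fun t => set_of_continuum (E t)) -> continuous E.
Proof.
move=> Eh t A; rewrite nbhsE => -[U [oU Ut] UA].
have [e e0 eU] := hclose_open oU Ut.
by apply: filterS (Eh t e e0) => t' tt'; apply: UA; exact: eU.
Qed.

End HausdorffClose.

Lemma continua_inj (X : topologicalType) : injective (@set_of_continuum X).
Proof. by move=> C D; exact: val_inj. Qed.

Lemma vietoris_open (X : topologicalType) (Us : set (set X)) :
  finite_opens Us -> open (vietoris Us).
Proof.
move=> fo; exists [set Us]; first by move=> _ ->.
by rewrite bigcup_set1.
Qed.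

(** If [c] lies in [C] but not in [D], a small ball about [c] distinguishes the continua that meet
    it from those that stay away from it. *)
Lemma continua_hausdorff (R : realType) (V : normedModType R) :
  hausdorff_space (continua V).
Proof.
rewrite open_hausdorff => C D CD.
wlog [c Cc Dc] : C D CD / exists2 c, set_of_continuum C c & ~ set_of_continuum D c.
  move=> W; have [H|H] := pselect (exists2 c, set_of_continuum C c & ~ set_of_continuum D c).
    exact: W.
  have H' : exists2 c, set_of_continuum D c & ~ set_of_continuum C c.
    apply: contrapT => H'; move/eqP: CD; apply; apply: continua_inj.
    apply/seteqP; split=> x Ax; apply: contrapT => Bx; first by apply: H; exists x.
    by apply: H'; exists x.
  have DC : D != C by rewrite eq_sym.
  have [[A B] [DA CB] [oA oB AB]] := W D C DC H'.
  by exists (B, A) => //; split=> //; rewrite setIC.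
have [_ Dk _] := set_valP D.
have cD : closed (set_of_continuum D) by apply: compact_closed => //; exact: norm_hausdorff.
have /nbhs_ballP[r /= r0 rD] : nbhs c (~` set_of_continuum D).
  by apply: open_nbhs_nbhs; split=> //; exact: closed_openC.
have r2 : 0 < r / 2 by rewrite divr_gt0.
pose B := [set x | r / 2 < `|c - x|].
have oB : open B.
  have /continuousP/(_ [set x | r / 2 < x] (@open_gt R _)) : continuous (fun x : V => `|c - x|).
    by apply: cts_norm; apply: ctsB; [exact: cts_cst|move=> ?; exact: cvg_id].
  exact.
pose A := [set x | `|c - x| < r / 2].
have oA : open A.
  have /continuousP/(_ [set x | x < r / 2] (@open_lt R _)) : continuous (fun x : V => `|c - x|).
    by apply: cts_norm; apply: ctsB; [exact: cts_cst|move=> ?; exact: cvg_id].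
  exact.
exists (vietoris [set A; setT], vietoris [set B]); first split; rewrite ?inE.
- split=> [x _|U [->|->]]; first by exists setT => //; right.
    by exists c; split=> //; rewrite /A /= subrr normr0.
  by rewrite setTI; case: (set_valP C).
- have DB x : set_of_continuum D x -> B x.
    move=> Dx; rewrite /B /= ltNge; apply/negP => cx; apply: (rD x) => //.
    by rewrite -ball_normE /= (le_lt_trans cx) //; lra.
  split=> [x Dx|U ->]; first by exists B => //; exact: DB.
  have [[d Dd] _ _] := set_valP D; exists d; split=> //; exact: DB.
split.
- apply: vietoris_open; split; first exact: finite_set2.
  by move=> U [->|->]; [exact: oA|exact: openT].
- by apply: vietoris_open; split=> [|U ->]; [exact: finite_set1|exact: oB].
apply/seteqP; split=> // E [[_ EA] [EB _]].
have [x [Ax Ex]] := EA A (or_introl erefl).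
have [_ -> Bx] := EB x Ex.
by have := lt_trans Ax Bx; rewrite ltxx.
Qed.

(** * Arcs and simple closed curves *)

(** A continuous map from a compact set to a Hausdorff space is closed, hence a quotient map onto
    its image, and [q] descends along it. *)
Lemma quotient_map_factor (T Y Z : topologicalType) (K : set T) (p : T -> Y) (q : T -> Z) :
  compact K -> continuous p -> continuous q -> hausdorff_space Y ->
  (forall s t, K s -> K t -> p s = p t -> q s = q t) ->
  exists F : set_type (p @` K) -> set_type (q @` K), continuous F /\
    forall y s, K s -> set_val y = p s -> set_val (F y) = q s.
Proof.
move=> Kc pc qc TY pq.
have /boolp.choice[s sP] (y : set_type (p @` K)) : exists s, K s /\ p s = set_val y.
  by have [s Ks sy] := set_valP y; exists s.
pose F y := mk_set_type (A := q @` K) (ex_intro2 _ _ (s y) (sP y).1 erefl).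
have Fq y t : K t -> set_val y = p t -> set_val (F y) = q t.
  by move=> Kt yt; apply: pq => //; case: (sP y) => // _ ->.
exists F; split=> //; apply: set_type_continuous; apply/continuous_closedP => D cD.
have -> : (fun t => set_val (F t)) @^-1` D = set_val @^-1` (p @` (K `&` q @^-1` D)).
  apply/seteqP; split=> y /=; first by move=> ?; exists (s y); [split|]; case: (sP y).
  by move=> [t [Kt Dt] ty]; rewrite (Fq y t).
have /continuous_closedP := @set_val_continuous Y (p @` K); apply.
apply: compact_closed => //; apply: continuous_compact; first exact: continuous_subspaceT.
by apply: compact_closedI => //; have /continuous_closedP := qc; exact.
Qed.

Lemma homeomorphic_fibers (T Y Z : topologicalType) (K : set T) (p : T -> Y) (q : T -> Z) :
  compact K -> continuous p -> continuous q -> hausdorff_space Y -> hausdorff_space Z ->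
  (forall s t, K s -> K t -> p s = p t <-> q s = q t) ->
  homeomorphic (set_type (p @` K)) (set_type (q @` K)).
Proof.
move=> Kc pc qc TY TZ pq.
have [F [Fc FE]] := quotient_map_factor Kc pc qc TY (fun s t Ks Kt => (pq s t Ks Kt).1).
have [G [Gc GE]] := quotient_map_factor Kc qc pc TZ (fun s t Ks Kt => (pq s t Ks Kt).2).
exists F, G; split=> // y; apply: val_inj; have [s Ks sy] := set_valP y.
  by rewrite -[RHS]sy; apply: GE => //; exact: FE.
by rewrite -[RHS]sy; apply: FE => //; exact: GE.
Qed.

Lemma ord2_cases (i : 'I_2) : i = 0 \/ i = 1.
Proof. by case: i => -[|[|//]] p; [left|right]; exact: val_inj. Qed.

Section Circle.
Context (R : realType).

Lemma cos_sinD2pi_int (t : R) (n : int) :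
  cos (pi *+ 2 * (t + n%:~R)) = cos (pi *+ 2 * t) /\
  sin (pi *+ 2 * (t + n%:~R)) = sin (pi *+ 2 * t).
Proof.
have nat t' (k : nat) : cos (pi *+ 2 * (t' + k%:R)) = cos (pi *+ 2 * t') :> R /\
    sin (pi *+ 2 * (t' + k%:R)) = sin (pi *+ 2 * t') :> R.
  elim: k => [|k [IHc IHs]]; first by rewrite addr0.
  by rewrite -natr1 addrA mulrDr mulr1 cosD2pi sinD2pi.
case: n => k; first exact: nat.
rewrite NegzE mulrNz; have [<- <-] := nat (t - k.+1%:R) k.+1.
by rewrite subrK.
Qed.

(** Pass to the fractional part [r]. Cosine is injective on [0, pi], and for [r > 1/2] the angle of
    [1 - r] falls into that range. *)
Lemma cos2pi_eq1 (t : R) : cos (pi *+ 2 * t) = 1 -> t \is a Num.int.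
Proof.
have [r0 r1] : 0 <= t - (Num.floor t)%:~R /\ t - (Num.floor t)%:~R < 1.
  by rewrite subr_ge0 floor_le ltrBlDl -intrD1 floorD1_gt.
set r := t - _ in r0 r1 *.
have pi0 := pi_gt0 R.
rewrite -(subrK (Num.floor t)%:~R t) -/r (cos_sinD2pi_int _ _).1 => c1.
suff -> : r = 0 by rewrite add0r intr_int.
have inj (x : R) : 0 <= x <= pi -> cos x = 1 -> x = 0.
  move=> xpi cx; have := @cos_inj R x 0.
  by rewrite !in_itv /= xpi lexx ltW // cos0 => /(_ isT isT cx).
have [r2|r2] := leP r (2^-1).
  have /eqP : pi *+ 2 * r = 0.
    apply: inj => //; rewrite -mulr_natr; apply/andP; split; nra.
  by rewrite mulf_eq0 mulrn_eq0 /= gt_eqF // => /eqP.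
have /eqP : pi *+ 2 * (1 - r) = 0.
  apply: inj; first by rewrite -mulr_natr; apply/andP; split; nra.
  by rewrite mulrBr mulr1 addrC cosD2pi cosN.
by rewrite mulf_eq0 mulrn_eq0 /= gt_eqF //= subr_eq0 => /eqP r_eq; rewrite r_eq ltxx in r1.
Qed.

Definition circle_point (t : R) : 'rV[R]_2 :=
  \row_i if i == 0 then cos (pi *+ 2 * t) else sin (pi *+ 2 * t).

Lemma circle_point_continuous : continuous circle_point.
Proof.
apply: cts_row => i.
have lin : continuous (fun t : R => pi *+ 2 * t).
  by apply: ctsM; [exact: cts_cst|move=> ?; exact: cvg_id].
by case: (i == 0); apply: (cts_comp lin); [exact: continuous_cos|exact: continuous_sin].
Qed.

Lemma circle_point_eq (s t : R) : circle_point s = circle_point t <-> s - t \is a Num.int.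
Proof.
split=> [/rowP st|/intrP[n /eqP]].
  have := st 0; have := st 1; rewrite !mxE /= => sst cst.
  apply: cos2pi_eq1; rewrite mulrBr cosB cst sst.
  by have := cos2Dsin2 (pi *+ 2 * t); rewrite !expr2.
rewrite subr_eq addrC => /eqP ->; have [c1 s1] := cos_sinD2pi_int t n.
by apply/rowP => i; rewrite !mxE; case: ifP.
Qed.

Lemma circle_point_range : circle_point @` `[0, 1] = @unit_circle R.
Proof.
apply/seteqP; split=> [_ [t _ <-]|x /= x1].
  by rewrite /unit_circle /= !mxE /= cos2Dsin2.
have pi0 := pi_gt0 R.
have c1 : -1 <= x 0 0 <= 1.
  by rewrite -ler_norml -(@expr_le1 _ 2) // real_normK ?num_real // -x1 lerDl sqr_ge0.
have pi2 : pi *+ 2 != 0 :> R by rewrite mulrn_eq0 /= gt_eqF.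
pose a := acos (x 0 0) / (pi *+ 2).
have aE : pi *+ 2 * a = acos (x 0 0) by rewrite mulrC divfK.
have a0 : 0 <= a by rewrite divr_ge0 ?acos_ge0 // mulrn_wge0 // ltW.
have a1 : a <= 1.
  have pp : 0 < pi *+ 2 :> R by rewrite mulr2n addr_gt0.
  by rewrite ler_pdivrMr // mul1r (le_trans (acos_lepi _)) // mulr2n lerDl ltW.
have sE : Num.sqrt (1 - x 0 0 ^+ 2) = `|x 0 1|.
  by rewrite -x1 addrC addKr sqrtr_sqr.
have [x10|x10] := leP 0 (x 0 1).
  exists a; first by rewrite /= in_itv /= a0.
  apply/rowP => i; rewrite mxE aE acosK // sin_acos // sE ger0_norm //.
  by case: (ord2_cases i) => ->.
exists (1 - a); first by rewrite /= in_itv /= subr_ge0 a1 lerBlDr lerDl.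
apply/rowP => i; rewrite mxE mulrBr mulr1 aE addrC cosD2pi sinD2pi cosN sinN acosK // sin_acos //.
rewrite sE ltr0_norm // opprK.
by case: (ord2_cases i) => ->.
Qed.

End Circle.

Section Loops.
Context (R : realType) (V : normedModType R).
Implicit Types (A : set V) (g : R -> V).

Lemma segment01_compact : compact (`[0, 1]%classic : set R).
Proof. exact: segment_compact. Qed.

(** The curve and the circle are quotients of [0, 1] by the same relation. *)
Lemma loop_homeomorphic g : continuous g ->
  (forall s t, 0 <= s <= 1 -> 0 <= t <= 1 -> g s = g t <-> s - t \is a Num.int) ->
  homeomorphic (set_type (g @` `[0, 1])) (set_type (@unit_circle R)).
Proof.
move=> gc gE; rewrite -circle_point_range.
apply: homeomorphic_fibers => //; try exact: norm_hausdorff.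
- exact: segment01_compact.
- exact: circle_point_continuous.
move=> s t /=; rewrite !in_itv /= => s01 t01; rewrite gE //.
by rewrite circle_point_eq.
Qed.

(** The parametrization is periodic on the whole line, which permits shifts of the parameter when
    the curve is rounded to a lattice. *)
Lemma homeomorphic_loop A : homeomorphic (set_type A) (set_type (@unit_circle R)) ->
  exists g, [/\ continuous g, A = g @` `[0, 1] &
    forall s t, g s = g t <-> s - t \is a Num.int].
Proof.
move=> [f [f' [fK f'K fc f'c]]].
have cT t : @unit_circle R (circle_point t).
  by rewrite /unit_circle /= !mxE /= cos2Dsin2.
pose c t := mk_set_type (cT t).
have cc : continuous c by apply: set_type_continuous; exact: circle_point_continuous.
exists (fun t => set_val (f' (c t))); split.
- by apply: (cts_comp _ (@set_val_continuous _ _)); exact: (cts_comp cc).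
- apply/seteqP; split=> [x Ax|_ [t _ <-]]; last exact: set_valP.
  have [t t01 tE] : (@circle_point R @` `[0, 1]) (set_val (f (mk_set_type Ax))).
    by rewrite circle_point_range; exact: set_valP.
  exists t => //; have -> : c t = f (mk_set_type Ax) by apply: val_inj.
  by rewrite fK.
move=> s t; rewrite -circle_point_eq; split=> [/val_inj st|st].
  by have := congr1 set_val (can_inj f'K st).
by congr (set_val (f' _)); exact: val_inj.
Qed.

Definition arc A p q := exists g, [/\ continuous g, g 0 = p, g 1 = q,
  (forall s t, 0 <= s <= 1 -> 0 <= t <= 1 -> g s = g t -> s = t) & A = g @` `[0, 1]].

(** Adding the two clamped curves and subtracting the junction avoids any pasting: on each half, one
    of the summands rests at the junction. *)
Lemma cat_curves g1 g2 : continuous g1 -> continuous g2 -> g1 1 = g2 0 ->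
  exists g, [/\ continuous g, (forall t, 0 <= t <= 2^-1 -> g t = g1 (2 * t)) &
    (forall t, 2^-1 <= t <= 1 -> g t = g2 (2 * t - 1))].
Proof.
move=> g1c g2c g12; pose clamp (t : R) := Num.max 0 (Num.min 1 t).
have clampc : continuous clamp.
  apply: cts_max; first exact: cts_cst.
  by apply: cts_min; [exact: cts_cst|move=> ?; exact: cvg_id].
have lin : continuous (fun t : R => 2 * t).
  by apply: ctsM; [exact: cts_cst|move=> ?; exact: cvg_id].
exists (fun t => g1 (clamp (2 * t)) + g2 (clamp (2 * t - 1)) - g2 0); split.
- apply: ctsB; last exact: cts_cst.
  have lin1 : continuous (fun t : R => 2 * t - 1) by apply: ctsB => //; exact: cts_cst.
  apply: ctsD; first exact: (cts_comp (cts_comp lin clampc) g1c).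
  exact: (cts_comp (cts_comp lin1 clampc) g2c).
- move=> t t01; rewrite /clamp (min_r (_ : 2 * t <= 1)); last by lra.
  rewrite (max_r (_ : 0 <= 2 * t)); last by lra.
  rewrite min_r; last by lra.
  by rewrite max_l ?addrK //; lra.
- move=> t t01; rewrite /clamp (min_l (_ : 1 <= 2 * t)); last by lra.
  rewrite (max_r (_ : 0 <= 1 :> R)) // min_r; last by lra.
  rewrite max_r; last by lra.
  by rewrite g12 addrAC subrr add0r.
Qed.

Lemma arc_ends A p q : arc A p q -> [/\ A p, A q & p != q].
Proof.
move=> [g [gc g0 g1 gi ->]]; split.
- by exists 0 => //=; rewrite in_itv /= lexx ler01.
- by exists 1 => //=; rewrite in_itv /= lexx ler01.
by rewrite -g0 -g1; apply/eqP => /gi; rewrite !lexx !ler01 => /(_ isT isT)/eqP; rewrite eq_sym oner_eq0.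
Qed.

Lemma arc_compact A p q : arc A p q -> compact A.
Proof.
move=> [g [gc _ _ _ ->]]; apply: continuous_compact; last exact: segment01_compact.
exact: continuous_subspaceT.
Qed.

Lemma arc_rev A p q : arc A p q -> arc A q p.
Proof.
move=> [g [gc g0 g1 gi ->]].
have rc : continuous (fun t : R => 1 - t).
  by apply: ctsB; [exact: cts_cst|move=> ?; exact: cvg_id].
exists (fun t => g (1 - t)); split; rewrite ?subr0 ?subrr //.
- exact: (cts_comp rc gc).
- move=> s t s01 t01 /gi st.
  have : 1 - s = 1 - t by apply: st; lra.
  by lra.
apply/seteqP; split=> y [t /=]; rewrite in_itv /= => t01 <-; exists (1 - t);
  rewrite /= ?in_itv /= ?subKr //; lra.
Qed.

Lemma half_cases (t : R) : 0 <= t <= 1 -> (0 <= t <= 2^-1) \/ (2^-1 < t <= 1).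
Proof. by move=> t01; have [t2|t2] := leP t 2^-1; [left|right]; lra. Qed.

Lemma cat_image g1 g2 g :
    (forall t, 0 <= t <= 2^-1 -> g t = g1 (2 * t)) ->
    (forall t, 2^-1 <= t <= 1 -> g t = g2 (2 * t - 1)) ->
  g @` `[0, 1] = g1 @` `[0, 1] `|` g2 @` `[0, 1].
Proof.
move=> gl gr; apply/seteqP; split=> [y [t /=]|y [|] [t /=]]; rewrite in_itv /= => t01 <-.
- have [t2|t2] := half_cases t01; [left|right].
    by rewrite gl //; exists (2 * t) => //; rewrite /= in_itv /=; lra.
  rewrite gr; last by lra.
  by exists (2 * t - 1) => //; rewrite /= in_itv /=; lra.
- exists (t / 2); first by rewrite /= in_itv /=; lra.
  by rewrite gl; [congr g1; lra|lra].
exists ((t + 1) / 2); first by rewrite /= in_itv /=; lra.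
by rewrite gr; [congr g2; lra|lra].
Qed.

Lemma arc_cat A B p q r : arc A p q -> arc B q r -> A `&` B `<=` [set q] ->
  arc (A `|` B) p r.
Proof.
move=> [g1 [g1c g10 g11 g1i ->]] [g2 [g2c g20 g21 g2i ->]] AB.
have [|g [gc gl gr]] := cat_curves g1c g2c; first by rewrite g11.
have mixed s t : 0 <= s <= 2^-1 -> 2^-1 < t <= 1 -> g s = g t -> False.
  move=> s01 t01; rewrite gl // gr; last by lra.
  move=> gst; have gq : g2 (2 * t - 1) = q.
    apply: AB; split; first by exists (2 * s) => //; rewrite /= in_itv /=; lra.
    by exists (2 * t - 1) => //; rewrite /= in_itv /=; lra.
  have : 2 * t - 1 = 0 by apply: g2i; rewrite ?gq ?g20 //; lra.
  lra.
exists g; split=> //.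
- by rewrite gl ?mulr0 //; lra.
- by rewrite gr; [rewrite -g21; congr g2; lra|lra].
- move=> s t s01 t01; have [s2|s2] := half_cases s01; have [t2|t2] := half_cases t01 => gst.
  + have : 2 * s = 2 * t by apply: g1i; rewrite -?gl //; lra.
    lra.
  + by case: (mixed s t).
  + by case: (mixed t s).
  + have : 2 * s - 1 = 2 * t - 1 by apply: g2i; rewrite -?gr //; lra.
    lra.
by rewrite (cat_image gl gr).
Qed.

Lemma arc_loop A B p q : arc A p q -> arc B q p -> A `&` B `<=` [set p; q] ->
  homeomorphic (set_type (A `|` B)) (set_type (@unit_circle R)).
Proof.
move=> [g1 [g1c g10 g11 g1i ->]] [g2 [g2c g20 g21 g2i ->]] AB.
have [|g [gc gl gr]] := cat_curves g1c g2c; first by rewrite g11.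
rewrite -(cat_image gl gr); apply: loop_homeomorphic => //.
have g0 : g 0 = p by rewrite gl ?mulr0 //; lra.
have g1E : g 1 = p by rewrite gr; [rewrite -g21; congr g2; lra|lra].
have mixed s t : 0 <= s <= 2^-1 -> 2^-1 < t <= 1 -> g s = g t -> s = 0 /\ t = 1.
  move=> s01 t01; rewrite gl // gr; last by lra.
  move=> gst; have [] : [set p; q] (g2 (2 * t - 1)).
  - apply: AB; split; first by exists (2 * s) => //; rewrite /= in_itv /=; lra.
    by exists (2 * t - 1) => //; rewrite /= in_itv /=; lra.
  - move=> gp.
    have : 2 * t - 1 = 1 by apply: g2i; rewrite ?gp ?g21 //; lra.
    have : 2 * s = 0 by apply: g1i; rewrite ?gst ?gp ?g10 //; lra.
    by move=> ? ?; split; lra.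
  - move=> gq.
    have : 2 * t - 1 = 0 by apply: g2i; rewrite ?gq ?g20 //; lra.
    lra.
move=> s t s01 t01; split; last first.
  move=> /intrP[n stn].
  have st1 : (-1 <= s - t) && (s - t <= 1) by lra.
  have n1 : ((-1 : int) <= n) && (n <= (1 : int)).
    by move: st1; rewrite stn -(@ler_int R) -(@ler_int R n) mulrN1z.
  have [n0|[n0|n0]] : n = 0 \/ n = 1 \/ n = -1 by lia.
  - by have -> : s = t by move: stn; rewrite n0; lra.
  - have -> : s = 1 by move: stn; rewrite n0; lra.
    have -> : t = 0 by move: stn; rewrite n0; lra.
    by rewrite g0.
  - have -> : t = 1 by move: stn; rewrite n0; lra.
    have -> : s = 0 by move: stn; rewrite n0; lra.
    by rewrite g0.
have [s2|s2] := half_cases s01; have [t2|t2] := half_cases t01 => gst.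
- have st : 2 * s = 2 * t by apply: g1i; rewrite -?gl //; lra.
  have -> : s - t = 0 by lra.
  exact: rpred0.
- have [-> ->] := mixed s t s2 t2 gst.
  by rewrite sub0r rpredN rpred1.
- have [-> ->] := mixed t s t2 s2 (esym gst).
  by rewrite subr0 rpred1.
have st : 2 * s - 1 = 2 * t - 1 by apply: g2i; rewrite -?gr //; lra.
have -> : s - t = 0 by lra.
exact: rpred0.
Qed.

End Loops.

Lemma arc_image (R : realType) (V W : normedModType R) (f : V -> W) (A : set V) p q :
  continuous f -> injective f -> arc A p q -> arc (f @` A) (f p) (f q).
Proof.
move=> fc fi [g [gc g0 g1 gi ->]]; exists (fun t => f (g t)); split; rewrite ?g0 ?g1 //.
- exact: (cts_comp gc fc).
- by move=> s t s01 t01 /fi; exact: gi.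
by rewrite image_comp.
Qed.

(** * Curves with spikes *)

Section Tents.
Context (R : realType).
Implicit Types (x : nat -> R) (u : R) (j k N : nat).

(** The intervals [1/(j+2), 1/(j+1)] tile (0, 1] and accumulate at 0, where [frame] has its vertical
    segment. *)
Definition tent_left j : R := j.+2%:R^-1.
Definition tent_right j : R := j.+1%:R^-1.
Definition tent_mid j : R := (tent_left j + tent_right j) / 2.
Definition tent_width j : R := (tent_right j - tent_left j) / 2.
Definition tent j u : R := Num.max 0 (1 - `|u - tent_mid j| / tent_width j).

Lemma tent_left_gt0 j : 0 < tent_left j. Proof. by rewrite invr_gt0. Qed.

Lemma tent_left_right j : tent_left j < tent_right j.
Proof. by rewrite ltf_pV2 ?posrE // ltr_nat. Qed.

Lemma tent_width_gt0 j : 0 < tent_width j.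
Proof. by rewrite divr_gt0 // subr_gt0 tent_left_right. Qed.

Lemma tent_right_le1 j : tent_right j <= 1.
Proof. by rewrite invf_le1 // ler1n. Qed.

Lemma tent_right_leq j k : (j <= k)%N -> tent_right k <= tent_right j.
Proof. by move=> jk; rewrite lef_pV2 ?posrE // ler_nat. Qed.

Lemma tent_leftE j : tent_left j = tent_right j.+1. Proof. by []. Qed.

Lemma tent_mid_bounds j : tent_left j < tent_mid j < tent_right j.
Proof. by have := tent_left_right j; rewrite /tent_mid => ?; apply/andP; split; lra. Qed.

Lemma tent_ge0 j u : 0 <= tent j u. Proof. by rewrite le_max lexx. Qed.

Lemma tent_le1 j u : tent j u <= 1.
Proof.
by rewrite ge_max ler01 gerBl divr_ge0 // ltW // tent_width_gt0.
Qed.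

Lemma tent_midE j : tent j (tent_mid j) = 1.
Proof. by rewrite /tent subrr normr0 mul0r subr0 max_r. Qed.

Lemma tent_support j u : tent j u != 0 -> tent_left j < u < tent_right j.
Proof.
rewrite /tent; case: (leP (1 - `|u - tent_mid j| / tent_width j) 0) => [w0|w0 _].
  by rewrite eqxx.
move: w0; rewrite subr_gt0 ltr_pdivrMr ?tent_width_gt0 // mul1r ltr_norml /tent_mid /tent_width.
by move=> /andP[? ?]; apply/andP; split; lra.
Qed.

Lemma tent_out j u : (u <= tent_left j) || (tent_right j <= u) -> tent j u = 0.
Proof.
move=> out; apply/eqP; apply: contraLR out => /tent_support/andP[lu ur].
by rewrite negb_or -!ltNge lu ur.
Qed.

Lemma tent_continuous j : continuous (tent j).
Proof.
apply: cts_max; first exact: cts_cst.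
apply: ctsB; first exact: cts_cst.
apply: ctsM; last exact: cts_cst.
by apply: cts_norm; apply: ctsB; [move=> ?; exact: cvg_id|exact: cts_cst].
Qed.

(* The only index whose tent can be nonzero at [u]. *)
Definition tent_index u : nat := (Num.truncn u^-1).-1.

Lemma tent_indexP j u : tent j u != 0 -> tent_index u = j.
Proof.
move=> /tent_support/andP[lu ur]; have u0 := lt_trans (tent_left_gt0 j) lu.
rewrite /tent_index; suff -> : Num.truncn u^-1 = j.+1 by [].
apply: truncn_def; rewrite -[X in X <= _ < _]invrK -[X in _ <= _ < X]invrK.
by rewrite lef_pV2 ?ltf_pV2 ?posrE ?invr_gt0 // (ltW ur) lu.
Qed.

(** The series of all [x j * tent j u], written as its only term that can be nonzero, so that no
    convergence question arises. *)
Definition spikes x u : R := x (tent_index u) * tent (tent_index u) u.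

Lemma spikes_tent x u j : (forall k, k != j -> tent k u = 0) -> spikes x u = x j * tent j u.
Proof.
move=> H; rewrite /spikes; have [->//|nj] := eqVneq (tent_index u) j.
rewrite (H _ nj) mulr0; have [->|/tent_indexP] := eqVneq (tent j u) 0; first by rewrite mulr0.
by move=> E; rewrite E eqxx in nj.
Qed.

Lemma spikes_itv x u j : tent_left j <= u <= tent_right j -> spikes x u = x j * tent j u.
Proof.
move=> /andP[lu ur]; apply: spikes_tent => k kj; apply: tent_out.
case: (ltngtP k j) kj => // kj _.
  by rewrite (le_trans ur) // tent_leftE tent_right_leq.
by rewrite orbC (le_trans _ lu) // tent_leftE tent_right_leq.
Qed.

Lemma spikes_mid x j : spikes x (tent_mid j) = x j.
Proof.
rewrite (@spikes_itv _ _ j) ?tent_midE ?mulr1 //.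
by have /andP[/ltW -> /ltW ->] := tent_mid_bounds j.
Qed.

Lemma spikes_left x j : spikes x (tent_left j) = 0.
Proof.
by rewrite (@spikes_itv _ _ j) ?lexx ?(ltW (tent_left_right j)) // tent_out ?mulr0 ?lexx.
Qed.

Lemma spikes_out x u : (u <= 0) || (1 <= u) -> spikes x u = 0.
Proof.
move=> out; rewrite /spikes tent_out ?mulr0 //; case/orP: out => u0.
  by rewrite (le_trans u0) // ltW // tent_left_gt0.
by rewrite (le_trans (tent_right_le1 _) u0) orbT.
Qed.

Lemma spikes0 u : spikes (fun=> 0) u = 0.
Proof. by rewrite /spikes mul0r. Qed.

(** Away from 0 only finitely many tents count, so there the graph is well behaved for every [x]. *)
Lemma spikes_sum x N u : (u <= 0) || (tent_right N <= u) ->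
  spikes x u = \sum_(j < N) x j * tent j u.
Proof.
move=> uN; have [t0|t0] := eqVneq (tent (tent_index u) u) 0.
  rewrite /spikes t0 mulr0 big1 // => j _.
  have [->|/[dup] tj /tent_indexP jE] := eqVneq (tent j u) 0; first by rewrite mulr0.
  by move: tj; rewrite -jE t0 eqxx.
have jN : (tent_index u < N)%N.
  have /andP[lu ur] := tent_support t0; have u0 := lt_trans (tent_left_gt0 _) lu.
  move: uN; rewrite leNgt u0 /= => uN; rewrite ltnNge; apply/negP => NJ.
  by have := le_lt_trans uN ur; rewrite ltNge tent_right_leq.
rewrite (bigD1 (Ordinal jN)) //= big1 ?addr0 // => j nj.
have [->|/tent_indexP jE] := eqVneq (tent j u) 0; first by rewrite mulr0.
by case/eqP: nj; apply: val_inj.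
Qed.

Lemma spikes_bound x u (e : R) : 0 <= e -> (forall j, `|x j| <= e) -> `|spikes x u| <= e.
Proof.
move=> e0 xe; rewrite /spikes normrM (ger0_norm (tent_ge0 _ _)).
by rewrite -[leRHS]mulr1 ler_pM ?tent_ge0 ?tent_le1.
Qed.

Lemma spikesB x y u : spikes x u - spikes y u = spikes (fun j => x j - y j) u.
Proof. by rewrite /spikes mulrBl. Qed.

Lemma sum_tents_continuous x N : continuous (fun u => \sum_(j < N) x j * tent j u).
Proof.
by apply: cts_sum => j _; apply: ctsM; [exact: cts_cst|exact: tent_continuous].
Qed.

(** Uniform limit of the finite sums: the supports of the tents do not overlap, so the error of a
    truncation is at most the largest [|x j|] left out. *)
Lemma spikes_continuous x : x @ \oo --> (0 : R) -> continuous (spikes x).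
Proof.
move=> x0 u; apply/cvgrPdist_lt => e e0.
have e3 : 0 < e / 3 by rewrite divr_gt0.
have /cvgrPdist_lt/(_ _ e3)[N _ xN] := x0.
pose y j := if (j < N)%N then x j else 0.
have ySum v : spikes y v = \sum_(j < N) x j * tent j v.
  rewrite /spikes /y; case: ltnP => jN.
    rewrite (bigD1 (Ordinal jN)) //= big1 ?addr0 // => j nj.
    have [->|/tent_indexP jE] := eqVneq (tent j v) 0; first by rewrite mulr0.
    by case/eqP: nj; apply: val_inj.
  rewrite mul0r big1 // => j _.
  have [->|/tent_indexP jE] := eqVneq (tent j v) 0; first by rewrite mulr0.
  by have := ltn_ord j; rewrite ltnNge -jE jN.
have xy v : `|spikes x v - spikes y v| <= e / 3.
  rewrite spikesB; apply: spikes_bound => [|j]; first exact: ltW.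
  rewrite /y; case: ltnP => jN; first by rewrite subrr normr0 ltW.
  by rewrite subr0; have := xN j jN; rewrite /= sub0r normrN => /ltW.
have /cvgrPdist_lt/(_ _ e3) := @sum_tents_continuous x N u.
apply: filterS => v; rewrite -!ySum => yuv.
have := xy u; have := xy v; rewrite (distrC (spikes x v)) => xv xu.
apply: (le_lt_trans (ler_distD (spikes y u) _ _)).
rewrite (_ : e = e / 3 + (e / 3 + e / 3)); last by lra.
by apply: ler_ltD => //; apply: (le_lt_trans (ler_distD (spikes y v) _ _)); exact: ltr_leD.
Qed.

End Tents.

Section Polygons.
Context (R : realType) (n : nat).
Implicit Types (a b : 'rV[R]_n) (A B : set 'rV[R]_n).

Lemma segmentP a b p : segment a b p <-> exists2 t, 0 <= t <= 1 & p = (1 - t) *: a + t *: b.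
Proof.
by split=> [[t /=]|[t t01 ->]]; [rewrite in_itv /= => t01 <-|]; exists t => //=; rewrite in_itv.
Qed.

Lemma segment_left a b : segment a b a.
Proof. by apply/segmentP; exists 0; rewrite ?lexx ?ler01 // subr0 scale1r scale0r addr0. Qed.

Lemma segment_right a b : segment a b b.
Proof. by apply/segmentP; exists 1; rewrite ?lexx ?ler01 // subrr scale1r scale0r add0r. Qed.

Lemma segment_sym a b : segment a b = segment b a.
Proof.
have sub (c d : 'rV[R]_n) : segment c d `<=` segment d c.
  move=> p /segmentP[t t01 ->]; apply/segmentP; exists (1 - t); first by lra.
  by rewrite subKr addrC.
by apply/seteqP; split; exact: sub.
Qed.

Lemma segmentxx a : segment a a = [set a].
Proof.
apply/seteqP; split=> [p /segmentP[t _ ->]|_ ->]; last exact: segment_left.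
by rewrite -scalerDl subrK scale1r.
Qed.

Lemma segment_param_continuous a b : continuous (fun t : R => (1 - t) *: a + t *: b).
Proof.
have idc : continuous (fun t : R => t) by move=> ?; exact: cvg_id.
apply: ctsD; apply: ctsZ => //; try exact: cts_cst.
by apply: ctsB => //; exact: cts_cst.
Qed.

Lemma segment_arc a b : a != b -> arc (segment a b) a b.
Proof.
move=> ab; exists (fun t : R => (1 - t) *: a + t *: b); split=> //.
- exact: segment_param_continuous.
- by rewrite subr0 scale1r scale0r addr0.
- by rewrite subrr scale1r scale0r add0r.
move=> s t _ _ st; apply/eqP; rewrite -subr_eq0.
have : (s - t) *: (b - a) == 0.
  rewrite [_ *: _](_ : _ = ((1 - s) *: a + s *: b) - ((1 - t) *: a + t *: b)).
    by rewrite st subrr.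
  by apply/rowP => i; rewrite !mxE; ring.
rewrite scaler_eq0 => /orP[//|ba]; case/eqP: ab; apply/eqP.
by rewrite eq_sym -subr_eq0.
Qed.

Lemma segment_rV_connected a b : connected (segment a b).
Proof.
apply: connected_continuous_connected; first exact: segment_connected.
by apply: continuous_subspaceT; exact: segment_param_continuous.
Qed.

Lemma segment_compact_rV a b : compact (segment a b).
Proof.
apply: continuous_compact; last exact: segment01_compact.
by apply: continuous_subspaceT; exact: segment_param_continuous.
Qed.

Lemma polygonal0 : finite_union_of_segments (@set0 'rV[R]_n).
Proof. by exists 0%N, (fun=> 0), (fun=> 0); rewrite II0 bigcup_set0. Qed.

Lemma polygonal_segment a b : finite_union_of_segments (segment a b).
Proof.
exists 1%N, (fun=> a), (fun=> b); apply/seteqP; split=> [p ?|p [i _]//].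
by exists 0%N.
Qed.

Lemma polygonalU A B : finite_union_of_segments A -> finite_union_of_segments B ->
  finite_union_of_segments (A `|` B).
Proof.
move=> [m [a [b ->]]] [m' [a' [b' ->]]].
exists (m + m')%N, (fun i => if (i < m)%N then a i else a' (i - m)%N),
  (fun i => if (i < m)%N then b i else b' (i - m)%N).
apply/seteqP; split=> [p [[i /= im ip]|[i /= im ip]]|p [i /= im]].
- by exists i => /=; rewrite ?im // ltn_addr.
- by exists (m + i)%N => /=; rewrite ?ltn_add2l // ltnNge leq_addr /= addKn.
case: ltnP => mi ip; first by left; exists i.
by right; exists (i - m)%N => //=; lia.
Qed.

Lemma polygonal_bigcup (m : nat) (F : nat -> set 'rV[R]_n) :
  (forall i, (i < m)%N -> finite_union_of_segments (F i)) ->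
  finite_union_of_segments (\bigcup_(i < m) F i).
Proof.
elim: m => [|m IH] FP; first by rewrite II0 bigcup_set0; exact: polygonal0.
have -> : \bigcup_(i < m.+1) F i = \bigcup_(i < m) F i `|` F m.
  apply/seteqP; split=> [p [i /= im Fp]|p [[i /= im Fp]|Fp]].
  - by move: im; rewrite ltnS leq_eqVlt => /orP[/eqP <-|im]; [right|left; exists i].
  - by exists i => //=; exact: ltnW.
  - by exists m => /=.
apply: polygonalU; last exact: FP.
by apply: IH => i im; apply: FP; exact: ltnW.
Qed.

Lemma segment_image (f : 'rV[R]_n -> 'rV[R]_n) a b :
  (forall t, f ((1 - t) *: a + t *: b) = (1 - t) *: f a + t *: f b) ->
  f @` segment a b = segment (f a) (f b).
Proof.
move=> fE; apply/seteqP; split=> [_ [_ [t t01 <-] <-]|_ [t t01 <-]].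
  by exists t.
by exists ((1 - t) *: a + t *: b); [exists t|].
Qed.

Lemma polygonal_image (f : 'rV[R]_n -> 'rV[R]_n) A :
  (forall t a b, f ((1 - t) *: a + t *: b) = (1 - t) *: f a + t *: f b) ->
  finite_union_of_segments A -> finite_union_of_segments (f @` A).
Proof.
move=> fE [m [a [b ->]]]; rewrite image_bigcup; apply: polygonal_bigcup => i _.
by rewrite segment_image //; exact: polygonal_segment.
Qed.

End Polygons.

(** Meant for the graph over (0, 1] and the vertical segment over 0, which may be joined as in the
    topologist's sine curve. *)
Lemma connectedU_closure (T : topologicalType) (A B : set T) : connected A -> connected B ->
  closure A `&` B !=set0 -> connected (A `|` B).
Proof.
move=> cA cB [x [clx Bx]]; apply: contrapT => /connectedPn[E [E0 AB sE]].
have [sA sB] : A `<=` E false `|` E true /\ B `<=` E false `|` E true.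
  by rewrite -AB; split=> y; [left|right].
have clE (b : bool) : closure (E b) `&` E (~~ b) = set0.
  by case: b; case: sE => // ? ; rewrite setIC.
have key (b : bool) : A `<=` E b -> B `<=` E b -> False.
  move=> Ab Bb; have [y Ey] := E0 (~~ b).
  have Eb z : (E false `|` E true) z -> E b z by rewrite -AB => -[/Ab|/Bb].
  suff : (set0 : set T) y by [].
  rewrite -(clE b); split=> //; apply: subset_closure; apply: Eb.
  by clear -Ey; case: b Ey => /= ?; [left|right].
have key2 (b : bool) : A `<=` E b -> B `<=` E (~~ b) -> False.
  move=> Ab Bb; suff : (set0 : set T) x by [].
  by rewrite -(clE b); split; [apply: (closureS Ab)|exact: Bb].
have [Af|At] := connected_subset sE sA cA; have [Bf|Bt] := connected_subset sE sB cB.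
- exact: (key false).
- exact: (key2 false).
- exact: (key2 true).
- exact: (key true).
Qed.

Section Hat.
Context (R : realType) (n : nat).
Local Notation V := 'rV[R]_n.+2.
Implicit Types (x : nat -> R) (B : set V) (y z : V).

(** Working in dimension [n.+2] treats the plane and space together: the spikes and the frame stay
    in the plane of the first two coordinates, and only the arc [B] uses the others. *)
Definition pt (u v : R) : V :=
  \row_i if i == 0 then u else if i == 1 then v else 0.

Lemma pt0 u v : pt u v 0 0 = u. Proof. by rewrite mxE eqxx. Qed.
Lemma pt1 u v : pt u v 0 1 = v. Proof. by rewrite mxE. Qed.

Lemma pt_inj u v u' v' : pt u v = pt u' v' -> u = u' /\ v = v'.
Proof. by move=> /rowP E; have := E 0; have := E 1; rewrite !pt0 !pt1. Qed.

Lemma pt_convex (t u v u' v' : R) :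
  (1 - t) *: pt u v + t *: pt u' v' = pt ((1 - t) * u + t * u') ((1 - t) * v + t * v').
Proof.
by apply/rowP => i; rewrite !mxE; case: ifP => // _; case: ifP => // _; ring.
Qed.

Lemma pt_norm_lt (u v u' v' e : R) : 0 < e -> `|u - u'| < e -> `|v - v'| < e ->
  `|pt u v - pt u' v'| < e.
Proof.
move=> e0 ue ve; apply/rV_norm_lt => // i; rewrite !mxE.
by case: ifP => // _; case: ifP => // _; rewrite subrr normr0.
Qed.

Lemma pt_continuous (T : topologicalType) (f g : T -> R) : continuous f -> continuous g ->
  continuous (fun t => pt (f t) (g t)).
Proof.
move=> fc gc; apply: cts_row => i.
by case: (i == 0) => //; case: (i == 1) => //; exact: cts_cst.
Qed.

Lemma segment_ptP u v u' v' y : segment (pt u v) (pt u' v') y <->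
  exists2 t, 0 <= t <= 1 & y = pt ((1 - t) * u + t * u') ((1 - t) * v + t * v').
Proof. by split=> [/segmentP|] [t t01 ->]; [|apply/segmentP]; exists t; rewrite ?pt_convex. Qed.

(** The graph of the spikes bridges the gap from (0, 0) to (1, 0), and [B] is attached at the feet
    (-1, -1) and (1, -1). *)
Definition frame : set V :=
  segment (pt (-1) (-1)) (pt (-1) 1) `|` segment (pt (-1) 1) (pt 0 1)
    `|` segment (pt 0 1) (pt 0 0) `|` segment (pt 1 0) (pt 1 (-1)).

Definition spike_graph x : set V := (fun u => pt u (spikes x u)) @` `[0, 1].

(* For [x] in [0,1]^N the spikes accumulate on the vertical segment of [frame]
   at u = 0, so that [hat x] depends continuously on [x], but it is locally
   connected only if [x] tends to 0. *)
Definition hat x : set V := spike_graph x `|` frame.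

Lemma frameP y : frame y -> exists u v, [/\ y = pt u v, -1 <= u <= 1, -1 <= v <= 1 &
  [\/ u = -1, (u <= 0 /\ v = 1), (u = 0 /\ 0 <= v) | (u = 1 /\ v <= 0)]].
Proof.
by move=> [[[|]|]|] /segment_ptP[t t01 ->]; eexists; eexists; (split; [reflexivity|lra|lra|]);
  [constructor 1|constructor 2|constructor 3|constructor 4]; lra.
Qed.

Lemma spike_graphP x y : spike_graph x y -> exists2 u, 0 <= u <= 1 & y = pt u (spikes x u).
Proof. by move=> [u /=]; rewrite in_itv /= => u01 <-; exists u. Qed.

Lemma spike_graph_mem x u : 0 <= u <= 1 -> spike_graph x (pt u (spikes x u)).
Proof. by move=> u01; exists u => //=; rewrite in_itv. Qed.

Lemma spike_graph0 : spike_graph (fun=> 0) = segment (pt 0 0) (pt 1 0).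
Proof.
apply/seteqP; split=> y.
  move=> /spike_graphP[u u01 ->]; apply/segment_ptP; exists u => //.
  by rewrite spikes0; congr pt; ring.
move=> /segment_ptP[t t01 ->]; have := spike_graph_mem (fun=> 0) t01.
by rewrite spikes0; congr (spike_graph _ (pt _ _)); ring.
Qed.

Lemma hat0_arc : arc (hat (fun=> 0)) (pt (-1) (-1)) (pt 1 (-1)).
Proof.
have ne u v u' v' : (u != u') || (v != v') -> pt u v != pt u' v'.
  by move=> /orP H; apply/eqP => /pt_inj[uu vv]; case: H; rewrite ?uu ?vv eqxx.
have N11 : (-1 : R) != 1 by apply/eqP; lra.
have N10 : (-1 : R) != 0 by apply/eqP; lra.
have N01 : (0 : R) != 1 by apply/eqP; lra.
have -> : hat (fun=> 0) = segment (pt (-1) (-1)) (pt (-1) 1) `|` segment (pt (-1) 1) (pt 0 1)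
    `|` segment (pt 0 1) (pt 0 0) `|` segment (pt 0 0) (pt 1 0) `|` segment (pt 1 0) (pt 1 (-1)).
  by rewrite /hat spike_graph0 /frame; apply/seteqP; split=> y; rewrite /setU /=; tauto.
apply: (@arc_cat _ _ _ _ _ (pt 1 0)); last first.
- move=> y [H /segment_ptP[s s01 ys]].
  have : exists u v, y = pt u v /\ (u < 1 \/ u = 1 /\ v = 0).
    by case: H => [[[|]|]|] /segment_ptP[t t01 ->]; eexists; eexists; split; try reflexivity;
      lra.
  by move=> [u [v [yuv uv]]]; rewrite /= ys; move: ys; rewrite yuv => /pt_inj[? ?];
    congr pt; lra.
- by apply: segment_arc; apply: ne; rewrite eq_sym oppr_eq0 oner_eq0 orbT.
apply: (@arc_cat _ _ _ _ _ (pt 0 0)); last first.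
- move=> y [H /segment_ptP[s s01 ys]].
  have : exists u v, y = pt u v /\ (u < 0 \/ u = 0 /\ 0 <= v \/ 0 < v).
    by case: H => [[|]|] /segment_ptP[t t01 ->]; eexists; eexists; split; try reflexivity;
      lra.
  by move=> [u [v [yuv uv]]]; rewrite /= ys; move: ys; rewrite yuv => /pt_inj[? ?];
    congr pt; lra.
- by apply: segment_arc; apply: ne; rewrite N01.
apply: (@arc_cat _ _ _ _ _ (pt 0 1)); last first.
- move=> y [H /segment_ptP[s s01 ys]].
  have : exists u v, y = pt u v /\ (u < 0 \/ v = 1).
    by case: H => [|] /segment_ptP[t t01 ->]; eexists; eexists; split; try reflexivity; lra.
  by move=> [u [v [yuv uv]]]; rewrite /= ys; move: ys; rewrite yuv => /pt_inj[? ?];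
    congr pt; lra.
- by apply: segment_arc; apply: ne; rewrite [1 == 0]eq_sym N01 orbT.
apply: (@arc_cat _ _ _ _ _ (pt (-1) 1)).
- by apply: segment_arc; apply: ne; rewrite N11 orbT.
- by apply: segment_arc; apply: ne; rewrite N10.
move=> y [/segment_ptP[t t01 yt] /segment_ptP[s s01 ys]].
by rewrite /= ys; move: ys; rewrite yt => /pt_inj[? ?]; congr pt; lra.
Qed.

End Hat.

(** * The vertical homeomorphism that flattens the spikes *)

Section Shear.
Context (R : realType) (n : nat).
Local Notation V := 'rV[R]_n.+2.
Local Notation pt := (@pt R n).
Implicit Types (x : nat -> R) (B : set V) (y z : V) (f : R -> R).

Definition set_coord1 (y : V) (v : R) : V := \row_i if i == 1 then v else y 0 i.

(* The vertical homeomorphism that pushes the level [f u] down to 0, is affine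
   on [-1, f u] and fixes everything below level -1. *)
Definition shear f y : V := set_coord1 y
  (Num.min (y 0 1) (Num.max ((y 0 1 - f (y 0 0)) / (1 + f (y 0 0))) (y 0 1 - f (y 0 0)))).

Definition unshear f y : V := set_coord1 y
  (Num.max (y 0 1) (Num.min ((1 + f (y 0 0)) * y 0 1 + f (y 0 0)) (y 0 1 + f (y 0 0)))).

Lemma set_coord1_0 y v : set_coord1 y v 0 0 = y 0 0. Proof. by rewrite mxE. Qed.
Lemma set_coord1_1 y v : set_coord1 y v 0 1 = v. Proof. by rewrite mxE eqxx. Qed.

Lemma set_coord1_id y : set_coord1 y (y 0 1) = y.
Proof. by apply/rowP => i; rewrite mxE; case: eqP => // ->. Qed.

Lemma set_coord1_twice y v v' : set_coord1 (set_coord1 y v) v' = set_coord1 y v'.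
Proof. by apply/rowP => i; rewrite !mxE; case: eqP. Qed.

Lemma set_coord1_continuous (T : topologicalType) (g : T -> V) (h : T -> R) :
  continuous g -> continuous h -> continuous (fun t => set_coord1 (g t) (h t)).
Proof.
by move=> gc hc; apply: cts_row => i; case: (i == 1) => //; exact: cts_coord.
Qed.


Lemma shear_low (v f : R) : 0 <= f -> v <= -1 ->
  Num.min v (Num.max ((v - f) / (1 + f)) (v - f)) = v.
Proof.
move=> f0 v1; have f1 : 0 < 1 + f by lra.
by rewrite min_l // le_max ler_pdivlMr //; apply/orP; left; nra.
Qed.

Lemma shear_mid (v f : R) : 0 <= f -> -1 <= v <= f ->
  Num.min v (Num.max ((v - f) / (1 + f)) (v - f)) = (v - f) / (1 + f).
Proof.
move=> f0 /andP[v1 vf]; have f1 : 0 < 1 + f by lra.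
rewrite max_l; last by rewrite ler_pdivlMr //; nra.
by rewrite min_r // ler_pdivrMr //; nra.
Qed.

Lemma shear_high (v f : R) : 0 <= f -> f <= v ->
  Num.min v (Num.max ((v - f) / (1 + f)) (v - f)) = v - f.
Proof.
move=> f0 vf; have f1 : 0 < 1 + f by lra.
rewrite max_r; last by rewrite ler_pdivrMr //; nra.
by rewrite min_r //; lra.
Qed.

Lemma unshear_low (w f : R) : 0 <= f -> w <= -1 ->
  Num.max w (Num.min ((1 + f) * w + f) (w + f)) = w.
Proof. by move=> f0 w1; rewrite max_l // ge_min; apply/orP; left; nra. Qed.

Lemma unshear_mid (w f : R) : 0 <= f -> -1 <= w <= 0 ->
  Num.max w (Num.min ((1 + f) * w + f) (w + f)) = (1 + f) * w + f.
Proof.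
by move=> f0 /andP[w1 w0]; rewrite min_l; [rewrite max_r //; nra|nra].
Qed.

Lemma unshear_high (w f : R) : 0 <= f -> 0 <= w ->
  Num.max w (Num.min ((1 + f) * w + f) (w + f)) = w + f.
Proof. by move=> f0 w0; rewrite min_r; [rewrite max_r //; lra|nra]. Qed.

Lemma shearK f : (forall u, 0 <= f u) -> cancel (shear f) (unshear f).
Proof.
move=> f0 y; rewrite /unshear set_coord1_twice set_coord1_0 set_coord1_1 -[RHS]set_coord1_id.
congr set_coord1; set v := y 0 1; have := f0 (y 0 0); set g := f _ => g0.
have g1 : 0 < 1 + g by lra.
have [v1|v1] := leP v (-1); first by rewrite shear_low // unshear_low.
have [vg|vg] := leP v g.
  rewrite shear_mid //; last by rewrite vg ltW.
  rewrite unshear_mid //; first by rewrite mulrC divfK ?gt_eqF // subrK.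
  by rewrite ler_pdivlMr // ler_pdivrMr //; apply/andP; split; nra.
rewrite shear_high //; last exact: ltW.
by rewrite unshear_high // ?subrK // subr_ge0 ltW.
Qed.

Lemma unshearK f : (forall u, 0 <= f u) -> cancel (unshear f) (shear f).
Proof.
move=> f0 y; rewrite /shear set_coord1_twice set_coord1_0 set_coord1_1 -[RHS]set_coord1_id.
congr set_coord1; set v := y 0 1; have := f0 (y 0 0); set g := f _ => g0.
have g1 : 0 < 1 + g by lra.
have [v1|v1] := leP v (-1); first by rewrite unshear_low // shear_low.
have [vg|vg] := leP v 0.
  rewrite unshear_mid //; last by rewrite vg ltW.
  rewrite shear_mid //; first by rewrite addrK mulrC mulKf // gt_eqF.
  by apply/andP; split; nra.
rewrite unshear_high //; last exact: ltW.
by rewrite shear_high // ?addrK //; lra.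
Qed.

Lemma unshear_continuous f : continuous f -> continuous (unshear f).
Proof.
move=> fc; have c0 : continuous (fun y : V => y 0 0) by exact: coord_continuous.
have c1 : continuous (fun y : V => y 0 1) by exact: coord_continuous.
have cf := cts_comp c0 fc.
apply: set_coord1_continuous; first by move=> ?; exact: cvg_id.
apply: cts_max => //; apply: cts_min; apply: ctsD => //.
by apply: ctsM => //; apply: ctsD => //; exact: cts_cst.
Qed.

Lemma shear_continuous f : (forall u, 0 <= f u) -> continuous f -> continuous (shear f).
Proof.
move=> f0 fc; have c0 : continuous (fun y : V => y 0 0) by exact: coord_continuous.
have c1 : continuous (fun y : V => y 0 1) by exact: coord_continuous.
have cf := cts_comp c0 fc.
apply: set_coord1_continuous; first by move=> ?; exact: cvg_id.
apply: cts_min => //; apply: cts_max; last exact: ctsB.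
apply: ctsM; first exact: ctsB.
have c : continuous (fun y : V => 1 + f (y 0 0)) by apply: ctsD => //; exact: cts_cst.
by move=> y; apply: (cvgV _ (c y)); rewrite gt_eqF //; have := f0 (y 0 0); lra.
Qed.

Lemma shear_homeomorphism f : (forall u, 0 <= f u) -> continuous f -> homeomorphism (shear f).
Proof.
move=> f0 fc; exists (unshear f); split.
- exact: shearK.
- exact: unshearK.
- exact: shear_continuous.
- exact: unshear_continuous.
Qed.

Lemma shear_pt f u v : shear f (pt u v) =
  pt u (Num.min v (Num.max ((v - f u) / (1 + f u)) (v - f u))).
Proof.
apply/rowP => i; rewrite /shear pt0 pt1 !mxE.
by case: (eqVneq i 1) => // ->.
Qed.

Lemma shear_id f y : f (y 0 0) = 0 -> shear f y = y.
Proof.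
move=> fy; rewrite /shear fy subr0 addr0 divr1 maxxx minxx; exact: set_coord1_id.
Qed.

Lemma shear_id_low f y : 0 <= f (y 0 0) -> y 0 1 <= -1 -> shear f y = y.
Proof. by move=> fy y1; rewrite /shear shear_low //; exact: set_coord1_id. Qed.

Lemma image_id_on (A : set V) (f : V -> V) : (forall y, A y -> f y = y) -> f @` A = A.
Proof.
move=> fA; apply/seteqP; split=> [_ [y Ay <-]|y Ay]; first by rewrite fA.
by exists y => //; exact: fA.
Qed.

Lemma spikes_ge0 x u : (forall j, 0 <= x j) -> 0 <= spikes x u.
Proof. by move=> x0; rewrite mulr_ge0 ?tent_ge0. Qed.

(** The frame lies over u <= 0 and u = 1, where [spikes x] vanishes, and [B] lies in the region that
    [shear] fixes. *)
Lemma shear_hat B x : (forall y, B y -> y 0 1 <= -1) -> (forall j, 0 <= x j) ->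
  shear (spikes x) @` (B `|` hat x) = B `|` hat (fun=> 0).
Proof.
move=> Blow x0; have s0 u : 0 <= spikes x u by exact: spikes_ge0.
rewrite /hat image_setU (image_setU _ (spike_graph x)); congr (_ `|` (_ `|` _)).
- by apply: image_id_on => y /Blow; exact: shear_id_low.
- apply/seteqP; split=> [_ [_ [u u01 <-] <-]|_ [u u01 <-]].
    exists u => //; rewrite shear_pt shear_mid //; last by have := s0 u; lra.
    by rewrite subrr mul0r spikes0.
  exists (pt u (spikes x u)); first by exists u.
  rewrite shear_pt shear_mid ?subrr ?mul0r ?spikes0 //; by have := s0 u; lra.
apply: image_id_on => y /frameP[u [v [-> u1 v1 uv]]]; apply: shear_id.
by rewrite pt0 spikes_out //; case: uv => [->|[-> _]|[-> _]|[-> _]];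
  rewrite ?lexx ?orbT // lerN10.
Qed.

End Shear.

Lemma homeomorphic_sym (X Y : topologicalType) : homeomorphic X Y -> homeomorphic Y X.
Proof. by move=> [f [g [fK gK fc gc]]]; exists g, f. Qed.

Lemma homeomorphism_comp (X Y Z : topologicalType) (f : X -> Y) (g : Y -> Z) :
  homeomorphism f -> homeomorphism g -> homeomorphism (g \o f).
Proof.
move=> [f' [fK f'K fc f'c]] [g' [gK g'K gc g'c]]; exists (f' \o g'); split.
- exact: can_comp.
- exact: can_comp.
- exact: (cts_comp fc gc).
- exact: (cts_comp g'c f'c).
Qed.

Lemma homeomorphic_trans (X Y Z : topologicalType) :
  homeomorphic X Y -> homeomorphic Y Z -> homeomorphic X Z.
Proof. by move=> [f fh] [g gh]; exists (g \o f); exact: homeomorphism_comp fh gh. Qed.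

Lemma homeomorphic_image (X Y : topologicalType) (f : X -> Y) (A : set X) :
  compact A -> continuous f -> injective f -> hausdorff_space X -> hausdorff_space Y ->
  homeomorphic (set_type (f @` A)) (set_type A).
Proof.
move=> Ac fc fi TX TY; rewrite -[X in homeomorphic _ (set_type X)](image_id A).
apply: homeomorphic_fibers => //; first by move=> ?; exact: cvg_id.
by move=> s t _ _; split=> [/fi|->].
Qed.

Lemma finite_nat_bound (J : set nat) : finite_set J -> exists N, forall j, J j -> (j < N)%N.
Proof.
move=> /finite_seqP[s ->]; exists (\max_(i <- s) i).+1 => j /= js.
by rewrite ltnS; exact: (@leq_bigmax_seq _ s xpredT id j js isT).
Qed.

Lemma finite_set_inj (J : set nat) (M : nat) (f : nat -> nat) :
  (forall j, J j -> (f j < M)%N) -> (forall j k, J j -> J k -> (j < k)%N -> f j <> f k) ->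
  finite_set J.
Proof.
move=> fM fi; have inj : {in J &, injective f}.
  move=> j k /set_mem Jj /set_mem Jk fjk.
  by case: (ltngtP j k) => // jk; [case: (fi j k)|case: (fi k j)].
rewrite -(eq_finite_set (inj_card_eq inj)).
by apply: sub_finite_set (finite_II M) => _ [j Jj <-]; exact: fM.
Qed.

(** * Topology of the spiked sets *)

Section HatSets.
Context (R : realType) (n : nat).
Local Notation V := 'rV[R]_n.+2.
Local Notation pt := (@pt R n).
Local Notation hat := (@hat R n).
Local Notation spike_graph := (@spike_graph R n).
Implicit Types (x : nat -> R) (B : set V) (y z : V).

Definition unit_seq x := forall j, 0 <= x j <= 1.

Lemma unit_seq0 : unit_seq (fun=> 0).
Proof. by move=> j; rewrite lexx ler01. Qed.

Lemma spikes_unit x u : unit_seq x -> 0 <= spikes x u <= 1.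
Proof.
move=> x01; have := x01 (tent_index u) => /andP[x0 x1].
by rewrite mulr_ge0 ?tent_ge0 //= mulr_ile1 ?tent_ge0 ?tent_le1.
Qed.

(** The height bound keeps [B] below the spikes and in the region fixed by [shear]. *)
Definition low_arc B := [/\ arc B (pt 1 (-1)) (pt (-1) (-1)), finite_union_of_segments B &
  forall y, B y -> y 0 1 <= -1].

Lemma hat_low_ends x y : unit_seq x -> hat x y -> y 0 1 <= -1 ->
  y = pt 1 (-1) \/ y = pt (-1) (-1).
Proof.
move=> x01 [/spike_graphP[u u01 ->]|].
  by rewrite pt1; have /andP[] := spikes_unit u x01 => *; exfalso; lra.
move=> /frameP[u [v [-> u1 v1 uv]]]; rewrite pt1 => vle.
have -> : v = -1 by lra.
by case: uv => [->|[? ?]|[? ?]|[-> _]]; [right|exfalso; lra|exfalso; lra|left].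
Qed.

Lemma hat0_scc B : low_arc B -> homeomorphic (set_type (B `|` hat (fun=> 0))) (set_type (@unit_circle R)).
Proof.
move=> [Barc _ Blow]; apply: (arc_loop Barc (hat0_arc _ _)) => y [By Hy].
exact: (hat_low_ends unit_seq0 Hy (Blow y By)).
Qed.

Lemma pt_curve_compact (f : R -> R) (a b : R) : continuous f ->
  compact ((fun u => pt u (f u)) @` `[a, b]).
Proof.
move=> fc; apply: continuous_compact; last exact: segment_compact.
by apply: continuous_subspaceT; apply: pt_continuous => //; move=> ?; exact: cvg_id.
Qed.

(** The graph need not be closed, but together with the vertical segment it is the intersection of
    the compact sets [A N]: the graph over [[tent_right N, 1]], where it is continuous, and a full
    rectangle over the rest. *)
Lemma hat_compact x : unit_seq x -> compact (hat x).
Proof.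
move=> x01.
pose S N u := \sum_(j < N) x j * tent j u.
pose A N := ((fun u => pt u (S N u)) @` `[tent_right R N, 1]) `|`
  ((fun uv : R * R => pt uv.1 uv.2) @` (`[0, tent_right R N] `*` `[0, 1])).
have Ac N : compact (A N).
  apply: compactU; first by apply: pt_curve_compact; exact: sum_tents_continuous.
  apply: continuous_compact; last by apply: compact_setX; exact: segment_compact.
  apply: continuous_subspaceT; apply: pt_continuous => ?; [exact: cvg_fst|exact: cvg_snd].
have E : spike_graph x `|` segment (pt 0 1) (pt 0 0) = \bigcap_N A N.
  apply/seteqP; split=> [y + N _|y Ay].
    move=> [/spike_graphP[u u01 ->]|/segment_ptP[t t01 ->]].
      have [uN|uN] := leP (tent_right R N) u.
        by left; exists u; [rewrite /= in_itv /= uN; lra|rewrite /S -spikes_sum // uN orbT].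
      right; exists (u, spikes x u) => //; split; rewrite /= in_itv /=; last exact: spikes_unit.
      by have := u01; lra.
    right; exists ((1 - t) * 0 + t * 0, (1 - t) * 1 + t * 0) => //.
    have : 0 < tent_right R N by rewrite invr_gt0.
    by split; rewrite /= in_itv /=; lra.
  have [y0|y0] := leP (y 0 0) 0.
    right; case: (Ay 0%N I) => [[u /=]|[[u v] [/=]]]; rewrite !in_itv /=.
      move=> u1 yE; move: y0; rewrite -yE pt0.
      have : 0 < tent_right R 0 by rewrite invr_gt0.
      by move=> ? ?; exfalso; lra.
    move=> u1 v1 yE; move: y0; rewrite -yE pt0 => u0; apply/segment_ptP.
    by exists (1 - v); [lra|congr pt; lra].
  pose N := Num.truncn (y 0 0)^-1.
  have Ny : tent_right R N < y 0 0.
    by rewrite -[ltRHS]invrK ltf_pV2 ?posrE ?invr_gt0 // truncnS_gt.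
  left; case: (Ay N I) => [[u /=]|[[u v] [/=]]]; rewrite !in_itv /=.
    move=> u1 <-; have -> : S N u = spikes x u by rewrite (@spikes_sum _ x N) //; apply/orP; right; lra.
    have r0 : 0 < tent_right R N by rewrite invr_gt0.
    by apply: spike_graph_mem; lra.
  by move=> u1 v1 yE; move: Ny; rewrite -yE pt0 => ?; exfalso; lra.
have -> : hat x = (\bigcap_N A N) `|` @frame R n.
  rewrite -E /hat; apply/seteqP; split=> y; rewrite /setU /frame /=; tauto.
apply: compactU; last by rewrite /frame; repeat apply: compactU; exact: segment_compact_rV.
apply: (@subclosed_compact _ _ (A 0%N)) => //; last by move=> y; exact.
by apply: closed_bigI => N _; apply: compact_closed => //; exact: norm_hausdorff.
Qed.

(** The graph over (0, 1] is a union of connected arcs through (1, 0). Its zeros between the spikes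
    tend to (0, 0), so its closure meets the vertical segment. *)
Lemma hat_connected x : unit_seq x -> connected (hat x).
Proof.
move=> x01; have idc : continuous (fun t : R => t) by move=> ?; exact: cvg_id.
pose G := (fun u => pt u (spikes x u)) @` `]0, 1].
have Gc : connected G.
  pose S N u := \sum_(j < N) x j * tent j u.
  have -> : G = \bigcup_N ((fun u => pt u (S N u)) @` `[tent_right R N, 1]).
    apply/seteqP; split=> [y [u /=]|y [N _ [u /=]]]; rewrite in_itv /= => /andP[u0 u1] <-.
      have Nu : tent_right R (Num.truncn u^-1) < u.
        by rewrite -[ltRHS]invrK ltf_pV2 ?posrE ?invr_gt0 // truncnS_gt.
      exists (Num.truncn u^-1) => //; exists u; first by rewrite /= in_itv /= u1 ltW.
      by rewrite /S -spikes_sum // (ltW Nu) orbT.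
    exists u; last by rewrite /S -spikes_sum // u0 orbT.
    by rewrite /= in_itv /= u1 (lt_le_trans _ u0) // invr_gt0.
  apply: bigcup_connected.
    exists (pt 1 0) => N _; exists 1; first by rewrite /= in_itv /= tent_right_le1 lexx.
    by rewrite /S -spikes_sum ?tent_right_le1 ?orbT // spikes_out // lexx orbT.
  move=> N _; apply: connected_continuous_connected; first exact: segment_connected.
  by apply: continuous_subspaceT; apply: pt_continuous => //; exact: sum_tents_continuous.
have clG : closure G (pt 0 0).
  move=> A /nbhs_ballP[e /= e0 eA]; pose j := Num.truncn e^-1.
  exists (pt (tent_left R j) 0); split.
    exists (tent_left R j); last by rewrite spikes_left.
    by rewrite /= in_itv /= tent_left_gt0 (le_trans (ltW (tent_left_right _ _))) ?tent_right_le1.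
  apply: eA; rewrite -ball_normE /=; apply: pt_norm_lt => //; last by rewrite subrr normr0.
  rewrite sub0r normrN gtr0_norm ?tent_left_gt0 // -[ltRHS]invrK ltf_pV2 ?posrE ?invr_gt0 //.
  by rewrite (lt_trans (truncnS_gt _)) // ltr_nat.
pose L1 := segment (pt 0 1) (pt 0 0).
have -> : hat x = segment (pt (-1) (-1)) (pt (-1) 1) `|` (segment (pt (-1) 1) (pt 0 1)
    `|` ((G `|` L1) `|` segment (pt 1 0) (pt 1 (-1)))).
  apply/seteqP; split=> y.
    move=> [/spike_graphP[u u01 ->]|]; last by rewrite /frame /L1 /setU /=; tauto.
    have [->|u0] := eqVneq u 0.
      rewrite spikes_out ?lexx //; right; right; left; right; exact: segment_right.
    right; right; left; left; exists u => //.
    by rewrite /= in_itv /= lt_def u0; have := u01.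
  have GG : G y -> hat x y.
    by move=> [u /=]; rewrite in_itv /= => /andP[/ltW u0 u1] <-; left; apply: spike_graph_mem; rewrite u0.
  move: GG; rewrite /hat /frame /L1 /setU /=; tauto.
apply: connectedU; [|exact: segment_rV_connected|].
  by exists (pt (-1) 1); split; [exact: segment_right|left; exact: segment_left].
apply: connectedU; [|exact: segment_rV_connected|].
  by exists (pt 0 1); split; [exact: segment_right|left; right; exact: segment_left].
apply: connectedU; [| |exact: segment_rV_connected].
  exists (pt 1 0); split; last exact: segment_left.
  by left; exists 1; rewrite ?spikes_out ?lexx ?orbT //= in_itv /= ltr01 lexx.
apply: connectedU_closure => //; first exact: segment_rV_connected.
by exists (pt 0 0); split=> //; exact: segment_right.
Qed.

Definition is_continuum (A : set V) := [/\ A !=set0, compact A & connected A].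

Lemma hat_continuum B x : low_arc B -> unit_seq x -> is_continuum (B `|` hat x).
Proof.
move=> [Barc _ _] x01; have [Bp Bq _] := arc_ends Barc; split.
- by exists (pt 1 (-1)); left.
- by apply: compactU; [exact: arc_compact Barc|exact: hat_compact].
- apply: connectedU; [|by have [g [gc _ _ _ ->]] := Barc; apply: connected_continuous_connected;
    [exact: segment_connected|exact: continuous_subspaceT]|exact: hat_connected].
  exists (pt 1 (-1)); split=> //; right; right; exact: segment_right.
Qed.

Lemma hat_scc B x : low_arc B -> unit_seq x -> x @ \oo --> (0 : R) ->
  homeomorphic (set_type (B `|` hat x)) (set_type (@unit_circle R)).
Proof.
move=> Bl x01 xc; have x0 j : 0 <= x j by have /andP[] := x01 j.
have [_ Bc _] := hat_continuum Bl x01; have [Barc _ Blow] := Bl.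
have s0 u : 0 <= spikes x u by exact: spikes_ge0.
apply: homeomorphic_trans (hat0_scc Bl); rewrite -(shear_hat Blow x0).
apply: homeomorphic_sym; apply: homeomorphic_image => //; try exact: norm_hausdorff.
- by apply: shear_continuous => //; exact: spikes_continuous.
- exact: can_inj (shearK s0).
Qed.

Lemma graph_itv_polygonal x j : finite_union_of_segments
  ((fun u => pt u (spikes x u)) @` `[tent_left R j, tent_right R j]).
Proof.
have lr := tent_left_right R j; have w0 := tent_width_gt0 R j.
have cE : tent_mid R j = tent_left R j + tent_width R j by rewrite /tent_mid /tent_width; lra.
have rE : tent_right R j = tent_left R j + 2 * tent_width R j by rewrite /tent_width; lra.
set l := tent_left R j in lr cE rE *; set r := tent_right R j in lr rE *.
set c := tent_mid R j in cE *; set w := tent_width R j in w0 cE rE *.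
have -> : (fun u => pt u (spikes x u)) @` `[l, r] =
    segment (pt l 0) (pt c (x j)) `|` segment (pt c (x j)) (pt r 0).
  have tE u : l <= u <= r -> spikes x u = x j * (1 - `|u - c| / w).
    move=> ulr; rewrite (@spikes_itv _ _ _ j) // /tent -/c -/w max_r // subr_ge0.
    by rewrite ler_pdivrMr // mul1r ler_norml; lra.
  apply/seteqP; split=> [y [u /=]|y [|] /segment_ptP[t t01 ->]].
  - rewrite in_itv /= => ulr <-; rewrite tE //.
    have [uc|uc] := leP u c; [left|right]; apply/segment_ptP.
      exists ((u - l) / w).
        by apply/andP; split; [apply: divr_ge0; lra|rewrite ler_pdivrMr //; lra].
      rewrite ler0_norm ?subr_le0 // cE; congr pt; field; lra.
    exists ((u - c) / w).
      by apply/andP; split; [apply: divr_ge0; lra|rewrite ler_pdivrMr //; lra].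
    rewrite gtr0_norm ?subr_gt0 // rE cE; congr pt; field; lra.
  - exists ((1 - t) * l + t * c); first by rewrite /= in_itv /= cE rE; nra.
    rewrite tE; last by rewrite cE rE; nra.
    congr pt; rewrite ler0_norm; last by rewrite cE; nra.
    by rewrite cE; field; lra.
  exists ((1 - t) * c + t * r); first by rewrite /= in_itv /= cE rE; nra.
  rewrite tE; last by rewrite cE rE; nra.
  congr pt; rewrite ger0_norm; last by rewrite rE cE; nra.
  by rewrite cE rE; field; lra.
by apply: polygonalU; exact: polygonal_segment.
Qed.

Lemma hat_polygonal B x N : low_arc B -> (forall j, (N <= j)%N -> x j = 0) ->
  finite_union_of_segments (B `|` hat x).
Proof.
move=> [_ Bp _] xN; apply: polygonalU => //; apply: polygonalU; last first.
  by rewrite /frame; repeat apply: polygonalU; exact: polygonal_segment.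
have -> : spike_graph x = segment (pt 0 0) (pt (tent_right R N) 0) `|`
    \bigcup_(j < N) ((fun u => pt u (spikes x u)) @` `[tent_left R j, tent_right R j]).
  have rN : 0 < tent_right R N by rewrite invr_gt0.
  have low u : u <= tent_right R N -> spikes x u = 0.
    move=> uN; rewrite /spikes; have [->|] := eqVneq (tent (tent_index u) u) 0; first by rewrite mulr0.
    move=> /tent_support/andP[lu _]; rewrite xN ?mul0r // leqNgt; apply/negP => JN.
    by have := lt_le_trans lu uN; rewrite tent_leftE ltNge tent_right_leq.
  apply/seteqP; split=> y.
    move=> /spike_graphP[u u01 ->]; have [uN|uN] := leP u (tent_right R N).
      left; apply/segment_ptP; exists (u / tent_right R N).
        by apply/andP; split; [apply: divr_ge0; lra|rewrite ler_pdivrMr //; lra].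
      by rewrite low //; congr pt; field; lra.
    (* The tent interval containing [u] is the last one whose right end is not to the left of
       [u]. *)
    right; pose P j := u <= tent_right R j.
    have exP : exists j, P j by exists 0%N; rewrite /P /tent_right invr1; lra.
    have ubP j : P j -> (j <= N)%N.
      move=> Pj; rewrite leqNgt; apply/negP => Nj.
      by have := lt_le_trans uN Pj; rewrite ltNge tent_right_leq // ltnW.
    case: (ex_maxnP exP ubP) => j Pj jmax.
    have jN : (j < N)%N.
      rewrite ltn_neqAle ubP // andbT; apply/eqP => jN; move: Pj; rewrite /P jN; lra.
    exists j => //; exists u => //; rewrite /= in_itv /= [X in _ && X]Pj andbT.
    rewrite leNgt; apply/negP => uj; have := jmax j.+1 (ltW uj); by rewrite ltnn.
  move=> [/segment_ptP[t t01 ->]|[j _ [u /=]]].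
    have := tent_right_le1 R N => rN1.
    have tb : 0 <= t * tent_right R N <= tent_right R N by apply/andP; split; nra.
    rewrite !mulr0 !add0r; have := @spike_graph_mem R n x (t * tent_right R N).
    by rewrite low; [apply|]; lra.
  rewrite in_itv /= => /andP[lu ur] <-; apply: spike_graph_mem.
  by rewrite (le_trans (ltW (tent_left_gt0 _ _)) lu) (le_trans ur) ?tent_right_le1.
apply: polygonalU; first exact: polygonal_segment.
by apply: polygonal_bigcup => j _; exact: graph_itv_polygonal.
Qed.

(** Between two spikes the set comes down to height 0. Both converse directions, for polygons and
    for simple closed curves, rest on this. *)
Lemma hat_valley B x y j : (forall z, B z -> z 0 1 <= -1) -> (B `|` hat x) y ->
  y 0 0 = tent_left R j -> y 0 1 <= 0 .
Proof.
move=> Blow [/Blow|[/spike_graphP[u u01 ->]|/frameP[u [v [-> u1 v1 uv]]]]].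
- by move=> ? _; lra.
- by rewrite pt0 pt1 => ->; rewrite spikes_left.
rewrite pt0 pt1 => uE; have u0 := tent_left_gt0 R j.
have : tent_left R j < 1 by rewrite (lt_le_trans (tent_left_right _ _)) ?tent_right_le1.
by move=> ?; exfalso; case: uv => [?|[? _]|[? _]|[? _]]; lra.
Qed.

Lemma tip_mem B x j : (B `|` hat x) (pt (tent_mid R j) (x j)).
Proof.
right; left; have := @spike_graph_mem R n x (tent_mid R j); rewrite spikes_mid; apply.
have /andP[lm mr] := tent_mid_bounds R j.
by rewrite ltW ?(lt_trans _ lm) ?tent_left_gt0 //= (le_trans (ltW mr)) // tent_right_le1.
Qed.

Lemma tips_valley j k : (j < k)%N -> tent_mid R k < tent_left R j < tent_mid R j.
Proof.
move=> jk; have /andP[-> _] := tent_mid_bounds R j; rewrite andbT.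
have /andP[_ kr] := tent_mid_bounds R k; apply: lt_le_trans kr _.
by rewrite tent_leftE tent_right_leq.
Qed.

(** A segment containing two tips of positive height would pass above height 0 over the valley
    between them. So each of the finitely many segments carries at most one such tip. *)
Lemma hat_polygonal_finite B x : (forall z, B z -> z 0 1 <= -1) -> unit_seq x ->
  finite_union_of_segments (B `|` hat x) -> finite_set [set j | x j != 0].
Proof.
move=> Blow x01 [m [a [b E]]].
have /boolp.choice[i iP] j : exists i, (i < m)%N /\ segment (a i) (b i) (pt (tent_mid R j) (x j)).
  by have := tip_mem B x j; rewrite E => -[i im ?]; exists i.
apply: (@finite_set_inj _ m i) => [j _|j k xj xk jk]; first by case: (iP j).
have [im sj] := iP j; have [_ sk] := iP k => ijk; rewrite -ijk in sk.
have xj0 : 0 < x j by rewrite lt_def; have /andP[-> _] := x01 j; rewrite andbT.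
have xk0 : 0 < x k by rewrite lt_def; have /andP[-> _] := x01 k; rewrite andbT.
have /andP[kl lj] := tips_valley jk.
pose s := (tent_mid R j - tent_left R j) / (tent_mid R j - tent_mid R k).
have d0 : 0 < tent_mid R j - tent_mid R k by lra.
have s0 : 0 < s by rewrite divr_gt0 //; lra.
have s1 : s < 1 by rewrite ltr_pdivrMr //; lra.
have sE : (1 - s) * tent_mid R j + s * tent_mid R k = tent_left R j.
  have ds : s * (tent_mid R j - tent_mid R k) = tent_mid R j - tent_left R j.
    by rewrite divfK // gt_eqF.
  by lra.
have : segment (a (i j)) (b (i j)) (pt (tent_left R j) ((1 - s) * x j + s * x k)).
  move: sj sk => /segmentP[t t01 tE] /segmentP[t' t'01 t'E]; apply/segmentP.
  exists ((1 - s) * t + s * t'); first by apply/andP; split; nra.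
  rewrite -sE -pt_convex tE t'E; apply/rowP => c; rewrite !mxE; ring.
move=> H; have : (B `|` hat x) (pt (tent_left R j) ((1 - s) * x j + s * x k)).
  by rewrite E; exists (i j).
by move/(hat_valley Blow); rewrite pt0 pt1 => /(_ j erefl); nra.
Qed.

(** Between the parameters of two tips the curve crosses a valley, hence falls by at least the
    height of the earlier tip. By uniform continuity, tips of height at least [e1] have parameters
    at least [d] apart, and only finitely many fit into [0, 1]. *)
Lemma hat_scc_cvg B x : (forall z, B z -> z 0 1 <= -1) -> unit_seq x ->
  homeomorphic (set_type (B `|` hat x)) (set_type (@unit_circle R)) ->
  x @ \oo --> (0 : R).
Proof.
move=> Blow x01 /homeomorphic_loop[g [gc gE _]].
apply/cvgrPdist_lt => e e0; pose e1 := Num.min e 1.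
have e1_gt0 : 0 < e1 by rewrite lt_min e0 ltr01.
have [e1e e11] : e1 <= e /\ e1 <= 1 by rewrite !ge_min !lexx orbT.
have [d [d0 dP]] := filter_ex (filterI (nbhs_right_gt (0 : R))
  (near_unif_continuous (segment01_compact (R := R)) gc e1_gt0)).
have /boolp.choice[t tP] j : exists t, 0 <= t <= 1 /\ g t = pt (tent_mid R j) (x j).
  by have := tip_mem B x j; rewrite gE => -[t /=]; rewrite in_itv /= => ? ?; exists t.
have far j k : e1 <= x j -> (j < k)%N -> `|t j - t k| < d -> False.
  move=> xj jk tjk; have /andP[kl lj] := tips_valley jk.
  have [tj gj] := tP j; have [tk gk] := tP k.
  have uc : continuous (fun s => g s 0 0) by exact: cts_coord.
  have [s [smin smax] sE] : exists2 s, Num.min (t j) (t k) <= s /\ s <= Num.max (t j) (t k) &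
      g s 0 0 = tent_left R j.
    have [tjk'|tjk'] := leP (t j) (t k).
      have [|s] := @IVT _ (fun s => g s 0 0) (t j) (t k) (tent_left R j) tjk' (continuous_subspaceT uc).
        by rewrite gj gk !pt0 ge_min le_max (ltW kl) (ltW lj) orbT.
      by rewrite in_itv /= => /andP[? ?] ?; exists s.
    have [|s] := @IVT _ (fun s => g s 0 0) (t k) (t j) (tent_left R j) (ltW tjk') (continuous_subspaceT uc).
      by rewrite gj gk !pt0 ge_min le_max (ltW kl) (ltW lj) orbT.
    by rewrite in_itv /= => /andP[? ?] ?; exists s.
  have tjs : `|t j - s| < d.
    move: tjk; rewrite !ltr_norml; move: smin smax; clear -d.
    by case: (leP (t j) (t k)) => ? ? ? /andP[? ?]; apply/andP; split; lra.
  have sg : (B `|` hat x) (g s).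
    rewrite gE; exists s => //; rewrite /= in_itv /=; move: smin smax tj tk; clear -s.
    by case: (leP (t j) (t k)) => ? ? ? ? ?; lra.
  have := hat_valley Blow sg sE => g1.
  have := dP (t j) s; rewrite /= in_itv /= => /(_ tj tjs); apply/negP; rewrite -leNgt.
  apply: le_trans (rV_coord_le _ 1); rewrite gj !mxE /= ler_normr; apply/orP; left.
  by rewrite (le_trans xj) // lerBrDr gerDl.
have [N NP] : exists N, forall j, e1 <= x j -> (j < N)%N.
  apply: (finite_nat_bound (J := [set j | e1 <= x j])).
  (* Parameters at least [d] apart fall into different cells of length [d]. *)
  apply: (@finite_set_inj _ (Num.truncn d^-1).+1 (fun j => Num.truncn (t j / d))).
    move=> j _; rewrite ltnS; apply: le_truncn; rewrite ler_pdivrMr //.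
    by rewrite mulVf ?gt_eqF //; have [] := tP j; lra.
  move=> j k xj xk jk tjk; apply: (far j k) => //.
  have td i : (Num.truncn (t i / d))%:R * d <= t i < (Num.truncn (t i / d)).+1%:R * d.
    rewrite -ler_pdivlMr // -ltr_pdivrMr //; apply: truncn_itv.
    by rewrite divr_ge0 ?(ltW d0) //; have [/andP[]] := tP i.
  have := td j; have := td k; rewrite tjk -natr1 mulrDl mul1r => /andP[? ?] /andP[? ?].
  by rewrite ltr_norml; apply/andP; split; lra.
exists N => // j /= Nj; rewrite sub0r normrN ger0_norm; last by have /andP[] := x01 j.
apply: lt_le_trans e1e; rewrite ltNge; apply/negP => /NP.
by rewrite ltnNge Nj.
Qed.

(** Over [[tent_right N, 1]] points with the same abscissa are compared. Closer to 0, a point is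
    moved horizontally onto the vertical segment, which belongs to every hat; so the coordinates
    from [N] on do not matter. *)
Lemma hat_hclose x x' N e : unit_seq x -> unit_seq x' -> tent_right R N < e ->
  (forall j, (j < N)%N -> `|x j - x' j| < e) -> hclose e (hat x) (hat x').
Proof.
move=> x01 x'01 Ne xx'; have N0 : 0 < tent_right R N by rewrite invr_gt0.
have e0 : 0 < e by lra.
have key w w' y : unit_seq w -> unit_seq w' -> (forall j, (j < N)%N -> `|w j - w' j| < e) ->
    hat w y -> exists2 y', hat w' y' & `|y - y'| < e.
  move=> w01 w'01 ww' [|]; last by move=> fy; exists y; [right|rewrite subrr normr0].
  move=> /spike_graphP[u u01 ->]; have [uN|uN] := leP (tent_right R N) u.
    exists (pt u (spikes w' u)); first by left; exact: spike_graph_mem.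
    apply: pt_norm_lt => //; first by rewrite subrr normr0.
    rewrite spikesB /spikes; have [->|/tent_support/andP[_ ur]] :=
      eqVneq (tent (tent_index u) u) 0; first by rewrite mulr0 normr0.
    rewrite normrM (le_lt_trans (y := `|w (tent_index u) - w' (tent_index u)|)) //.
      by rewrite ler_piMr // ger0_norm ?tent_ge0 ?tent_le1.
    apply: ww'; rewrite ltnNge; apply/negP => NJ.
    by have := le_lt_trans uN ur; rewrite ltNge tent_right_leq.
  exists (pt 0 (spikes w u)).
    right; left; right; apply/segment_ptP; exists (1 - spikes w u); last by congr pt; ring.
    by have := spikes_unit u w01; lra.
  apply: pt_norm_lt => //; last by rewrite subrr normr0.
  by rewrite subr0 ger0_norm; lra.
split=> y; first exact: key.
move=> /(key x' x) H; have [||j|y' ? ?] // := H; first by move=> jN; rewrite distrC xx'.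
by exists y' => //; rewrite distrC.
Qed.

End HatSets.

(** * Approximation of simple closed curves *)

Section LoopErasure.
Local Open Scope nat_scope.

Lemma nth_belast (T : Type) (x0 x : T) s r : r < size s ->
  nth x0 (belast x s) r = last x (take r s).
Proof. by elim: s x r => //= y s IH x [|r] //=; rewrite ltnS; exact: IH. Qed.

Variables (T : eqType) (e : rel T) (w : nat -> T) (N g : nat).

Definition touch (i j : nat) := (w i == w j) || e (w i) (w j).

Hypothesis wN : forall i, w (i + N) = w i.
Hypothesis w_step : forall i, touch i i.+1.
Hypothesis w_near : forall i j, i <= j <= i + N -> touch i j -> (j <= i + g) || (i + N <= j + g).
Hypothesis gN : 3 * g < N.
Hypothesis g_gt0 : 0 < g.

(** Bounding a hop by [g] keeps the erased walk close to the original one and forces it to wind once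
    around the period. *)
Definition hop (i j : nat) := [&& i < j, j <= i + g & touch i j].

Lemma hop_path_ge i s : path hop i s -> i <= last i s.
Proof.
elim: s i => //= j s IH i /andP[/and3P[ij _ _] /IH]; exact: leq_trans (ltnW ij).
Qed.

Lemma hop_path_gt i s : path hop i s -> s != [::] -> i < last i s.
Proof. by case: s => //= j s /andP[/and3P[ij _ _] /hop_path_ge kl] _; exact: leq_trans kl. Qed.

(** Erasing loops loses no part of the curve: a kept index lies at most [g] before any skipped
    one. *)
Lemma hop_path_near i s j : path hop i s -> i <= j < last i s ->
  exists2 c, c \in belast i s & c <= j <= c + g.
Proof.
elim: s i => [|k s IH] i /=; first by move=> _ /andP[ij]; rewrite ltnNge ij.
move=> /andP[/and3P[ik kg _] ks] /andP[ij jl]; have [kj|jk] := leqP k j.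
  have [|c cs cj] := IH k ks; first by rewrite kj.
  by exists c => //; rewrite inE cs orbT.
by exists i; rewrite ?mem_head // ij (leq_trans (ltnW jk)).
Qed.

(** Each hop advances by at most [g] and [3 * g < N], so the remaining cycle is never degenerate. *)
Lemma hop_path_size i s : path hop i s -> last i s = i + N -> 3 < size s.
Proof.
have bound j t : path hop j t -> last j t <= j + size t * g.
  elim: t j => [|k t IH] j /=; first by rewrite addn0.
  by move=> /andP[/and3P[_ kg _] /IH]; lia.
move=> /bound + lE; rewrite lE; nia.
Qed.

(** Let the walk take the same value at kept indices [a < b]. By [w_near] they are close within the
    period or close across its end. In the first case the part between them is cut out; in the
    second case only that part is kept and closed up. *)
Lemma loop_erasure_step i0 s : path hop i0 s -> last i0 s = i0 + N ->
  ~~ uniq (map w (belast i0 s)) ->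
  exists i1 s', [/\ path hop i1 s', last i1 s' = i1 + N & size s' < size s].
Proof.
move=> ps ls /(uniqPn (w 0)) [p [q [pq]]]; rewrite size_map size_belast => qs.
have nthE r : r < size s -> nth (w 0) (map w (belast i0 s)) r = w (last i0 (take r s)).
  by move=> rs; rewrite (nth_map 0) ?size_belast ?nth_belast.
rewrite !nthE ?(ltn_trans pq) // => wab.
set s1 := take p s in wab; set s3 := drop q s; set s2 := drop p (take q s).
have sE : s = s1 ++ s2 ++ s3.
  rewrite catA /s1 /s2 -{1}(cat_take_drop q s); congr (_ ++ _).
  by rewrite -{1}(cat_take_drop p (take q s)) take_takel // ltnW.
have s12 : take q s = s1 ++ s2.
  by rewrite -{1}(cat_take_drop p (take q s)) take_takel // ltnW.
rewrite s12 last_cat in wab; set a := last i0 s1 in wab.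
have s2N : s2 != [::].
  by rewrite -size_eq0 size_drop size_take qs subn_eq0 -ltnNge.
have s3N : s3 != [::] by rewrite -size_eq0 size_drop subn_eq0 -ltnNge.
have {ps} := ps; rewrite sE !cat_path -/a; set b := last a s2 in wab * => /and3P[p1 p2 p3].
have lb : last b s3 = i0 + N by rewrite -ls sE !last_cat.
have ia : i0 <= a := hop_path_ge p1.
have ab : a < b := hop_path_gt p2 s2N.
have bN : b <= i0 + N by rewrite -lb hop_path_ge.
have tab : touch a b by rewrite /touch wab eqxx.
have abN : a <= b <= a + N by lia.
have /orP[bag|aNb] := w_near abN tab.
  exists i0, (s1 ++ s3); split.
  - rewrite cat_path p1 -/a; case: (s3) p3 s3N lb => //= c s4 /andP[/and3P[bc cg tbc] p4] _ lb.
    rewrite p4 andbT /hop (ltn_trans ab bc) /=.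
    have tac : touch a c by move: tbc; rewrite /touch wab.
    have cN := hop_path_ge p4; rewrite lb in cN.
    have acN : a <= c <= a + N by lia.
    (* The far alternative fails, as [c <= b + g <= a + 2 * g] and [3 * g < N]. *)
    by rewrite tac andbT; have /orP[] := w_near acN tac; lia.
  - by rewrite last_cat -/a -lb; case: (s3) s3N.
  - by rewrite !size_cat ltn_add2l -[X in X < _]add0n ltn_add2r lt0n size_eq0.
case/lastP: (s2) s2N @b p2 p3 wab ab bN lb tab abN aNb s12 sE => // t b' _ b.
rewrite /b last_rcons => {b}; rewrite rcons_path => /andP[pt /and3P[db bg tdb]] p3 wab ab bN lb tab abN aNb s12 sE.
set d := last a t in db bg tdb.
have ad : a <= d := hop_path_ge pt.
(* The last hop, to [b], is redirected to [a + N], where the walk takes the same value. *)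
exists a, (rcons t (a + N)); split.
- rewrite rcons_path pt /= -/d /hop.
  have tda : touch d (a + N) by move: tdb; rewrite /touch wN wab.
  have dN : d <= a + N <= d + N by lia.
  by rewrite tda andbT; have /orP[] := w_near dN tda; lia.
- by rewrite last_rcons.
- rewrite !size_cat !size_rcons addnCA -[X in X < _]addn0 ltn_add2l addn_gt0.
  by rewrite [0 < size s3]lt0n size_eq0 s3N orbT.
Qed.

Lemma loop_erasure : exists i0 s,
  [/\ path hop i0 s, last i0 s = i0 + N & uniq (map w (belast i0 s))].
Proof.
have [s0 [ps0 ls0]] : exists s, path hop 0 s /\ last 0 s = 0 + N.
  exists (iota 1 N); split.
    elim: N 0 => //= m IH i; rewrite IH andbT /hop ltnSn w_step andbT.
    by rewrite -addn1 leq_add2l.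
  elim: N 0 => [|m IH] i /=; first by rewrite addn0.
  by rewrite IH addSnnS.
move: ps0 ls0; move: {2}(size s0) (leqnn (size s0)) => m; move: 0 s0.
elim: m => [|m IH] i s sm ps ls.
  have := hop_path_size ps ls; lia.
have [us|nus] := boolP (uniq (map w (belast i s))); first by exists i, s.
have [i1 [s' [ps' ls' s's]]] := loop_erasure_step ps ls nus.
by apply: (IH i1 s') => //; rewrite -ltnS (leq_trans s's).
Qed.

End LoopErasure.

(** The segment may be a point, which happens for a leg of the frame and for the pieces added by
    [shrink]. *)
Lemma arc_cat_segment (R : realType) n (A : set 'rV[R]_n) p q r : arc A p q ->
  A `&` segment q r `<=` [set q] -> arc (A `|` segment q r) p r.
Proof.
have [<-|qr] := eqVneq q r.
  move=> Aarc _; have [_ Aq _] := arc_ends Aarc.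
  by rewrite segmentxx (_ : A `|` [set q] = A) //; apply/setUidPl => _ ->.
by move=> Aarc; apply: arc_cat => //; exact: segment_arc.
Qed.

Lemma segment_ball (R : realType) n (a b c y : 'rV[R]_n) (r : R) :
  `|a - c| <= r -> `|b - c| <= r -> segment a b y -> `|y - c| <= r.
Proof.
move=> ac bc /segmentP[t t01 ->].
have -> : (1 - t) *: a + t *: b - c = (1 - t) *: (a - c) + t *: (b - c).
  by apply/rowP => i; rewrite !mxE; ring.
rewrite (le_trans (ler_normD _ _)) // !normrZ !ger0_norm; [|lra|lra].
have := normr_ge0 (a - c); have := normr_ge0 (b - c); nra.
Qed.

Lemma lt0_absurd (R : realType) (P : Prop) : (0 : R) < 0 -> P.
Proof. by rewrite ltxx. Qed.

(** * Lattice polygons *)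

Section Lattice.
Context (R : realType) (n : nat).
Local Notation V := 'rV[R]_n.
Local Notation L := 'rV[int]_n.
Implicit Types (x y z t : L).

Definition embed (z : L) : V := \row_i (z 0 i)%:~R.

Lemma embed_inj : injective embed.
Proof.
by move=> z t /rowP zt; apply/rowP => i; have := zt i; rewrite !mxE => /eqP; rewrite eqr_int => /eqP.
Qed.

Definition adj : rel L := fun z t =>
  [exists l, (`|z 0 l - t 0 l| == 1) && [forall i, (i != l) ==> (z 0 i == t 0 i)]].

Lemma adjP z t : reflect (exists l, `|z 0 l - t 0 l| = 1 /\ forall i, i != l -> z 0 i = t 0 i)
  (adj z t).
Proof.
apply: (iffP existsP) => [[l /andP[/eqP zt /forallP H]]|[l [zt H]]]; exists l.
  by split=> // i il; have := H i; rewrite il => /eqP.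
by rewrite zt eqxx /=; apply/forallP => i; apply/implyP => il; apply/eqP; exact: H.
Qed.

Lemma adj_sym : symmetric adj.
Proof.
have sub z t : adj z t -> adj t z.
  by move=> /adjP[l [zt H]]; apply/adjP; exists l; split=> [|i /H //]; rewrite distrC.
by move=> z t; apply/idP/idP; exact: sub.
Qed.

Lemma adj_norm z t : adj z t -> `|embed z - embed t| <= 1.
Proof.
move=> /adjP[l [zt H]]; apply/rV_norm_le => // i; rewrite !mxE -rmorphB /=.
have [->|il] := eqVneq i l; first by rewrite -intr_norm zt.
by rewrite (H i il) subrr normr0.
Qed.

(** Apart from its two vertices, a point of an edge has exactly one non-integer coordinate, and this
    determines the edge. *)
Lemma edge_point z t p : adj z t -> segment (embed z) (embed t) p ->
  (p = embed z \/ p = embed t) \/ exists l (m : int),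
    [/\ forall i, i != l -> z 0 i = t 0 i /\ p 0 i = (z 0 i)%:~R,
        (z 0 l = m /\ t 0 l = m + 1) \/ (z 0 l = m + 1 /\ t 0 l = m)
      & m%:~R < p 0 l < (m + 1)%:~R].
Proof.
move=> /adjP[l [zt H]] /segmentP[s s01 pE].
have [s0|s0] := eqVneq s 0.
  by left; left; rewrite pE s0 subr0 scale1r scale0r addr0.
have [s1|s1] := eqVneq s 1.
  by left; right; rewrite pE s1 subrr scale1r scale0r add0r.
have {s0 s1} [s0 s1] : 0 < s /\ s < 1.
  by move/andP: s01 => [? ?]; rewrite !lt_def s0 eq_sym s1.
right; have [ztl|ztl] : t 0 l = z 0 l + 1 \/ z 0 l = t 0 l + 1 by lia.
  exists l, (z 0 l); split.
  - by move=> i il; split; [exact: H|rewrite pE !mxE -(H i il); ring].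
  - by left.
  - by rewrite pE !mxE ztl rmorphD /=; apply/andP; split; nra.
exists l, (t 0 l); split.
- by move=> i il; split; [exact: H|rewrite pE !mxE -(H i il); ring].
- by right.
- by rewrite pE !mxE ztl rmorphD /=; apply/andP; split; nra.
Qed.

Lemma not_int_between (m k : int) : m%:~R < (k%:~R : R) < (m + 1)%:~R -> False.
Proof. by rewrite !ltr_int; lia. Qed.

(** Two edges sharing a non-vertex point have the same non-integer direction and the same integer
    part in it, hence the same endpoints. *)
Lemma edges_meet x y z t p : adj x y -> adj z t ->
  segment (embed x) (embed y) p -> segment (embed z) (embed t) p ->
  [\/ x = z /\ y = t, x = t /\ y = z |
      (p = embed x \/ p = embed y) /\ (p = embed z \/ p = embed t)].
Proof.
move=> axy azt pxy pzt.
have [v|[l [m [Hxy lxy pm]]]] := edge_point axy pxy;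
  have [v'|[l' [m' [Hzt lzt pm']]]] := edge_point azt pzt.
- by constructor 3.
- by exfalso; case: v => pE; apply: (@not_int_between m'); move: pm'; rewrite pE mxE; exact.
- by exfalso; case: v' => pE; apply: (@not_int_between m); move: pm; rewrite pE mxE; exact.
have ll : l = l'.
  apply/eqP/negPn/negP => ll; have [_ pl] := Hzt l ll.
  by apply: (@not_int_between m); move: pm; rewrite pl; exact.
rewrite -ll in Hzt lzt pm'.
have mm : m = m'.
  have : (m : int) < m' + 1 by rewrite -(ltr_int R); lra.
  have : (m' : int) < m + 1 by rewrite -(ltr_int R); lra.
  by lia.
rewrite -mm in lzt.
have off i : i != l -> [/\ x 0 i = z 0 i, y 0 i = z 0 i & t 0 i = z 0 i].
  move=> il; have [xy pi] := Hxy i il; have [zt pi'] := Hzt i il.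
  have xz : x 0 i = z 0 i by apply/eqP; rewrite -(eqr_int R) -pi -pi'.
  by split; rewrite // -?xy // -zt.
have ext (a b : L) : (forall i, i != l -> a 0 i = b 0 i) -> a 0 l = b 0 l -> a = b.
  by move=> ab abl; apply/rowP => i; have [->|/ab] := eqVneq i l.
have [xz|xz] := eqVneq (x 0 l) (z 0 l); [constructor 1|constructor 2].
  by split; apply: ext => [i /off[]|]; rewrite ?xz //; [congruence|lia].
by split; apply: ext => [i /off[]|]; [congruence|lia|congruence|lia].
Qed.

Fixpoint polyline x (s : seq L) : set V :=
  if s is y :: s' then segment (embed x) (embed y) `|` polyline y s' else [set embed x].

Lemma polylineP x s p : polyline x s p -> path adj x s ->
  (s = [::] /\ p = embed x) \/
  exists a b, [/\ a \in x :: s, b \in x :: s, adj a b & segment (embed a) (embed b) p].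
Proof.
elim: s x => [|y s IH] x /=; first by left.
move=> [pxy|py] /andP[xy ys]; right.
  by exists x, y; split; rewrite ?inE ?eqxx ?orbT.
have [[s0 pE]|[a [b [ay b_y ab pab]]]] := IH y py ys.
  exists x, y; split; rewrite ?inE ?eqxx ?orbT // pE; exact: segment_right.
by exists a, b; split=> //; rewrite inE ?ay ?b_y orbT.
Qed.

Lemma polyline_vertex x s z : z \in x :: s -> polyline x s (embed z).
Proof.
elim: s x => [|y s IH] x; first by rewrite inE => /eqP ->.
rewrite inE => /orP[/eqP ->|zs]; first by left; exact: segment_left.
by right; exact: IH.
Qed.

Lemma polyline_polygonal x s : finite_union_of_segments (polyline x s).
Proof.
elim: s x => [|y s IH] x /=; first by rewrite -segmentxx; exact: polygonal_segment.
by apply: polygonalU => //; exact: polygonal_segment.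
Qed.

Lemma polyline_near x s p : polyline x s p -> path adj x s ->
  exists2 z, z \in x :: s & `|p - embed z| <= 1.
Proof.
move=> ps xs; have [[_ ->]|[a [b [ax bx ab pab]]]] := polylineP ps xs.
  by exists x; rewrite ?mem_head // subrr normr0.
exists a => //; apply: segment_ball pab; first by rewrite subrr normr0.
by apply: adj_norm; rewrite adj_sym.
Qed.

Lemma polyline_edge x s a b p : path adj x s -> s != [::] -> a \notin x :: s ->
  adj a b -> segment (embed a) (embed b) p -> polyline x s p -> p = embed b.
Proof.
move=> xs sN axs ab pab /polylineP/(_ xs)[[s0]|[c [d [cs ds cd pcd]]]].
  by rewrite s0 in sN.
case: (edges_meet ab cd pab pcd) => [[ac _]|[ad _]|[[pa|//] cdp]].
- by rewrite ac cs in axs.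
- by rewrite ad ds in axs.
- exfalso; move: axs; rewrite pa in cdp.
  by case: cdp => /embed_inj ->; rewrite ?cs ?ds.
Qed.

Lemma polyline_arc x s : path adj x s -> uniq (x :: s) -> s != [::] ->
  arc (polyline x s) (embed x) (embed (last x s)).
Proof.
elim: s x => // y s IH x /= /andP[xy ys] /andP[xs us] _.
have nxy : embed x != embed y.
  by apply/eqP => /embed_inj E; rewrite E mem_head in xs.
have [s0|sN] := eqVneq s [::].
  rewrite s0 /= (_ : _ `|` _ = segment (embed x) (embed y)); first exact: segment_arc.
  by apply/setUidPl => _ ->; exact: segment_right.
apply: (arc_cat (segment_arc nxy)); first exact: IH.
move=> p [pxy ps]; exact: (polyline_edge ys sN xs xy pxy ps).
Qed.

End Lattice.
Arguments adj {n}.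

Section LatticeHat.
Context (R : realType) (n : nat).
Local Notation V := 'rV[R]_n.+2.
Local Notation L := 'rV[int]_n.+2.
Local Notation pt := (@pt R n).
Local Notation hat := (@hat R n).
Local Notation embed := (@embed R n.+2).
Local Notation polyline := (@polyline R n.+2).

(** Touching height -1 only at the feet lets [shrink] insert segments at that height without new
    intersections. *)
Definition strict_low_arc (B : set V) := low_arc B /\
  forall y, B y -> [\/ y 0 1 < -1, y = pt 1 (-1) | y = pt (-1) (-1)].

Lemma set_coord1_segment (y z : V) (v v' : R) : segment (set_coord1 y v) (set_coord1 y v') z <->
  exists2 t, 0 <= t <= 1 & z = set_coord1 y ((1 - t) * v + t * v').
Proof.
have E t : (1 - t) *: set_coord1 y v + t *: set_coord1 y v' =
    set_coord1 y ((1 - t) * v + t * v').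
  by apply/rowP => i; rewrite !mxE; case: ifP => // _; ring.
by split=> [/segmentP[t t01 ->]|[t t01 ->]]; [|apply/segmentP]; exists t.
Qed.

Lemma set_coord1_other (y : V) v i : i != 1 -> set_coord1 y v 0 i = y 0 i.
Proof. by move=> i1; rewrite mxE (negbTE i1). Qed.

(** Vertical legs over [z] and [t] must not overlap. Of the neighbours of [a] that are not above it,
    one is directly below and the others lie beside it, on different vertical lines. *)
Lemma adj_top (a z t : L) : adj a z -> adj a t -> z 0 1 <= a 0 1 -> t 0 1 <= a 0 1 ->
  z != t -> exists2 i, i != 1 & z 0 i != t 0 i.
Proof.
move=> az at' za ta zt; apply: contrapT => H.
have off i : i != 1 -> z 0 i = t 0 i.
  by move=> i1; apply/eqP/negPn/negP => ?; apply: H; exists i.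
have z1t1 : z 0 1 != t 0 1.
  apply: contra zt => /eqP zt1; apply/eqP/rowP => i.
  by have [->|/off] := eqVneq i 1.
have [l [al Hl]] := adjP _ _ az; have [k [ak Hk]] := adjP _ _ at'.
have [l1|l1] := eqVneq l 1; have [k1|k1] := eqVneq k 1.
- by rewrite l1 in al; rewrite k1 in ak; lia.
- have := Hk 1; rewrite eq_sym k1 => /(_ isT) a1.
  have := Hl k; rewrite l1 k1 => /(_ isT) akz; have := off k k1; lia.
- have := Hl 1; rewrite eq_sym l1 => /(_ isT) a1.
  have := Hk l; rewrite k1 l1 => /(_ isT) akz; have := off l l1; lia.
- have := Hl 1; rewrite eq_sym l1 => /(_ isT) a1.
  have := Hk 1; rewrite eq_sym k1 => /(_ isT) a1'; lia.
Qed.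

(** Up to the height of [a], the leg over [z] is a point or the edge from [z] to [a], and [a] is not
    a vertex of the polyline. *)
Lemma leg_meets_polyline (a w z : L) (s : seq L) (p : V) (v : R) :
  path adj w s -> s != [::] -> a \notin w :: s -> z \in w :: s -> adj a z ->
  z 0 1 <= a 0 1 -> (z 0 1)%:~R <= v <= (a 0 1)%:~R ->
  p = set_coord1 (embed z) v -> polyline w s p -> p = embed z.
Proof.
move=> ws sN aws zs az za zva pE ps.
have [z1a1|z1a1] := eqVneq (z 0 1) (a 0 1).
  by rewrite pE; apply/rowP => i; rewrite !mxE; case: eqP => // ->; move: zva; rewrite z1a1; lra.
have [l [al Hl]] := adjP _ _ az.
have l1 : l = 1.
  by apply/eqP/negPn/negP => l1; have := Hl 1; rewrite eq_sym l1 => /(_ isT) E; rewrite E eqxx in z1a1.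
have {}al : a 0 1 = z 0 1 + 1 by rewrite l1 in al; lia.
apply: (polyline_edge ws sN aws az _ ps); apply/segmentP.
have zv := zva; rewrite al rmorphD /= in zv.
exists (1 - (v - (z 0 1)%:~R)); first by lra.
rewrite pE; apply/rowP => i; rewrite !mxE; case: (eqVneq i 1) => [->|i1].
  by rewrite al rmorphD /=; ring.
by rewrite (Hl i) ?l1 //; ring.
Qed.

Lemma vertical_segment (z : L) (b : R) y : (z 0 1)%:~R <= b ->
  segment (embed z) (set_coord1 (embed z) b) y ->
  y = set_coord1 (embed z) (y 0 1) /\ (z 0 1)%:~R <= y 0 1 <= b.
Proof.
move=> zb; have zE : embed z = set_coord1 (embed z) (z 0 1)%:~R.
  by rewrite -[LHS]set_coord1_id mxE.
rewrite {1}zE set_coord1_segment => -[t t01 ->]; rewrite set_coord1_1; split=> //.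
by apply/andP; split; nra.
Qed.

Lemma polyline_low (w : L) (s : seq L) (b : R) y : path adj w s -> s != [::] ->
  (forall z, z \in w :: s -> (z 0 1)%:~R <= b) -> polyline w s y -> y 0 1 <= b.
Proof.
move=> ws sN top /polylineP/(_ ws)[[s0]|[d [e [/top db /top eb _ /segmentP[t t01 ->]]]]].
  by rewrite s0 in sN.
by rewrite !mxE; nra.
Qed.

Lemma horizontal_segment (p r y : V) (a b : R) : p 0 1 = b -> r 0 1 = b -> p 0 0 <= a ->
  r 0 0 < a -> segment p r y -> y 0 1 = b /\ (y = p \/ y 0 0 < a).
Proof.
move=> pb rb pa ra /segmentP[t t01 ->]; split; first by rewrite !mxE pb rb; ring.
have [->|t0] := eqVneq t 0; first by left; rewrite subr0 scale1r scale0r addr0.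
have {}t0 : 0 < t by rewrite lt_def t0; lra.
by right; rewrite !mxE /=; nra.
Qed.

Lemma foot_segment (c y : V) : segment (c + pt (-1) (-2)) (c + pt (-1) (-1)) y ->
  y = c + pt (-1) (y 0 1 - c 0 1) /\ -2 <= y 0 1 - c 0 1 <= -1.
Proof.
move=> /segmentP[t t01 ->]; split.
  apply/rowP => i; rewrite !mxE; case: ifP => _; first by ring.
  by case: ifP => [/eqP ->|_] /=; ring.
by rewrite !mxE /=; apply/andP; split; lra.
Qed.

Lemma adj_height (z t : L) : adj z t -> (z 0 1)%:~R - 1 <= (t 0 1)%:~R :> R.
Proof.
move=> zt; have := rV_coord_le (embed z - embed t) 1; have := adj_norm R zt.
by rewrite !mxE => H1 H2; have := le_trans H2 H1; rewrite ler_norml; lra.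
Qed.

Lemma near_vertical (z : L) (b e : R) : 0 <= e -> `|b - (z 0 1)%:~R| <= e ->
  `|set_coord1 (embed z) b - embed z| <= e.
Proof.
move=> e0 be; apply/rV_norm_le => // i; rewrite !mxE; case: (eqVneq i 1) => [->//|_].
by rewrite subrr normr0.
Qed.

(** The corner is within 3 of its lattice vertex, and points of the hat or of the vertical piece
    below its left foot are within 2 of the right foot. *)
Lemma near_corner (u v : R) (p z : V) : `|p - z| <= 3 -> -1 <= u <= 1 -> -2 <= v <= 1 ->
  `|pt u v + (p - pt 1 (-1)) - z| <= 5.
Proof.
move=> pz u1 v1; have -> : pt u v + (p - pt 1 (-1)) - z = (pt u v - pt 1 (-1)) + (p - z).
  by apply/rowP => i; rewrite !mxE; ring.
have : `|pt u v - pt 1 (-1)| <= 2.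
  apply/rV_norm_le => // i; rewrite !mxE; case: ifP => _; first by rewrite ler_norml; lra.
  by case: ifP => _; [rewrite ler_norml; lra|rewrite subrr normr0].
by move=> H; rewrite (le_trans (ler_normD _ _)) //; lra.
Qed.

Section TopVertex.
Variables (a w : L) (s : seq L).
Local Notation q := (last w s).
Local Notation h := ((a 0 1)%:~R : R).
Hypotheses (ws : path adj w s) (us : uniq (a :: w :: s)) (aw : adj a w) (aq : adj a q).
Hypotheses (sN : s != [::]) (top : forall z, z \in w :: s -> z 0 1 <= a 0 1).
Hypothesis qw : q 0 0 <= w 0 0.

(** The leg over [w] ends in the right foot, at level [h + 2]. The leg over [q] stops at level
    [h + 1] to pass beneath the frame towards the left foot; [qw] makes this passage lead away from
    the leg over [w]. *)
Definition corner : V := set_coord1 (embed w) (h + 2).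
Definition knee : V := set_coord1 (embed q) (h + 1).
Definition hat_origin : V := corner - pt 1 (-1).
Local Notation foot v := (hat_origin + pt (-1) v).

(* The path, opened at its highest vertex [a]: legs go up from its two ends to
   the two feet of the frame placed at [hat_origin], above everything else. *)
Definition opened_path : set V := polyline w s `|` segment (embed q) knee `|`
  segment knee (foot (-2)) `|` segment (foot (-2)) (foot (-1)) `|` segment (embed w) corner.

Let topR z : z \in w :: s -> (z 0 1)%:~R <= h. Proof. by move/top; rewrite ler_int. Qed.
Let ws_q : q \in w :: s. Proof. exact: mem_last. Qed.
Let ws_w : w \in w :: s. Proof. exact: mem_head. Qed.

Let aws : a \notin w :: s. Proof. by case/andP: us. Qed.

Let wq : w != q.
Proof.
apply/eqP => wq; move: us => /andP[_ /andP[+ _]]; rewrite wq; case: (s) sN => //= b t _.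
by rewrite mem_last.
Qed.

Let off_q (u v : R) : set_coord1 (embed w) u <> set_coord1 (embed q) v.
Proof.
have [i i1 wqi] := adj_top aw aq (top ws_w) (top ws_q) wq.
move=> /rowP/(_ i); rewrite !set_coord1_other // !mxE => /eqP.
by rewrite eqr_int (negbTE wqi).
Qed.

Lemma leg_w y : segment (embed w) corner y ->
  y = set_coord1 (embed w) (y 0 1) /\ (w 0 1)%:~R <= y 0 1 <= h + 2.
Proof. by apply: vertical_segment; have := topR ws_w; lra. Qed.

Lemma leg_q y : segment (embed q) knee y ->
  y = set_coord1 (embed q) (y 0 1) /\ (q 0 1)%:~R <= y 0 1 <= h + 1.
Proof. by apply: vertical_segment; have := topR ws_q; lra. Qed.

Lemma hat_origin0 : hat_origin 0 0 = (w 0 0)%:~R - 1.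
Proof. by rewrite !mxE. Qed.

Lemma hat_origin1 : hat_origin 0 1 = h + 3.
Proof. by rewrite !mxE /=; lra. Qed.

Lemma knee_foot y : segment knee (foot (-2)) y ->
  y 0 1 = h + 1 /\ (y = knee \/ y 0 0 < (w 0 0)%:~R).
Proof.
apply: horizontal_segment; first by rewrite set_coord1_1.
- by rewrite mxE hat_origin1 pt1; lra.
- by rewrite set_coord1_0 mxE ler_int.
- by rewrite mxE hat_origin0 pt0; lra.
Qed.

Lemma foot_foot y : segment (foot (-2)) (foot (-1)) y ->
  y = foot (y 0 1 - (h + 3)) /\ h + 1 <= y 0 1 <= h + 2.
Proof. by move=> /foot_segment; rewrite hat_origin1 => -[? ?]; split=> //; lra. Qed.

(** Successive pieces from [w] through [q] to the left foot are separated by their heights. The leg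
    over [w], added last, is kept apart from the others by [off_q] or by its first coordinate. *)
Lemma opened_path_arc : arc opened_path corner (foot (-1)).
Proof.
have A1 : arc (polyline w s) (embed w) (embed q).
  by apply: polyline_arc => //; case/andP: us.
have low y : polyline w s y -> y 0 1 <= h := polyline_low ws sN topR.
have A2 : arc (polyline w s `|` segment (embed q) knee) (embed w) knee.
  apply: arc_cat_segment A1 _ => y [ys /leg_q[yE /andP[y1 _]]].
  apply: (leg_meets_polyline ws sN aws ws_q aq (top ws_q) _ yE ys).
  by rewrite y1; exact: low.
have A3 : arc (polyline w s `|` segment (embed q) knee `|` segment knee (foot (-2)))
    (embed w) (foot (-2)).
  apply: arc_cat_segment A2 _ => y [ys /knee_foot[y1 _]]; case: ys => [/low|/leg_q[yE _]].
    by rewrite y1 => ?; exfalso; lra.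
  by rewrite /= yE y1.
have A4 : arc (polyline w s `|` segment (embed q) knee `|` segment knee (foot (-2))
    `|` segment (foot (-2)) (foot (-1))) (embed w) (foot (-1)).
  apply: arc_cat_segment A3 _ => y [ys /foot_foot[yE y12]].
  suff y1 : y 0 1 = h + 1 by rewrite /= yE y1; congr (_ + pt _ _); lra.
  by case: ys => [[/low|/leg_q[_ /andP[_ y1]]]|/knee_foot[//]]; lra.
apply: arc_rev; apply: (arc_cat_segment (arc_rev A4)) => y [ys /leg_w[yE /andP[y1 _]]].
have y0 : y 0 0 = (w 0 0)%:~R by rewrite yE set_coord1_0 mxE.
case: ys => [[[ys|/leg_q[yE' _]]|/knee_foot[_ [yq|]]]|/foot_foot[yE' _]].
- apply: (leg_meets_polyline ws sN aws ws_w aw (top ws_w) _ yE ys).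
  by rewrite y1; exact: low.
- by exfalso; rewrite yE in yE'; exact: off_q yE'.
- by exfalso; rewrite yE in yq; exact: off_q yq.
- by rewrite y0 ltxx.
- by move: y0; rewrite yE' mxE hat_origin0 pt0 => ?; apply: (@lt0_absurd R); lra.
Qed.

Lemma opened_path_below y : opened_path y ->
  [\/ y 0 1 < h + 2, y = corner | y = foot (-1)].
Proof.
case=> [[[[/(polyline_low ws sN topR)|/leg_q[_ ?]]|/knee_foot[? _]]|/foot_foot[yE y1]]|].
- by move=> ?; constructor 1; lra.
- by constructor 1; lra.
- by constructor 1; lra.
- have [y2|y2] := eqVneq (y 0 1) (h + 2).
    by constructor 3; rewrite yE y2; congr (_ + pt _ _); lra.
  by constructor 1; rewrite lt_def eq_sym y2; lra.
move=> /leg_w[yE y1]; have [y2|y2] := eqVneq (y 0 1) (h + 2).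
  by constructor 2; rewrite yE y2.
by constructor 1; rewrite lt_def eq_sym y2; lra.
Qed.

Lemma opened_path_polygonal : finite_union_of_segments opened_path.
Proof.
by repeat apply: polygonalU; try exact: polygonal_segment; exact: polyline_polygonal.
Qed.

Lemma ends_near : `|embed q - embed w| <= 2.
Proof.
have -> : embed q - embed w = (embed q - embed a) + (embed a - embed w) by rewrite addrA subrK.
have := adj_norm R aw; have := adj_norm R aq; rewrite distrC => ? ?.
by rewrite (le_trans (ler_normD _ _)) //; lra.
Qed.

Lemma corner_near : `|corner - embed w| <= 3.
Proof.
apply: near_vertical => //; rewrite ler_norml.
by have := adj_height aw; have := topR ws_w; lra.
Qed.

Lemma knee_near : `|knee - embed w| <= 5.
Proof.
have kq : `|knee - embed q| <= 3.
  apply: near_vertical => //; rewrite ler_norml.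
  by have := adj_height aq; have := topR ws_q; lra.
have -> : knee - embed w = (knee - embed q) + (embed q - embed w) by rewrite addrA subrK.
by rewrite (le_trans (ler_normD _ _)) //; have := ends_near; lra.
Qed.

Lemma foot_near v : -2 <= v <= 1 -> `|foot v - embed w| <= 5.
Proof. by move=> v1; rewrite [hat_origin + _]addrC; apply: near_corner => //; [exact: corner_near|lra]. Qed.

Lemma opened_path_near y : opened_path y ->
  exists2 z, z \in a :: w :: s & `|y - embed z| <= 5.
Proof.
have near_w (p : V) : `|p - embed w| <= 5 -> exists2 z, z \in a :: w :: s & `|p - embed z| <= 5.
  by move=> H; exists w => //; rewrite inE mem_head orbT.
have f2 : `|foot (-2) - embed w| <= 5 by apply: foot_near; lra.
have f1 : `|foot (-1) - embed w| <= 5 by apply: foot_near; lra.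
case=> [[[[zs|zs]|zs]|zs]|zs].
- have [d ds dn] := polyline_near zs ws; exists d; first by rewrite inE ds orbT.
  by rewrite (le_trans dn) // ler1n.
- apply/near_w/(segment_ball _ knee_near zs).
  by rewrite (le_trans ends_near) // ler_nat.
- exact/near_w/(segment_ball knee_near f2 zs).
- exact/near_w/(segment_ball f2 f1 zs).
apply/near_w/(segment_ball _ _ zs); first by rewrite subrr normr0.
by rewrite (le_trans corner_near) // ler_nat.
Qed.

Lemma lattice_hat_right : exists (c : V) (B : set V), [/\ strict_low_arc B,
    forall x y, unit_seq x -> (B `|` hat x) y ->
      exists2 z, z \in a :: w :: s & `|y + c - embed z| <= 5 &
    forall z, z \in a :: w :: s -> exists2 y, B y & `|y + c - embed z| <= 1].
Proof.
pose c := hat_origin; pose B := (fun y => y - c) @` opened_path.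
have cc : continuous (fun y : V => y - c) by apply: ctsB; [move=> ?; exact: cvg_id|exact: cts_cst].
have ci : injective (fun y : V => y - c) by exact: addIr.
have p0c : corner - c = pt 1 (-1) by rewrite opprB addrC subrK.
have t2c : foot (-1) - c = pt (-1) (-1) by rewrite addrAC subrr add0r.
have strict (y : V) : B y -> [\/ y 0 1 < -1, y = pt 1 (-1) | y = pt (-1) (-1)].
  move=> [z /opened_path_below[zl|->|->] <-]; [constructor 1|by constructor 2|by constructor 3].
  have -> : (z - c) 0 1 = z 0 1 - (h + 3) by rewrite -hat_origin1 !mxE.
  by lra.
exists c, B; split.
- split=> //; split.
  + by rewrite -p0c -t2c; exact: arc_image cc ci opened_path_arc.
  + apply: polygonal_image; last exact: opened_path_polygonal.
    by move=> t d e; apply/rowP => i; rewrite !mxE; ring.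
  + by move=> y /strict[/ltW //|->|->]; rewrite pt1.
- move=> x y x01 [[z zB <-]|]; first by rewrite subrK; exact: opened_path_near.
  move=> [/spike_graphP[u u01 ->]|/frameP[u [v [-> u1 v1 _]]]]; (exists w; first by rewrite inE mem_head orbT).
    by apply: near_corner; [exact: corner_near|lra|have := spikes_unit u x01; lra].
  by apply: near_corner; [exact: corner_near| |lra].
have Bv z : z \in w :: s -> B (embed z - c).
  by move=> zs; exists (embed z) => //; do 4 left; exact: polyline_vertex.
move=> z; rewrite inE => /orP[/eqP ->|zs].
  (* The deleted vertex [a] is represented by its neighbour [w], at distance 1. *)
  exists (embed w - c); first exact: Bv.
  by rewrite subrK; apply: adj_norm; rewrite adj_sym.
by exists (embed z - c); [exact: Bv|rewrite subrK subrr normr0].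
Qed.

End TopVertex.

End LatticeHat.

Section LatticeCycle.
Context (R : realType) (n : nat).
Local Notation V := 'rV[R]_n.+2.
Local Notation L := 'rV[int]_n.+2.
Local Notation hat := (@hat R n).
Local Notation embed := (@embed R n.+2).

Definition eq_adj (z t : L) := (z == t) || adj z t.

Lemma uniq_path_adj (x : L) (s : seq L) : uniq (x :: s) -> path eq_adj x s -> path adj x s.
Proof.
elim: s x => //= y s IH x; rewrite inE negb_or /eq_adj.
by move=> /andP[/andP[/negbTE -> _] us] /= /andP[-> /=]; exact: IH.
Qed.

Lemma seq_top (c : seq L) : c != [::] -> exists2 a, a \in c & forall z, z \in c -> z 0 1 <= a 0 1.
Proof.
elim: c => // x c IH _; have [->|cN] := eqVneq c [::].
  by exists x; rewrite ?mem_head // => z; rewrite inE => /eqP ->.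
have [a ac atop] := IH cN; have [xa|ax] := leP (x 0 1) (a 0 1).
  by exists a; rewrite ?inE ?ac ?orbT // => z; rewrite inE => /orP[/eqP ->|/atop].
exists x; rewrite ?mem_head // => z; rewrite inE => /orP[/eqP ->//|/atop za].
exact: le_trans za (ltW ax).
Qed.

Lemma lattice_hat_cycle (c : seq L) : cycle eq_adj c -> uniq c -> (2 < size c)%N ->
  exists (o : V) (B : set V), [/\ strict_low_arc B,
    forall x y, unit_seq x -> (B `|` hat x) y ->
      exists2 z, z \in c & `|y + o - embed z| <= 5 &
    forall z, z \in c -> exists2 y, B y & `|y + o - embed z| <= 1].
Proof.
move=> cc uc sc; have [|a ac atop] := @seq_top c; first by case: (c) sc.
have [i c' rE] := rot_to ac.
have memc z : (z \in a :: c') = (z \in c) by rewrite -rE mem_rot.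
suff : exists (o : V) (B : set V), [/\ strict_low_arc B,
    forall x y, unit_seq x -> (B `|` hat x) y ->
      exists2 z, z \in a :: c' & `|y + o - embed z| <= 5 &
    forall z, z \in a :: c' -> exists2 y, B y & `|y + o - embed z| <= 1].
  move=> [c0 [B [sB n1 n2]]]; exists c0, B; split=> // [x y xu /n1[//|z]|z].
    by rewrite memc; exists z.
  by rewrite -memc; exact: n2.
have {uc} : uniq (a :: c') by rewrite -rE rot_uniq.
have {cc} : cycle eq_adj (a :: c') by rewrite -rE rot_cycle.
have {sc} : (1 < size c')%N by rewrite -ltnS -[(size c').+1]/(size (a :: c')) -rE size_rot.
have {}atop z : z \in c' -> z 0 1 <= a 0 1 by move=> zc; apply: atop; rewrite -memc inE zc orbT.
clear rE memc; case: c' atop => // w s top; rewrite /= ltnS => s0.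
rewrite rcons_path => /andP[aw /andP[ws la]] /andP[aws us].
have sN : s != [::] by rewrite -size_eq0 -lt0n.
have {}ws := uniq_path_adj us ws.
have {}aw : adj a w.
  by move: aw; rewrite /eq_adj => /orP[/eqP E|//]; rewrite E mem_head in aws.
have {}la : adj a (last w s).
  rewrite adj_sym; move: la; rewrite /eq_adj => /orP[/eqP E|//].
  by rewrite -E mem_last in aws.
have [lw|lw] := leP ((last w s) 0 0) (w 0 0).
  by apply: lattice_hat_right; rewrite //= aws us.
(* If the last vertex lies to the right of [w], traversing the path backwards exchanges the two
   neighbours of [a]. *)
have revE : rev (w :: s) = last w s :: rev (belast w s) by rewrite lastI rev_rcons.
have memr z : (z \in last w s :: rev (belast w s)) = (z \in w :: s).
  by rewrite -revE mem_rev.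
have lastr : last (last w s) (rev (belast w s)) = w.
  by case: (s) sN => //= y t _; rewrite rev_cons last_rcons.
have [||||||| c0 [B [sB n1 n2]]] := @lattice_hat_right R n a (last w s) (rev (belast w s)).
- by rewrite rev_path; apply: sub_path ws => z t; rewrite adj_sym.
- by rewrite -revE cons_uniq mem_rev rev_uniq aws; exact: us.
- exact: la.
- by rewrite lastr.
- by rewrite -size_eq0 size_rev size_belast size_eq0.
- by move=> z; rewrite memr; exact: top.
- by rewrite lastr ltW.
exists c0, B; split=> // [x y xu /n1[//|z]|z].
  by rewrite inE memr -in_cons; exists z.
by move=> zs; apply: n2; rewrite inE memr -in_cons.
Qed.

End LatticeCycle.
Arguments eq_adj {n}.

(** * Rounding a closed curve to the lattice *)

Section Density.
Context (R : realType) (n : nat).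
Local Notation V := 'rV[R]_n.+2.
Local Notation L := 'rV[int]_n.+2.
Local Notation hat := (@hat R n).
Local Notation embed := (@embed R n.+2).

Definition sim (w : V) (l : R) (y : V) : V := w + l *: y.

Variable g : R -> V.
Hypothesis gc : continuous g.
Hypothesis gE : forall s t, g s = g t <-> s - t \is a Num.int.

Lemma loop_int s (m : int) : g (s + m%:~R) = g s.
Proof. by apply/gE; rewrite addrAC subrr add0r intr_int. Qed.

Lemma frac01 (s : R) : 0 <= s - (Num.floor s)%:~R /\ s - (Num.floor s)%:~R < 1.
Proof. by rewrite subr_ge0 floor_le ltrBlDl -intrD1 floorD1_gt. Qed.

Lemma loop_unif (e : R) : 0 < e ->
  exists2 d, 0 < d & forall s t, `|s - t| < d -> `|g s - g t| < e.
Proof.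
move=> e0; have [d [d0 dP]] := filter_ex (filterI (nbhs_right_gt (0 : R))
  (near_unif_continuous (segment01_compact (R := R)) gc e0)).
exists d => // s t st; have [f0 f1] := frac01 s.
rewrite -(loop_int s (- Num.floor s)) -(loop_int t (- Num.floor s)) !rmorphN /=.
apply: dP; first by rewrite /= in_itv /= f0 ltW.
by rewrite opprB addrA subrK.
Qed.

(** The distance between points whose parameters differ by an amount in [[h, 1 - h]] attains a
    positive minimum [r], by compactness and injectivity. *)
Lemma loop_separation (h : R) : 0 < h -> h <= 8^-1 ->
  exists2 r, 0 < r & forall s t, `|g s - g t| < r -> exists m : int, `|s - t - m%:~R| < h.
Proof.
move=> h0 h8; pose K := (`[h, 1 - h]%classic `*` `[0, 1]%classic : set (R * R)).
pose F (p : R * R) := `|g (p.2 + p.1) - g p.2|.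
have Kc : compact K by apply: compact_setX; exact: segment_compact.
have f1 : continuous (fun p : R * R => p.1) by move=> ?; exact: cvg_fst.
have f2 : continuous (fun p : R * R => p.2) by move=> ?; exact: cvg_snd.
have Fc : continuous F.
  apply: cts_norm; apply: ctsB; last exact: (cts_comp f2 gc).
  by apply: (cts_comp _ gc); apply: (@ctsD _ _ R^o).
have K0 : K !=set0.
  by exists (h, 0); split; rewrite /= in_itv /=; lra.
have [p /set_mem [p1 p2] pmin] := compact_EVT_min K0 Kc (continuous_subspaceT Fc).
exists (F p).
  rewrite normr_gt0 subr_eq0; apply/eqP => /gE; rewrite addrAC subrr add0r => /intrP[m pm].
  move: p1; rewrite /= in_itv /= pm => hm.
  have m0 : 0 < m by rewrite -(@ltr_int R); lra.
  have m1 : m < 1 by rewrite -(@ltr_int R); lra.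
  by lia.
move=> s t st; have [r0 r1] := frac01 (s - t); set m := Num.floor (s - t) in r0 r1 *.
have [rh|rh] := ltP (s - t - m%:~R) h.
  by exists m; rewrite ger0_norm.
have [rh'|rh'] := ltP (1 - h) (s - t - m%:~R).
  by exists (m + 1); rewrite rmorphD /= ltr_norml; lra.
exfalso; move: st; apply/negP; rewrite -leNgt.
have [t0 t1] := frac01 t.
have -> : `|g s - g t| = F (s - t - m%:~R, t - (Num.floor t)%:~R).
  rewrite /F /=; congr (`|_ - _|).
    rewrite -(loop_int s (- m - Num.floor t)) rmorphB rmorphN /=; congr g; ring.
  by rewrite -(loop_int t (- Num.floor t)) rmorphN.
by apply: pmin; apply/mem_set; split; rewrite /= in_itv /= ?rh ?rh' ?t0 ?ltW.
Qed.

Lemma floor_near (x y : R) : `|x - y| < 1 -> `|Num.floor x - Num.floor y| <= 1.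
Proof.
have key (a b : R) : a < b + 1 -> Num.floor a <= Num.floor b + 1 :> int.
  move=> ab; rewrite -ltzD1 -(ltr_int R) (le_lt_trans (floor_le a)) // (lt_trans ab) //.
  by rewrite intrD1 ltrD2r floorD1_gt.
rewrite ltr_norml => /andP[xy yx]; rewrite ler_norml.
have : Num.floor x <= Num.floor y + 1 by apply: key; lra.
have : Num.floor y <= Num.floor x + 1 by apply: key; lra.
by lia.
Qed.

Lemma scaled_floor_near (l x : R) : 0 < l -> `|l * (Num.floor (x / l))%:~R - x| <= l.
Proof.
move=> l0; have [f0 f1] := frac01 (x / l); set f := (Num.floor _)%:~R in f0 f1 *.
have -> : l * f - x = - (l * (x / l - f)) by field; rewrite gt_eqF.
by rewrite normrN ger0_norm ?mulr_ge0 ?(ltW l0) // ler_piMr ?(ltW l0) // ltW.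
Qed.

(* Rounding one coordinate at a time makes consecutive points equal or adjacent. *)
Definition rounding (l : R) (M : nat) (j : nat) : L :=
  \row_i Num.floor (g (((j + i) %/ n.+2)%:R / M%:R) 0 i / l).

Variables (l : R) (M : nat).
Hypothesis l0 : 0 < l.
Hypothesis M0 : (0 < M)%N.
Hypothesis gM : forall s t, `|s - t| <= M%:R^-1 -> `|g s - g t| < l.

Let P := (n.+2 * M)%N.

Lemma rounding_period j : rounding l M (j + P) = rounding l M j.
Proof.
apply/rowP => i; rewrite !mxE; congr (Num.floor (_ 0 i / l)).
have -> : ((j + P + i) %/ n.+2 = (j + i) %/ n.+2 + M)%N.
  rewrite (_ : j + P + i = M * n.+2 + (j + i))%N; last by rewrite /P; lia.
  by rewrite divnMDl // addnC.
rewrite natrD mulrDl divff ?pnatr_eq0 -?lt0n //.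
congr fun_of_matrix; exact: (loop_int _ 1).
Qed.

(** From [j] to [j.+1] only the coordinate [i] with [n.+2] dividing [j + i + 1] is sampled anew, and
    its floor changes by at most 1. *)
Lemma rounding_step j : eq_adj (rounding l M j) (rounding l M j.+1).
Proof.
have M0' : 0 < M%:R :> R by rewrite ltr0n.
have near (i : 'I_n.+2) : `|rounding l M j 0 i - rounding l M j.+1 0 i| <= 1.
  rewrite !mxE; apply: floor_near; rewrite -mulrBl normrM (gtr0_norm (_ : 0 < l^-1)) ?invr_gt0 //.
  rewrite ltr_pdivrMr // mul1r.
  set a := _ / M%:R; set b := _ / M%:R.
  have -> : g a 0 i - g b 0 i = (g a - g b) 0 i by rewrite !mxE.
  apply: le_lt_trans (rV_coord_le _ _) _; apply: gM.
  rewrite /a /b -mulrBl normrM (gtr0_norm (_ : 0 < M%:R^-1)) ?invr_gt0 //.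
  rewrite ler_piMl ?invr_ge0 ?(ltW M0') //.
  have [-> |->] : ((j.+1 + i) %/ n.+2 = (j + i) %/ n.+2 \/ (j.+1 + i) %/ n.+2 = ((j + i) %/ n.+2).+1)%N.
    by rewrite addSn divnS //; case: (_ %| _)%N; [right; rewrite add1n|left; rewrite add0n].
  - by rewrite subrr normr0.
  - by rewrite -natr1 opprD addrA subrr add0r normrN1.
have same (i : 'I_n.+2) : ~~ (n.+2 %| (j + i).+1)%N -> rounding l M j 0 i = rounding l M j.+1 0 i.
  by move=> ndvd; rewrite !mxE addSn divnS // (negbTE ndvd) add0n.
apply/orP; have [i idvd|none] := pickP (fun i : 'I_n.+2 => (n.+2 %| (j + i).+1)%N); last first.
  by left; apply/eqP/rowP => i; apply: same; rewrite none.
have uniq_i (k : 'I_n.+2) : k != i -> ~~ (n.+2 %| (j + k).+1)%N.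
  move=> ki; apply/negP => kdvd; case/eqP: ki; apply: val_inj => /=.
  have /eqP : (j.+1 + k = j.+1 + i %[mod n.+2])%N by rewrite !addSn (eqP idvd) (eqP kdvd).
  by rewrite eqn_modDl !modn_small // => /eqP.
have [e|ne] := eqVneq (rounding l M j 0 i) (rounding l M j.+1 0 i).
  by left; apply/eqP/rowP => k; have [->//|/uniq_i/same] := eqVneq k i.
right; apply/adjP; exists i; split; first by have := near i; lia.
by move=> k /uniq_i/same.
Qed.

(** One [l] accounts for the delayed sampling of the coordinates, the other for the floor. *)
Lemma rounding_near j : `|l *: embed (rounding l M j) - g (j%:R / P%:R)| <= 2 * l.
Proof.
have M0' : 0 < M%:R :> R by rewrite ltr0n.
apply/rV_norm_le; [by rewrite mulr_ge0 // ltW|].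
move=> i; rewrite !mxE; set a := ((j + i) %/ n.+2)%:R / M%:R.
have H : `|g a 0 i - g (j%:R / P%:R) 0 i| <= l.
  have -> : g a 0 i - g (j%:R / P%:R) 0 i = (g a - g (j%:R / P%:R)) 0 i by rewrite !mxE.
  apply: le_trans (rV_coord_le _ _) _; apply/ltW/gM.
  have -> : a - j%:R / P%:R = (((j + i) %/ n.+2 * n.+2)%:R - j%:R) / n.+2%:R / M%:R.
    rewrite /a /P !natrM; field; rewrite gt_eqF //= -/(n.+2)%N; lra.
  rewrite normrM (gtr0_norm (_ : 0 < M%:R^-1)) ?invr_gt0 // ler_piMl ?invr_ge0 ?(ltW M0') //.
  rewrite normrM (gtr0_norm (_ : 0 < n.+2%:R^-1)) ?invr_gt0 // ler_pdivrMr // mul1r.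
  have := divn_eq (j + i) n.+2; have := ltn_pmod (j + i) (ltn0Sn n.+1); have := ltn_ord i.
  set q := ((j + i) %/ n.+2 * n.+2)%N; set r := ((j + i) %% n.+2)%N => ilt rlt E.
  have : q%:R <= (j + n.+2)%:R :> R by rewrite ler_nat; lia.
  have : j%:R <= (q + n.+2)%:R :> R by rewrite ler_nat; lia.
  by rewrite !natrD ler_norml => ? ?; apply/andP; split; lra.
have := scaled_floor_near (g a 0 i) l0; move: H; rewrite !ler_norml.
by move=> /andP[? ?] /andP[? ?]; apply/andP; split; lra.
Qed.

End Density.

Lemma int_near01 (R : realType) (m : int) (x h : R) : 0 <= x -> x <= 1 -> h <= 8^-1 ->
  `|x - m%:~R| < h -> x < h \/ 1 - x < h.
Proof.
move=> x0 x1 h8; rewrite ltr_norml => /andP[m1 m2].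
have ml : -1 < m by rewrite -(@ltr_int R) mulrN1z; lra.
have mu : m < 2 by rewrite -(@ltr_int R); lra.
have [m0|m0] : m = 0 \/ m = 1 by clear -ml mu; lia.
  by left; move: m2; rewrite m0; lra.
by right; move: m1; rewrite m0; lra.
Qed.

Section DensityTheorem.
Context (R : realType) (n : nat).
Local Notation V := 'rV[R]_n.+2.
Local Notation hat := (@hat R n).
Local Notation embed := (@embed R n.+2).

Lemma scc_density (C : set V) (e : R) :
  homeomorphic (set_type C) (set_type (@unit_circle R)) -> 0 < e ->
  exists2 d, 0 < d & forall l, 0 < l < d -> exists (w : V) (B : set V),
    strict_low_arc B /\
    forall x, unit_seq x -> hclose e C (sim w l @` (B `|` hat x)).
Proof.
move=> /homeomorphic_loop[g [gc CE gE]] e0.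
have e4 : 0 < e / 4 by rewrite divr_gt0.
have [d d0 dP] := loop_unif gc gE e4.
(* [d / 2] leaves room for one sampling step besides the gap [h]; [8^-1] leaves room for three gaps
   within a period, as loop erasure requires. *)
pose h := Num.min (d / 2) 8^-1.
have h0 : 0 < h by rewrite lt_min divr_gt0 //= invr_gt0.
have [hd h8] : h <= d / 2 /\ h <= 8^-1 by rewrite !ge_min !lexx orbT.
have [r r0 rP] := loop_separation gc gE h0 h8.
(* Equal or adjacent lattice points come from points of the curve at distance at most [5 * l < r].
   The final errors, bounded by [7 * l] and [e / 4 + 3 * l], stay below [e]. *)
exists (Num.min (r / 6) (e / 16)); first by rewrite lt_min !divr_gt0.
move=> l /andP[l0]; rewrite lt_min => /andP[lr le].
have [dl dl0 dlP] := loop_unif gc gE l0.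
(* Fine enough that [g] varies by less than [l] over 1/M, and that [h * M >= 1], which makes [k]
   positive. *)
pose M := (Num.truncn dl^-1 + Num.truncn h^-1).+1.
have M0 : 0 < M%:R :> R by rewrite ltr0n.
have Mdl : M%:R^-1 < dl.
  rewrite -[ltRHS]invrK ltf_pV2 ?posrE ?invr_gt0 // (lt_le_trans (truncnS_gt _)) //.
  by rewrite ler_nat ltnS leq_addr.
have Mh : 1 <= h * M%:R.
  rewrite -ler_pdivrMl // mulr1 (le_trans (ltW (truncnS_gt _))) //.
  by rewrite ler_nat ltnS leq_addl.
have gM s t : `|s - t| <= M%:R^-1 -> `|g s - g t| < l.
  by move=> st; apply: dlP; exact: le_lt_trans st Mdl.
pose P := (n.+2 * M)%N.
have P0 : 0 < P%:R :> R by rewrite ltr0n.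
have hP : 1 <= h * P%:R.
  by rewrite (le_trans Mh) // ler_pM2l // ler_nat leq_pmull.
pose w j := rounding g l M j.
pose k := Num.truncn (h * P%:R).
have kP : k%:R <= h * P%:R by rewrite truncn_le // (le_trans ler01).
have wnear j : `|l *: embed (w j) - g (j%:R / P%:R)| <= 2 * l.
  exact: rounding_near.
have w_near i j : (i <= j <= i + P)%N -> eq_adj (w i) (w j) ->
    (j <= i + k)%N || (i + P <= j + k)%N.
  move=> /andP[ij jP] wij.
  have ww : `|l *: embed (w j) - l *: embed (w i)| <= l.
    rewrite -scalerBr normrZ gtr0_norm // ler_piMr ?(ltW l0) //.
    case/orP: wij => [/eqP ->|]; first by rewrite subrr normr0.
    by rewrite adj_sym; exact: adj_norm.
  have [m mP] : exists m : int, `|j%:R / P%:R - i%:R / P%:R - m%:~R| < h.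
    apply: rP; rewrite (le_lt_trans (ler_distD (l *: embed (w j)) _ _)) //.
    have := ler_distD (l *: embed (w i)) (l *: embed (w j)) (g (i%:R / P%:R)).
    have := wnear j; have := wnear i; rewrite distrC (distrC (l *: embed (w j)) (g _)).
    by clear -l0 lr ww; lra.
  have x0 : (0 : R) <= j%:R / P%:R - i%:R / P%:R.
    by rewrite -mulrBl divr_ge0 ?(ltW P0) // subr_ge0 ler_nat.
  have x1 : j%:R / P%:R - i%:R / P%:R <= (1 : R).
    by rewrite -mulrBl ler_pdivrMr // mul1r lerBlDl -natrD ler_nat.
  have [xh|xh] := int_near01 x0 x1 h8 mP.
    have : (j - i)%:R <= h * P%:R.
      by rewrite natrB // -ler_pdivrMr // mulrBl ltW.
    rewrite -truncn_ge_nat ?mulr_ge0 ?ler0n ?(ltW h0) // -/k leq_subLR.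
    by move=> ->.
  have : (i + P - j)%:R <= h * P%:R.
    rewrite natrB // natrD -ler_pdivrMr // mulrBl mulrDl divff ?gt_eqF //.
    by rewrite (_ : _ - _ = 1 - (j%:R / P%:R - i%:R / P%:R)); [exact: ltW|ring].
  rewrite -truncn_ge_nat ?mulr_ge0 ?ler0n ?(ltW h0) // -/k leq_subLR.
  by move=> ->; rewrite orbT.
have hP8 : h * P%:R <= 8^-1 * P%:R by rewrite ler_pM2r.
have k3 : (3 * k < P)%N by rewrite -(ltr_nat R) natrM; clear -kP P0 hP8; lra.
have k0 : (0 < k)%N by rewrite truncn_ge_nat ?mulr_ge0 ?ler0n ?(ltW h0).
have wP j : w (j + P)%N = w j by apply: rounding_period.
have w_step j : eq_adj (w j) (w j.+1) by apply: rounding_step.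
have [i0 [s [ps ls us]]] := loop_erasure wP w_step w_near k3 k0.
have ss := hop_path_size k3 k0 ps ls.
set c := map w (belast i0 s) in us.
have cc : cycle eq_adj c.
  case/lastP: s ps ls ss @c us => // t b; rewrite belast_rcons last_rcons => pt bE _ c _.
  have : path eq_adj (w i0) (map w (rcons t b)).
    rewrite (path_map (f := w)); apply: sub_path pt => i j /and3P[_ _]; exact.
  by rewrite map_rcons bE wP.
have sc : (2 < size c)%N by rewrite size_map size_belast ltnW.
have [c0 [B [sB n1 n2]]] := lattice_hat_cycle R cc us sc.
exists (l *: c0), B; split=> // x x01.
have simE y : sim (l *: c0) l y = l *: (y + c0) by rewrite /sim -scalerDr addrC.
have close y z (t : R) : `|y + c0 - embed z| <= t -> `|sim (l *: c0) l y - l *: embed z| <= t * l.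
  by move=> yz; rewrite simE -scalerBr normrZ gtr0_norm // mulrC ler_pM2r.
split=> [x0 | _ [y Ey <-]].
  rewrite CE => -[t _ <-].
  have [f0 f1] := frac01 (t - i0%:R / P%:R).
  set f := t - _ - _ in f0 f1.
  have gt : g t = g (i0%:R / P%:R + f).
    rewrite -(loop_int gE t (- Num.floor (t - i0%:R / P%:R))) rmorphN /=; congr g.
    by rewrite /f; ring.
  have fP0 : 0 <= f * P%:R by rewrite mulr_ge0 ?(ltW P0).
  have fP1 := truncn_itv fP0; set q := Num.truncn _ in fP1.
  have qP : (q < P)%N.
    rewrite -(ltr_nat R); case/andP: fP1 => fq _; apply: le_lt_trans fq _.
    by rewrite gtr_pMl.
  (* [i0 + q] is the last sampling index up to the parameter of the given point. The kept index [b]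
     is at most [k] steps earlier, so the parameters differ by less than [2 * h <= d]. *)
  have [|b bs] := hop_path_near ps (j := (i0 + q)%N).
    by rewrite leq_addr ls ltn_add2l.
  move=> /andP[bq qb].
  have cb : w b \in c by apply: map_f.
  have [y By yb] := n2 _ cb.
  exists (sim (l *: c0) l y); first by exists y => //; left.
  have gtb : `|g t - g (b%:R / P%:R)| < e / 4.
    rewrite gt; apply: dP; case/andP: fP1 => fq fq1.
    have bR : b%:R <= i0%:R + q%:R :> R by rewrite -natrD ler_nat.
    have qR : i0%:R + q%:R <= b%:R + k%:R :> R by rewrite -!natrD ler_nat.
    have -> : i0%:R / P%:R + f - b%:R / P%:R = (i0%:R + f * P%:R - b%:R) / P%:R.
      by field; rewrite gt_eqF.
    rewrite normrM (gtr0_norm (_ : 0 < P%:R^-1)) ?invr_gt0 // ltr_pdivrMr //.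
    rewrite -natr1 in fq1; rewrite ger0_norm; last by clear -fq bR; lra.
    have : 2 * (h * P%:R) <= d * P%:R by rewrite mulrA ler_pM2r //; clear -hd; lra.
    by clear -fq1 qR kP hP; lra.
  have := close _ _ _ yb; have := wnear b => H1 H2.
  rewrite (le_lt_trans (ler_distD (g (b%:R / P%:R)) _ _)) //.
  have H3 : `|g (b%:R / P%:R) - sim (l *: c0) l y| <= 2 * l + 1 * l.
    by rewrite (le_trans (ler_distD (l *: embed (w b)) _ _)) // lerD // distrC.
  by clear -H3 gtb le l0 e0; lra.
have [z /mapP[b bs ->] yb] := n1 x y x01 Ey.
have [f0 f1] := frac01 (b%:R / P%:R : R).
have Cb : C (g (b%:R / P%:R)).
  rewrite CE -(loop_int gE (b%:R / P%:R) (- Num.floor (b%:R / P%:R : R))) rmorphN /=.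
  by eexists; [|reflexivity]; rewrite /= in_itv /= f0 ltW.
exists (g (b%:R / P%:R)) => //.
have := close _ _ _ yb; have := wnear b => H1 H2.
rewrite (le_lt_trans (ler_distD (l *: embed (w b)) _ _)) //.
rewrite (distrC (g _)) (distrC _ (sim _ _ _)).
by clear -H1 H2 le l0; lra.
Qed.

End DensityTheorem.

(** * Paths of curves with spikes *)

Section Similarity.
Context (R : realType) (n : nat).
Local Notation V := 'rV[R]_n.+2.
Local Notation pt := (@pt R n).
Local Notation hat := (@hat R n).
Implicit Types (A B : set V) (w y : V) (l : R).

Lemma sim_continuous w l : continuous (sim w l).
Proof.
apply: ctsD; first exact: cts_cst.
by apply: ctsZ; [exact: cts_cst|move=> ?; exact: cvg_id].
Qed.

Lemma simK w l : l != 0 -> cancel (sim w l) (sim (- (l^-1 *: w)) l^-1).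
Proof.
by move=> l0 y; rewrite /sim scalerDr addKr scalerA mulVf // scale1r.
Qed.

Lemma simKV w l : l != 0 -> cancel (sim (- (l^-1 *: w)) l^-1) (sim w l).
Proof.
by move=> l0 y; rewrite /sim scalerDr scalerN !scalerA mulfV // !scale1r addrA subrr add0r.
Qed.

Lemma sim_homeomorphism w l : l != 0 -> homeomorphism (sim w l).
Proof.
move=> l0; exists (sim (- (l^-1 *: w)) l^-1); split.
- exact: simK.
- exact: simKV.
- exact: sim_continuous.
- exact: sim_continuous.
Qed.

Lemma sim_affine w l t y z : sim w l ((1 - t) *: y + t *: z) = (1 - t) *: sim w l y + t *: sim w l z.
Proof. by apply/rowP => i; rewrite !mxE; ring. Qed.

Lemma sim_hclose w w' l e e' A A' : 0 < l -> hclose e A A' -> `|w - w'| < e' ->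
  hclose (e' + l * e) (sim w l @` A) (sim w' l @` A').
Proof.
move=> l0 [AA A'A] ww.
have key y z : `|y - z| < e -> `|sim w l y - sim w' l z| < e' + l * e.
  move=> yz; have -> : sim w l y - sim w' l z = (w - w') + l *: (y - z).
    by apply/rowP => i; rewrite !mxE; ring.
  rewrite (le_lt_trans (ler_normD _ _)) // ltrD // normrZ gtr0_norm //.
  by rewrite ltr_pM2l.
split=> [_ [y /AA[z Az yz] <-]|_ [z /A'A[y Ay yz] <-]].
  by exists (sim w' l z); [exists z|exact: key].
by exists (sim w l y); [exists y|exact: key].
Qed.

Lemma sim_continuum w l A : is_continuum A -> is_continuum (sim w l @` A).
Proof.
move=> [[y Ay] Ac Acn]; split.
- by exists (sim w l y); exists y.
- by apply: continuous_compact => //; apply: continuous_subspaceT; exact: sim_continuous.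
- by apply: connected_continuous_connected => //; apply: continuous_subspaceT; exact: sim_continuous.
Qed.

Lemma sim_homeomorphic w l A : l != 0 -> compact A ->
  homeomorphic (set_type (sim w l @` A)) (set_type A).
Proof.
move=> l0 Ac; apply: homeomorphic_image => //; try exact: norm_hausdorff.
- exact: sim_continuous.
- exact: can_inj (simK _ l0).
Qed.

Lemma sim_polygonal w l A : l != 0 ->
  finite_union_of_segments (sim w l @` A) <-> finite_union_of_segments A.
Proof.
move=> l0; split=> pA; last by apply: polygonal_image => // t a b; exact: sim_affine.
have -> : A = sim (- (l^-1 *: w)) l^-1 @` (sim w l @` A).
  rewrite image_comp; apply/seteqP; split=> [y Ay|_ [y Ay <-]]; last by rewrite /= simK.
  by exists y => //=; rewrite simK.
by apply: polygonal_image => // t a b; exact: sim_affine.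
Qed.

Lemma hat_top x y : unit_seq x -> hat x y ->
  [/\ y 0 1 <= 1 & y 0 1 = 1 -> -1 <= y 0 0 /\ (y 0 0 = -1 -> y = pt (-1) 1)].
Proof.
move=> x01 [/spike_graphP[u u01 ->]|/frameP[u [v [-> u1 v1 uv]]]]; rewrite pt0 pt1; split.
- by have := spikes_unit u x01; lra.
- by move=> _; split; [lra|move=> uE; exfalso; lra].
- lra.
- by move=> vE; split; [lra|move=> uE; rewrite uE vE].
Qed.

Lemma hat_corner x : hat x (pt (-1) 1).
Proof. by right; left; left; left; exact: segment_right. Qed.

(* The top left corner is the lowest point, for the order of u, among the
   highest points, so that it can be read off the set. *)
Lemma hat_translation B B' x x' (c : V) : (forall z, B z -> z 0 1 <= -1) ->
  (forall z, B' z -> z 0 1 <= -1) -> unit_seq x -> unit_seq x' ->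
  (forall y, (B `|` hat x) y -> (B' `|` hat x') (y + c)) ->
  (forall y, (B' `|` hat x') y -> (B `|` hat x) (y - c)) -> c = 0.
Proof.
move=> Bl Bl' x01 x'01 BB' B'B.
have top A z y : (forall z, A z -> z 0 1 <= -1) -> unit_seq z -> (A `|` hat z) y ->
    [/\ y 0 1 <= 1 & y 0 1 = 1 -> -1 <= y 0 0 /\ (y 0 0 = -1 -> y = pt (-1) 1)].
  move=> Al z01 [/Al yl|]; last exact: hat_top.
  by split; [lra|move=> y1; exfalso; lra].
have H1 : (B' `|` hat x') (pt (-1) 1 + c) by apply: BB'; right; exact: hat_corner.
have H2 : (B `|` hat x) (pt (-1) 1 - c) by apply: B'B; right; exact: hat_corner.
have [a1 a2] := top _ _ _ Bl' x'01 H1; have [b1 b2] := top _ _ _ Bl x01 H2.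
have e1 : (pt (-1) 1 + c) 0 1 = 1 + c 0 1 by rewrite !mxE.
have e2 : (pt (-1) 1 - c) 0 1 = 1 - c 0 1 by rewrite !mxE.
have f1 : (pt (-1) 1 + c) 0 0 = -1 + c 0 0 by rewrite !mxE.
have f2 : (pt (-1) 1 - c) 0 0 = -1 - c 0 0 by rewrite !mxE.
rewrite e1 in a1 a2; rewrite e2 in b1 b2; rewrite f1 in a2; rewrite f2 in b2.
have c1 : c 0 1 = 0 by lra.
have [a3 a4] := a2 ltac:(lra); have [b3 _] := b2 ltac:(lra).
have /a4 E : -1 + c 0 0 = -1 by lra.
by rewrite -[LHS](addKr (pt (-1) 1)) E addNr.
Qed.

(** With a common scale the two sets differ by a translation, which [hat_translation] shows to be
    zero. Over [tent_mid] the only point of the set above height -1 is then the tip, whose height is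
    [x j]. *)
Lemma hat_recover w w' l B B' x x' : 0 < l -> (forall z, B z -> z 0 1 <= -1) ->
  (forall z, B' z -> z 0 1 <= -1) -> unit_seq x -> unit_seq x' ->
  sim w l @` (B `|` hat x) = sim w' l @` (B' `|` hat x') -> forall j, x j = x' j.
Proof.
move=> l0 Bl Bl' x01 x'01 E; have lN : l != 0 by rewrite gt_eqF.
pose c := l^-1 *: (w - w').
have simc y z : sim w l y = sim w' l z -> z = y + c.
  move=> yz; apply: (can_inj (simK w' lN)); rewrite -yz /sim /c scalerDr scalerA mulfV // scale1r.
  by apply/rowP => i; rewrite !mxE; ring.
have BB' y : (B `|` hat x) y -> (B' `|` hat x') (y + c).
  move=> By; have : (sim w' l @` (B' `|` hat x')) (sim w l y) by rewrite -E; exists y.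
  by move=> [z Bz /esym/simc <-].
have B'B z : (B' `|` hat x') z -> (B `|` hat x) (z - c).
  move=> Bz; have : (sim w l @` (B `|` hat x)) (sim w' l z) by rewrite E; exists z.
  by move=> [y By /simc ->]; rewrite addrK.
have c0 := hat_translation Bl Bl' x01 x'01 BB' B'B.
move=> j; have := BB' _ (tip_mem B x j); rewrite c0 addr0.
have /andP[lm mr] := tent_mid_bounds R j.
have m0 : 0 < tent_mid R j := lt_trans (tent_left_gt0 _ _) lm.
have m1 : tent_mid R j < 1 := lt_le_trans mr (tent_right_le1 _ _).
have /andP[xj0 _] := x01 j.
move=> [/Bl'|[/spike_graphP[u u01 /pt_inj[<-]]|/frameP[u [v [/pt_inj[<- _] _ _ uv]]]]].
- by rewrite pt1 => ?; exfalso; lra.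
- by rewrite spikes_mid.
- by exfalso; case: uv => [?|[? _]|[? _]|[? _]]; lra.
Qed.

(** The homothety of ratio [s] about (0, -1), the midpoint of the feet; the two segments reconnect
    the shrunken arc to the feet. *)
Definition shrink B (s : R) : set V :=
  sim (pt 0 (s - 1)) s @` B `|` segment (pt 1 (-1)) (pt s (-1))
    `|` segment (pt (- s) (-1)) (pt (-1) (-1)).

Lemma sim_pt u v s u' v' : sim (pt u v) s (pt u' v') = pt (u + s * u') (v + s * v').
Proof. by apply/rowP => i; rewrite !mxE; case: ifP => // _; case: ifP => // _; ring. Qed.

Lemma shrink1 B : strict_low_arc B -> shrink B 1 = B.
Proof.
move=> [[Barc _ _] _]; have [Bp Bq _] := arc_ends Barc.
rewrite /shrink !segmentxx subrr.
have -> : sim (pt 0 0) 1 @` B = B.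
  have z : pt 0 0 = 0 :> V by apply/rowP => i; rewrite !mxE; do 2 case: ifP => // _.
  by apply: image_id_on => y _; rewrite /sim scale1r z add0r.
apply/seteqP; split=> [y [[//|->]|->] //|y By]; by left; left.
Qed.

Lemma shrink0 B : B !=set0 -> shrink B 0 = segment (pt 1 (-1)) (pt (-1) (-1)).
Proof.
move=> [z Bz]; rewrite /shrink oppr0 sub0r; apply/seteqP; split=> y.
  move=> [[[a Ba <-]|/segment_ptP[t t01 ->]]|/segment_ptP[t t01 ->]]; apply/segment_ptP.
  - exists 2^-1; first lra.
    rewrite /sim scale0r addr0; congr pt; lra.
  - by exists (t / 2); [lra|congr pt; lra].
  - by exists ((1 + t) / 2); [lra|congr pt; lra].
move=> /segment_ptP[t t01 ->]; have [t2|t2] := leP t 2^-1; [left; right|right]; apply/segment_ptP.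
  by exists (2 * t); [lra|congr pt; lra].
by exists (2 * t - 1); [lra|congr pt; lra].
Qed.

Lemma segment_low_arc : low_arc (segment (pt 1 (-1)) (pt (-1) (-1))).
Proof.
split.
- by apply: segment_arc; apply/eqP => /pt_inj[? _]; lra.
- exact: polygonal_segment.
- by move=> y /segment_ptP[t t01 ->]; rewrite pt1; lra.
Qed.

Lemma shrink_low_arc B s : strict_low_arc B -> 0 <= s <= 1 -> low_arc (shrink B s).
Proof.
move=> sB s01; have [[Barc Bp Bl] Bs] := sB; have [Bpp Bqq _] := arc_ends Barc.
have [->|s0] := eqVneq s 0.
  by rewrite shrink0; [exact: segment_low_arc|exists (pt 1 (-1))].
have {}s0 : 0 < s by rewrite lt_def s0; lra.
have v1 y : sim (pt 0 (s - 1)) s y 0 1 = -1 + s * (y 0 1 + 1) by rewrite !mxE /=; ring.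
split.
- have A1 : arc (sim (pt 0 (s - 1)) s @` B) (pt s (-1)) (pt (- s) (-1)).
    have := arc_image (sim_continuous (w := pt 0 (s - 1)) (l := s))
      (can_inj (simK _ (lt0r_neq0 s0))) Barc.
    by rewrite !sim_pt; congr (arc _ (pt _ _) (pt _ _)); ring.
  have ends y : (sim (pt 0 (s - 1)) s @` B) y -> [\/ y 0 1 < -1, y = pt s (-1) | y = pt (- s) (-1)].
    move=> [z Bz <-]; have [zl|->|->] := Bs z Bz.
    + by constructor 1; rewrite v1; nra.
    + by constructor 2; rewrite sim_pt; congr pt; ring.
    + by constructor 3; rewrite sim_pt; congr pt; ring.
  apply: arc_cat_segment.
    rewrite segment_sym; apply: arc_rev; apply: (arc_cat_segment (arc_rev A1)).
    move=> y [/ends ys /segment_ptP[t t01 yE]].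
    case: ys => [|//|yE']; first by rewrite yE pt1 => ?; exfalso; lra.
    by move: yE'; rewrite yE => /pt_inj[? _]; exfalso; nra.
  move=> y [ys /segment_ptP[t t01 yE]].
  case: ys => [/ends[|yE'|//]|/segment_ptP[r r01 yE']].
  + by rewrite yE pt1 => ?; exfalso; lra.
  + by move: yE'; rewrite yE => /pt_inj[? _]; exfalso; nra.
  + by move: yE'; rewrite yE => /pt_inj[? _]; exfalso; nra.
- apply: polygonalU; last exact: polygonal_segment.
  apply: polygonalU; last exact: polygonal_segment.
  by apply/sim_polygonal => //; exact: lt0r_neq0.
- move=> y [[[z /Bl zl <-]|]|]; first by rewrite v1; nra.
    by move=> /segment_ptP[t t01 ->]; rewrite pt1; lra.
  by move=> /segment_ptP[t t01 ->]; rewrite pt1; lra.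
Qed.

Lemma shrink_hcont B : compact B -> hcont (shrink B).
Proof.
move=> Bc s e e0.
have [M [M0 MB]] : exists M, 0 < M /\ forall y, B y -> `|y + pt 0 1| <= M.
  have [M [_ /(_ (`|M| + 1))]] := compact_bounded Bc.
  rewrite (le_lt_trans (ler_norm M)) ?ltrDl // => /(_ isT) MB.
  exists (`|M| + 1 + `|pt 0 1|); split.
    by rewrite (lt_le_trans (_ : 0 < `|M| + 1)) ?lerDl // ltr_wpDl.
  by move=> y By; rewrite (le_trans (ler_normD _ _)) // lerD2r; exact: MB.
have : \forall s' \near s, `|s - s'| < e / (M + 1).
  have eM : 0 < e / (M + 1) by rewrite divr_gt0 //; lra.
  by have := nbhsx_ballx s _ eM; rewrite -ball_normE.
apply: filterS => s' ss'.
have M1 : 0 < M + 1 by lra.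
have ss1 : `|s - s'| < e.
  rewrite (lt_le_trans ss') // ler_pdivrMr //; nra.
have ssM : `|s - s'| * (M + 1) < e by rewrite -ltr_pdivlMr.
apply: hcloseU; first apply: hcloseU.
- apply: hclose_image => y By.
  have -> : sim (pt 0 (s - 1)) s y - sim (pt 0 (s' - 1)) s' y = (s - s') *: (y + pt 0 1).
    apply/rowP => i; rewrite !mxE; case: ifP => _; first by ring.
    by case: ifP => _; ring.
  rewrite normrZ; have := MB y By; have := normr_ge0 (s - s'); nra.
- apply: (@hclose_image _ _ _ _ (fun t => (1 - t) *: pt 1 (-1) + t *: pt s (-1))
    (fun t => (1 - t) *: pt 1 (-1) + t *: pt s' (-1))) => t; rewrite /= in_itv /= => t01.
  rewrite !pt_convex; apply: pt_norm_lt => //; last by rewrite subrr normr0.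
  have -> : (1 - t) * 1 + t * s - ((1 - t) * 1 + t * s') = t * (s - s') by ring.
  rewrite normrM ger0_norm; last by lra.
  by have := normr_ge0 (s - s'); nra.
apply: (@hclose_image _ _ _ _ (fun t => (1 - t) *: pt (- s) (-1) + t *: pt (-1) (-1))
  (fun t => (1 - t) *: pt (- s') (-1) + t *: pt (-1) (-1))) => t; rewrite /= in_itv /= => t01.
rewrite !pt_convex; apply: pt_norm_lt => //; last by rewrite subrr normr0.
have -> : (1 - t) * - s + t * -1 - ((1 - t) * - s' + t * -1) = - ((1 - t) * (s - s')) by ring.
rewrite normrN normrM ger0_norm; last by lra.
by have := normr_ge0 (s - s'); nra.
Qed.

End Similarity.

(** * Families parametrized by the Hilbert cube *)

Section HilbertCube.
Context (R : realType).
Implicit Types (x : hilbert_cube R).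

Definition cube_coord x (j : nat) : R := set_val (x j).

Lemma cube_coord_continuous j : continuous (fun x => cube_coord x j).
Proof.
have pc : continuous (fun x : hilbert_cube R => x j).
  exact: (@proj_continuous nat (fun=> set_type (`[0 : R, 1]%classic)) j).
exact: (cts_comp pc (@set_val_continuous _ _)).
Qed.

Lemma cube_coord_unit x : unit_seq (cube_coord x).
Proof. by move=> j; have := set_valP (x j); rewrite /= in_itv. Qed.

Definition clamp (t : R) : R := Num.max 0 (Num.min 1 t).

Lemma clamp_continuous : continuous clamp.
Proof.
apply: cts_max; first exact: cts_cst.
by apply: cts_min; [exact: cts_cst|move=> ?; exact: cvg_id].
Qed.

Lemma clamp01 t : 0 <= clamp t <= 1.
Proof. by rewrite le_max lexx ge_max ler01 ge_min lexx. Qed.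

Lemma clamp_id t : 0 <= t <= 1 -> clamp t = t.
Proof. by move=> /andP[t0 t1]; rewrite /clamp min_r // max_r. Qed.

Lemma clamp_le0 t : t <= 0 -> clamp t = 0.
Proof. by move=> t0; rewrite /clamp min_r ?(le_trans t0) // max_l. Qed.

Lemma clamp_ge1 t : 1 <= t -> clamp t = 1.
Proof. by move=> t1; rewrite /clamp min_l // max_r. Qed.

Lemma clamp_itv t : `[0, 1]%classic (clamp t).
Proof. by rewrite /= in_itv /= clamp01. Qed.

Definition unit_point (t : R) : set_type (`[0 : R, 1]%classic) := mk_set_type (clamp_itv t).

Lemma unit_point_continuous : continuous unit_point.
Proof. by apply: set_type_continuous; exact: clamp_continuous. Qed.

Lemma hilbert_cube_compact : compact [set: hilbert_cube R].
Proof.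
have -> : [set: hilbert_cube R] = [set x | forall j, [set: set_type (`[0 : R, 1]%classic)] (x j)].
  by apply/seteqP; split.
apply: (@tychonoff nat (fun=> set_type (`[0 : R, 1]%classic)) (fun=> setT)) => j.
have -> : [set: set_type (`[0 : R, 1]%classic)] = unit_point @` `[0, 1].
  apply/seteqP; split=> // y _; have := set_valP y; rewrite /= => y01.
  exists (set_val y) => //; apply: val_inj; rewrite /=; apply: clamp_id.
  by move: y01; rewrite in_itv.
apply: continuous_compact; last exact: segment_compact.
by apply: continuous_subspaceT; exact: unit_point_continuous.
Qed.

(** Weights steer the cube into a class: harmonic weights give sequences tending to 0, cut-off
    weights give finitely supported ones, and weights 1 give the copies of c_0 and sigma. *)
Definition weighted (a : nat -> R) x (j : nat) : R := a j * cube_coord x j.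

Lemma weighted_unit a x : unit_seq a -> unit_seq (weighted a x).
Proof.
move=> a01 j; have /andP[a0 a1] := a01 j; have /andP[x0 x1] := cube_coord_unit x j.
by rewrite mulr_ge0 //= mulr_ile1.
Qed.

End HilbertCube.

Section Families.
Context (R : realType) (n : nat).
Local Notation V := 'rV[R]_n.+2.
Local Notation pt := (@pt R n).
Local Notation hat := (@hat R n).
Implicit Types (A B : set V) (w y : V) (l : R).

Definition to_continuum A (H : is_continuum A) : continua V :=
  mk_set_type (A := [set C : set V | [/\ C !=set0, compact C & connected C]]) H.

Lemma hcont_comp (S T : topologicalType) (E : T -> set V) (f : S -> T) :
  hcont E -> continuous f -> hcont (fun s => E (f s)).
Proof. by move=> Ec fc s e e0; exact: (fc s _ (Ec (f s) e e0)). Qed.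

Lemma hat_hcont (a : nat -> R) : unit_seq a -> hcont (fun x : hilbert_cube R => hat (weighted a x)).
Proof.
move=> a01 x e e0; pose N := Num.truncn e^-1.
have Ne : tent_right R N < e.
  by rewrite -[ltRHS]invrK ltf_pV2 ?posrE ?invr_gt0 // truncnS_gt.
have H (j : 'I_N) : \forall x' \near x, `|weighted a x j - weighted a x' j| < e.
  have c : continuous (fun x : hilbert_cube R => weighted a x j).
    by apply: ctsM; [exact: cts_cst|exact: cube_coord_continuous].
  by have /cvgrPdist_lt/(_ _ e0) := c x.
have := filter_forall (nbhs_filter x) H.
apply: (@filterS _ _ (nbhs_filter x)) => x' xx'.
apply: (@hat_hclose R n _ _ N e) => //; try exact: weighted_unit.
by move=> j jN; exact: (xx' (Ordinal jN)).
Qed.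

(* The three stages of the path, for the parameter in [0, 3]: [B] shrinks to a
   segment, the origin moves from [w] to [w'], then [B'] grows. *)
Definition bottom_path B B' (t : R) : set V :=
  if t <= 3 / 2 then shrink B (clamp (1 - t)) else shrink B' (clamp (t - 2)).

Lemma bottom_path_low_arc B B' t : strict_low_arc B -> strict_low_arc B' ->
  low_arc (bottom_path B B' t).
Proof.
by move=> sB sB'; rewrite /bottom_path; case: ifP => _; apply: shrink_low_arc => //; exact: clamp01.
Qed.

Lemma bottom_path0 B B' : strict_low_arc B -> bottom_path B B' 0 = B.
Proof.
move=> sB; rewrite /bottom_path divr_ge0 // subr0 clamp_ge1 //; exact: shrink1.
Qed.

Lemma bottom_path3 B B' : strict_low_arc B' -> bottom_path B B' 3 = B'.
Proof.
move=> sB; rewrite /bottom_path ifF; last by apply/negbTE; rewrite -ltNge; lra.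
by rewrite clamp_ge1; [exact: shrink1|lra].
Qed.

Lemma bottom_path_hcont B B' : strict_low_arc B -> strict_low_arc B' ->
  hcont (bottom_path B B').
Proof.
move=> sB sB'; have [[Barc _ _] _] := sB; have [[Barc' _ _] _] := sB'.
have [[Bp _ _] [Bp' _ _]] := (arc_ends Barc, arc_ends Barc').
have idc : continuous (fun t : R => t) by move=> ?; exact: cvg_id.
have l1 : continuous (fun t : R => 1 - t) by apply: ctsB => //; exact: cts_cst.
have l2 : continuous (fun t : R => t - 2) by apply: ctsB => //; exact: cts_cst.
have c1 : hcont (fun t : R => shrink B (clamp (1 - t))).
  exact: (hcont_comp (shrink_hcont (arc_compact Barc)) (cts_comp l1 (@clamp_continuous R))).
have c2 : hcont (fun t : R => shrink B' (clamp (t - 2))).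
  exact: (hcont_comp (shrink_hcont (arc_compact Barc')) (cts_comp l2 (@clamp_continuous R))).
(* On [1, 2] both branches are the plain segment, so the switch at 3/2 makes no jump. *)
have mid (t : R) : 1 <= t <= 2 -> bottom_path B B' t = segment (pt 1 (-1)) (pt (-1) (-1)).
  move=> t12; rewrite /bottom_path; case: ifP => _; rewrite clamp_le0 ?shrink0 //; try lra.
    by exists (pt 1 (-1)).
  by exists (pt 1 (-1)).
move=> t e e0; have [t1|t1] := ltP t (3 / 2).
  have d0 : 0 < 3 / 2 - t by rewrite subr_gt0.
  have := nbhsx_ballx t _ d0; have := c1 t e e0; apply: filterS2 => t' tt'.
  rewrite -ball_normE /= ltr_norml => t'1.
  by rewrite /bottom_path !ifT //; lra.
have [t2|t2] := ltP (3 / 2) t.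
  have d0 : 0 < t - 3 / 2 by rewrite subr_gt0.
  have := nbhsx_ballx t _ d0; have := c2 t e e0; apply: filterS2 => t' tt'.
  rewrite -ball_normE /= ltr_norml => t'1.
  by rewrite /bottom_path !ifF //; apply/negbTE; rewrite -ltNge; lra.
have tE : t = 3 / 2 by lra.
have h0 : (0 : R) < 2^-1 by lra.
have := nbhsx_ballx t _ h0; apply: filterS => t'; rewrite -ball_normE /= ltr_norml => tt'.
by rewrite !mid; [exact: hclose_refl|lra|lra].
Qed.

Definition thick B B' w w' l (a : nat -> R) (p : R * hilbert_cube R) : set V :=
  sim (w + clamp (p.1 - 1) *: (w' - w)) l @` (bottom_path B B' p.1 `|` hat (weighted a p.2)).

Lemma thick_hcont B B' w w' l a : strict_low_arc B -> strict_low_arc B' -> 0 < l -> unit_seq a ->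
  hcont (thick B B' w w' l a).
Proof.
move=> sB sB' l0 a01 p e e0.
have f1 : continuous (fun p : R * hilbert_cube R => p.1) by move=> ?; exact: cvg_fst.
have f2 : continuous (fun p : R * hilbert_cube R => p.2) by move=> ?; exact: cvg_snd.
have el : 0 < e / 2 / l by rewrite !divr_gt0.
have e2 : 0 < e / 2 by rewrite divr_gt0.
have H1 := hcont_comp (bottom_path_hcont sB sB') f1 p el.
have H2 := hcont_comp (hat_hcont a01) f2 p el.
have wc : continuous (fun p : R * hilbert_cube R => w + clamp (p.1 - 1) *: (w' - w)).
  apply: ctsD; first exact: cts_cst.
  apply: ctsZ; last exact: cts_cst.
  have l1 : continuous (fun p : R * hilbert_cube R => p.1 - 1).
    by apply: (@ctsB _ _ R^o) => //; exact: cts_cst.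
  exact: (cts_comp l1 (@clamp_continuous R)).
have /cvgrPdist_lt/(_ _ e2) H3 := wc p.
near=> p'; rewrite (_ : e = e / 2 + l * (e / 2 / l)); last first.
  by rewrite [l * _]mulrC divfK ?gt_eqF //; lra.
apply: sim_hclose => //; last by near: p'.
by apply: hcloseU; near: p'.
Unshelve. all: by end_near. Qed.

Lemma thick_continuum B B' w w' l a p : strict_low_arc B -> strict_low_arc B' -> unit_seq a ->
  is_continuum (thick B B' w w' l a p).
Proof.
move=> sB sB' a01; apply: sim_continuum; apply: hat_continuum; last exact: weighted_unit.
exact: bottom_path_low_arc.
Qed.

End Families.

(** * Cantor manifolds *)

(** This passes from finitely many partitions, met inside finite-dimensional cubes, to all of
    them. *)
Lemma compact_nested (T : topologicalType) (K : set T) (C : nat -> set T) :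
  compact K -> (forall i, closed (C i)) ->
  (forall m, exists2 p, K p & forall i, (i < m)%N -> C i p) ->
  exists2 p, K p & forall i, C i p.
Proof.
move=> Kc Cc KC.
have /boolp.choice[p pP] m : exists p, K p /\ forall i, (i < m)%N -> C i p.
  by have [p Kp Cp] := KC m; exists p.
have pK : \forall m \near \oo, K (p m) by exists 0%N => // m _; case: (pP m).
have [q [Kq qp]] := Kc (p @ \oo) _ pK.
exists q => // i; apply: Cc => A qA; apply: qp => //.
by exists i.+1 => // m /= im; case: (pP m) => _; exact.
Qed.

Lemma prod_topology_continuous (I : Type) (K : I -> topologicalType) (S : topologicalType)
    (f : S -> prod_topology K) :
  (forall i, continuous (fun s => f s i)) -> continuous f.
Proof.
move=> fc s.
have F : Filter (f @ s) by apply: fmap_filter; exact: nbhs_filter.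
have sup := @cvg_sup _ _ (fun i => Topological.class
  (initial_topology (fun g : forall i, K i => g i))) (f @ s) (f s) F.
apply/sup => i; move: s {F sup}.
apply/(@continuousP _ (initial_topology (fun g : forall i, K i => g i))) => A [B oB <-].
by move/continuousP : (fc i); exact.
Qed.

Section CubeMap.
Context (R : realType) (m : nat).

(** Coordinate 0 runs along the path over [0, 3]; the others fill the first [m] coordinates of the
    Hilbert cube, the rest being 0. *)
Definition cube_map (y : 'rV[R]_m.+1) : R * hilbert_cube R :=
  (3 * y 0 0, fun j => unit_point (if (j < m)%N then y 0 (inord j.+1) else 0)).

Lemma cube_map_continuous : continuous cube_map.
Proof.
have c1 : continuous (fun y : 'rV[R]_m.+1 => (cube_map y).1).
  by apply: ctsM; [exact: cts_cst|exact: coord_continuous].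
have c2 : continuous (fun y : 'rV[R]_m.+1 => (cube_map y).2).
  apply: (@prod_topology_continuous nat (fun=> set_type (`[0 : R, 1]%classic))) => j /=.
  apply: (cts_comp _ (@unit_point_continuous R)).
  by case: (j < m)%N; [exact: coord_continuous|exact: cts_cst].
exact: cts_pair.
Qed.

Lemma cube_map_coord y (j : 'I_m) : cube y -> cube_coord (cube_map y).2 j = y 0 (lift ord0 j).
Proof.
move=> yc; rewrite /cube_coord /= ltn_ord -[LHS]/(clamp (y 0 (inord j.+1))) clamp_id; last exact: yc.
congr (y 0 _); by apply: val_inj; rewrite /= inordK // ltnS ltn_ord.
Qed.

Lemma cube_map_itv y : cube y -> 0 <= (cube_map y).1 <= 3.
Proof. by move=> /(_ 0) /=; lra. Qed.

End CubeMap.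

Section ThickEnds.
Context (R : realType) (n : nat) (B B' : set 'rV[R]_n.+2) (w w' : 'rV[R]_n.+2) (l : R).
Hypotheses (sB : strict_low_arc B) (sB' : strict_low_arc B').

Lemma thick0 a x :
  thick B B' w w' l a (0, x) = sim w l @` (B `|` hat (weighted a x)).
Proof. by rewrite /thick bottom_path0 // sub0r clamp_le0 ?scale0r ?addr0 // oppr_le0. Qed.

Lemma thick3 a x :
  thick B B' w w' l a (3, x) = sim w' l @` (B' `|` hat (weighted a x)).
Proof.
rewrite /thick bottom_path3 // clamp_ge1 /=; last lra.
by rewrite scale1r addrC subrK.
Qed.

End ThickEnds.

(** What the four hyperspaces have in common: [good] stands for convergence to 0 or for finite
    support. The last clause provides cubes of every finite dimension. *)
Definition hat_class (R : realType) n (good : (nat -> R) -> Prop) (X : set (continua 'rV[R]_n.+2)) :=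
  [/\ forall C, X C -> homeomorphic (set_type C) (set_type (@unit_circle R)),
      forall w l B x (C : continua 'rV[R]_n.+2), 0 < l -> low_arc B -> unit_seq x ->
        C = sim w l @` (B `|` hat x) :> set _ -> (X C <-> good x) &
      forall x N, unit_seq x -> (forall j, (N <= j)%N -> x j = 0) -> good x].

Section HatClass.
Context (R : realType) (n : nat) (good : (nat -> R) -> Prop).
Context (X : set (continua 'rV[R]_n.+2)) (HX : hat_class good X).
Local Notation V := 'rV[R]_n.+2.
Local Notation hat := (@hat R n).
Local Notation T := (set_type X).

Lemma hat_class_hausdorff : hausdorff_space T.
Proof. by apply: set_type_hausdorff; exact: continua_hausdorff. Qed.

Lemma hat_class_inhabited : [set: T] !=set0.
Proof.
have c : is_continuum (sim (0 : V) 1 @` (segment (pt n 1 (-1)) (pt n (-1) (-1)) `|` hat (fun=> 0))).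
  by apply: sim_continuum; apply: hat_continuum; [exact: segment_low_arc|exact: unit_seq0].
have Xc : X (to_continuum c).
  have [_ XE Xf] := HX; apply/(XE _ _ _ _ (to_continuum c) ltr01 (segment_low_arc R n) (@unit_seq0 R) erefl).
  by apply: (Xf _ 0%N) => //; exact: unit_seq0.
by exists (mk_set_type Xc).
Qed.

Lemma hat_class_open (U : set T) : open U -> U !=set0 ->
  exists2 d, 0 < d & forall l, 0 < l < d -> exists (w : V) (B : set V),
    strict_low_arc B /\ forall x (D : T), unit_seq x ->
      set_of_continuum (set_val D) = sim w l @` (B `|` hat x) -> U D.
Proof.
move=> /set_type_open[W oW ->] [C WC]; have [XC _ _] := HX.
have [e e0 eW] := hclose_open oW WC.
have [d d0 dP] := scc_density (XC _ (set_valP C)) e0.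
exists d => // l /dP[w [B [sB BP]]]; exists w, B; split=> // x D x01 DE.
by apply: eW; rewrite DE; exact: BP.
Qed.

(** The scale is chosen below the thresholds of both open sets. Only the weighted cube coordinates
    are recovered from a value of [f]; the path parameter may be lost, for instance while the same
    curve stands still. *)
Lemma thick_path (U W : set T) (a : nat -> R) : open U -> U !=set0 -> open W -> W !=set0 ->
  unit_seq a -> (forall x, good (weighted a x)) ->
  exists f : R * hilbert_cube R -> T, [/\ continuous f,
    forall x, U (f (0, x)), forall x, W (f (3, x)) &
    forall p p', f p = f p' -> forall j, weighted a p.2 j = weighted a p'.2 j].
Proof.
move=> oU U0 oW W0 a01 ag; have [_ XE _] := HX.
have [d d0 dP] := hat_class_open oU U0; have [d' d'0 d'P] := hat_class_open oW W0.
pose l := Num.min d d' / 2.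
have m0 : 0 < Num.min d d' by rewrite lt_min d0.
have l0 : 0 < l by rewrite divr_gt0.
have lm : l < Num.min d d' by rewrite /l; lra.
have [|w [B [sB BU]]] := dP l; first by rewrite l0 (lt_le_trans lm) // ge_min lexx.
have [|w' [B' [sB' BW]]] := d'P l; first by rewrite l0 (lt_le_trans lm) // ge_min lexx orbT.
pose E p := to_continuum (thick_continuum w w' l p sB sB' a01).
have Xf p : X (E p).
  apply/(XE _ _ _ _ (E p) l0 (bottom_path_low_arc p.1 sB sB') (weighted_unit p.2 a01) erefl).
  exact: ag.
exists (fun p => mk_set_type (Xf p)); split.
- apply: set_type_continuous; apply: hcont_continuous => /=.
  exact: (thick_hcont w w' sB sB' l0 a01).
- by move=> x; apply: (BU (weighted a x)); [exact: weighted_unit|exact: thick0].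
- by move=> x; apply: (BW (weighted a x)); [exact: weighted_unit|exact: thick3].
move=> p p' /(congr1 (fun D : T => set_of_continuum (set_val D))) /=.
have [_ _ Bl] := bottom_path_low_arc p.1 sB sB'.
have [_ _ Bl'] := bottom_path_low_arc p'.1 sB sB'.
by apply: hat_recover => //; exact: weighted_unit.
Qed.

Lemma cube_in_hat_class m (U W : set T) : open U -> U !=set0 -> open W -> W !=set0 ->
  exists g : 'rV[R]_m.+1 -> T, [/\ continuous g,
    forall y, cube y -> y 0 0 = 0 -> U (g y), forall y, cube y -> y 0 0 = 1 -> W (g y) &
    forall y y', cube y -> cube y' -> g y = g y' ->
      forall j, y 0 (lift ord0 j) = y' 0 (lift ord0 j)].
Proof.
move=> oU U0 oW W0; pose a j : R := (j < m)%N%:R.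
have a01 : unit_seq a by move=> j; rewrite /a; case: ltnP; rewrite lexx ler01.
have ag x : good (weighted a x).
  have [_ _ Xf] := HX; apply: (Xf _ m); first exact: weighted_unit.
  by move=> j mj; rewrite /weighted /a ltnNge mj mul0r.
have [f [fc fU fW fE]] := thick_path oU U0 oW W0 a01 ag.
exists (fun y => f (cube_map y)); split.
- exact: (cts_comp (@cube_map_continuous R m) fc).
- by move=> y _ y0; rewrite /cube_map y0 mulr0.
- by move=> y _ y1; rewrite /cube_map y1 mulr1.
move=> y y' yc y'c /fE yy j; have := yy j.
by rewrite /weighted /a ltn_ord !mul1r !cube_map_coord.
Qed.

Lemma hat_class_not_finite_dimensional : ~ finite_dimensional T.
Proof.
move=> [m]; have [g [gc _ _ gj]] := @cube_in_hat_class m.+1 _ _ (@openT T) hat_class_inhabited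
  (@openT T) hat_class_inhabited.
(* With [h0 = 0] the path direction imposes nothing; the other [m.+1] coordinates suffice against
   dimension [m]. *)
apply: (@covering_dim_cube R m T T id g (fun=> 0) hat_class_hausdorff _ _ gc) => //.
- by move=> ?; exact: cvg_id.
- by move=> A oA; exists A.
- exact: cts_cst.
- by move=> y _ _; exists (g y).
move=> j y y' yc y'c gyy y0 y1; have := gj y y' yc y'c gyy j.
by rewrite y0 y1 => /esym/eqP; rewrite oner_eq0.
Qed.

(** The path direction is spent on hitting [Z]: a zero of [h0] lies in neither [U] nor [W]. The
    remaining [m.+1] coordinates contradict dimension [m] of [Z]. *)
Lemma hat_class_separation m (Z : set T) : closed Z -> covering_dim_le (set_type Z) m ->
  ~ separates Z.
Proof.
move=> cZ dZ [U [W [oU oW [U0 W0] UW ZUW]]].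
have UWF t : U t -> W t -> False by move=> Ut Wt; suff : (set0 : set T) t by []; rewrite -UW.
have [g [gc gU gW gj]] := @cube_in_hat_class m.+1 _ _ oU U0 oW W0.
pose h0 y := dist_to (~` (g @^-1` W)) y - dist_to (~` (g @^-1` U)) y.
have gcl (A : set T) : open A -> closed (~` (g @^-1` A)).
  by move=> oA; apply: open_closedC; move/continuousP : gc; exact.
apply: (@covering_dim_cube R m T (set_type Z) set_val g h0 hat_class_hausdorff _ _ gc) => //.
- exact: set_val_continuous.
- exact: set_type_open.
- by apply: ctsB; exact: dist_to_continuous.
- move=> y yc y0; rewrite subr_le0 dist_to_mem ?dist_to_ge0 // => Wy.
  exact: (UWF _ (gU y yc y0) Wy).
- move=> y yc y1; rewrite subr_ge0 [leLHS]dist_to_mem ?dist_to_ge0 // => Uy.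
  exact: (UWF _ Uy (gW y yc y1)).
- move=> y yc /eqP; rewrite subr_eq0 => /eqP UWy.
  suff Zy : Z (g y) by exists (mk_set_type Zy).
  apply: contrapT; change ((~` Z) (g y) -> False); rewrite ZUW => -[Uy|Wy].
    suff /(dist_to_eq0 (gcl U oU)) : dist_to (~` (g @^-1` U)) y = 0 by [].
    by rewrite -UWy dist_to_mem // => Wy; exact: UWF Uy Wy.
  suff /(dist_to_eq0 (gcl W oW)) : dist_to (~` (g @^-1` W)) y = 0 by [].
  by rewrite UWy dist_to_mem // => Uy; exact: UWF Uy Wy.
move=> j y y' yc y'c gyy y0 y1; have := gj y y' yc y'c gyy j.
by rewrite y0 y1 => /esym/eqP; rewrite oner_eq0.
Qed.

Lemma hat_class_Cantor_manifold : infinite_dimensional_Cantor_manifold T.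
Proof.
split; first exact: hat_class_not_finite_dimensional.
by move=> Z cZ [m]; exact: hat_class_separation.
Qed.

(** Positive weights make every coordinate readable, so the traces on [Z] of opposite faces form
    infinitely many disjoint closed pairs. The partitions given by the weak infinite-dimensionality
    of [Z] are shown to have a common point. *)
Lemma hat_class_strong_Cantor_manifold (a : nat -> R) : (forall j, 0 < a j <= 1) ->
  (forall x, good (weighted a x)) -> strongly_infinite_dimensional_Cantor_manifold T.
Proof.
move=> a01 ag; split; first exact: hat_class_not_finite_dimensional.
move=> Z cZ wZ [U [W [oU oW [U0 W0] UW ZUW]]].
have UWF t : U t -> W t -> False by move=> Ut Wt; suff : (set0 : set T) t by []; rewrite -UW.
have ua : unit_seq a by move=> j; have /andP[/ltW -> ->] := a01 j.
have [f [fc fU fW fE]] := thick_path oU U0 oW W0 ua ag.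
have {}fE p p' j : f p = f p' -> cube_coord p.2 j = cube_coord p'.2 j.
  move=> /fE/(_ j); rewrite /weighted; apply: mulfI; have /andP[] := a01 j.
  by move=> /lt0r_neq0.
pose D : set (R * hilbert_cube R) := `[0, 3] `*` setT.
have Dc : compact D by apply: compact_setX; [exact: segment_compact|exact: hilbert_cube_compact].
pose face j (c : R) : set T := f @` (D `&` [set p | cube_coord p.2 j = c]).
have facec j c : closed (face j c).
  apply: compact_closed; first exact: hat_class_hausdorff.
  apply: continuous_compact; first exact: continuous_subspaceT.
  apply: compact_closedI => //.
  have snd_c : continuous (fun p : R * hilbert_cube R => p.2) by move=> ?; exact: cvg_snd.
  have /continuous_closedP/(_ [set c] (@closed_eq _ _)) :=
    cts_comp snd_c (@cube_coord_continuous R j).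
  exact.
pose A j c : set (set_type Z) := set_val @^-1` face j c.
have Ac j c : closed (A j c) by have /continuous_closedP := @set_val_continuous _ Z; exact.
have [|L [LP L0]] := wZ (A^~ 0) (A^~ 1).
  move=> j; split=> //; apply/seteqP; split=> // z [[p [_ p0] pz] [q [_ q1] qz]].
  have := fE p q j; rewrite pz qz => /(_ erefl); rewrite p0 q1 => /esym/eqP.
  by rewrite oner_eq0.
(* The sides of each partition are extended to open sets of the hyperspace; the extensions are
   disjoint on [Z] only. *)
have /boolp.choice[G GP] j : exists G : set T * set T, [/\ open G.1, open G.2,
    forall z : set_type Z, G.1 (set_val z) -> G.2 (set_val z) -> False,
    forall z : set_type Z, ~ G.1 (set_val z) -> ~ G.2 (set_val z) -> L j z &
    (forall z, A j 0 z -> G.1 (set_val z)) /\ (forall z, A j 1 z -> G.2 (set_val z))].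
  have [_ [P [Q [/set_type_open[P' oP ->] /set_type_open[Q' oQ ->] PQ LPQ [AP AQ]]]]] := LP j.
  exists (P', Q'); split=> // z; first by move=> *; suff : (set0 : set (set_type Z)) z by []; rewrite -PQ.
  by move=> nP nQ; apply: contrapT => nL; have : (~` L j) z by []; rewrite LPQ => -[].
pose C j : set T := Z `&` (~` (G j).1 `&` ~` (G j).2).
have Cc j : closed (C j).
  by have [e1 e2 _ _ _] := GP j; apply: closedI => //; apply: closedI; exact: open_closedC.
have fDc : compact (f @` D) by apply: continuous_compact => //; exact: continuous_subspaceT.
suff [t [p Dp pt] Ct] : exists2 t, (f @` D) t & forall j, C j t.
  have [Zt _] := Ct 0%N.
  suff : (set0 : set (set_type Z)) (mk_set_type Zt) by [].
  rewrite -L0 => j _; have [_ [n1 n2]] := Ct j; have [_ _ _ LG _] := GP j; exact: LG.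
(* For each [m], a cube of dimension [m + 1] yields a point of [Z] outside both sides of the first
   [m] partitions. *)
apply: compact_nested => // m.
pose g (y : 'rV[R]_m.+1) := f (cube_map y).
have gc : continuous g by exact: (cts_comp (@cube_map_continuous R m) fc).
have Dy (y : 'rV[R]_m.+1) : cube y -> D (cube_map y).
  by move=> yc; split=> //=; rewrite in_itv; exact: cube_map_itv.
have ZK (y : 'rV[R]_m.+1) : ~ U (g y) -> ~ W (g y) -> Z (g y).
  by move=> nU nW; apply: contrapT => nZ; have : (~` Z) (g y) by []; rewrite ZUW => -[].
have preo (P : set T) : open P -> open (g @^-1` P) by move/continuousP : gc; exact.
have [|||||||y [yc nU nW] nG] := @cube_partitions R m T g gc U W
  (fun j => g @^-1` (G j).1) (fun j => g @^-1` (G j).2) oU oW UWF.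
- by move=> y _ y0; rewrite /g /cube_map y0 mulr0.
- by move=> y _ y1; rewrite /g /cube_map y1 mulr1.
- by move=> j; apply: preo; case: (GP j).
- by move=> j; apply: preo; case: (GP j).
- by move=> j y [yc nU nW]; have [_ _ + _ _] := GP j => /(_ (mk_set_type (ZK y nU nW))).
- move=> j y [yc nU nW] yj; have [_ _ _ _ [+ _]] := GP j => /(_ (mk_set_type (ZK y nU nW))).
  by apply; exists (cube_map y) => //; split; [exact: Dy|rewrite /= cube_map_coord].
- move=> j y [yc nU nW] yj; have [_ _ _ _ [_]] := GP j => /(_ (mk_set_type (ZK y nU nW))).
  by apply; exists (cube_map y) => //; split; [exact: Dy|rewrite /= cube_map_coord].
exists (g y); first by exists (cube_map y) => //; exact: Dy.
move=> j jm; have [n1 n2] := nG (Ordinal jm); split; first exact: ZK.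
by split.
Qed.

(** The whole Hilbert cube embeds in the space of continua with compact image. Its trace on the
    class is closed there and consists of the images of the good sequences. *)
Lemma hat_class_closed_copies : open_sets_contain_closed_copies T
  (set_type [set x : hilbert_cube R | good (cube_coord x)]).
Proof.
move=> U oU U0; have [_ XE _] := HX; have [d d0 dP] := hat_class_open oU U0.
have l0 : 0 < d / 2 by rewrite divr_gt0.
have [|w [B [sB BU]]] := dP (d / 2); first by rewrite l0; lra.
have u1 : unit_seq (fun=> 1 : R) by move=> j; rewrite ler01 lexx.
have w1 x : weighted (fun=> 1 : R) x = cube_coord x.
  by apply/funext => j; rewrite /weighted mul1r.
(* Parameter 0 of a path from [w] to itself, so that the continuity of [thick] can be reused. *)
pose G (x : hilbert_cube R) := to_continuum (thick_continuum w w (d / 2) (0, x) sB sB u1).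
have GE x : set_of_continuum (G x) = sim w (d / 2) @` (B `|` hat (cube_coord x)).
  by rewrite -w1; exact: thick0.
have pc : continuous (fun x : hilbert_cube R => (0 : R, x)).
  by apply: cts_pair; [exact: cts_cst|move=> ?; exact: cvg_id].
have Gc : continuous G.
  by apply: hcont_continuous; exact: (hcont_comp (thick_hcont w w sB sB l0 u1) pc).
have [Bl _] := sB; have [_ _ Blow] := Bl.
have Ginj x x' : G x = G x' -> x = x'.
  move=> /(congr1 (@set_of_continuum _)); rewrite !GE => xx; apply/funext => j; apply: val_inj.
  exact: (hat_recover l0 Blow Blow (cube_coord_unit x) (cube_coord_unit x') xx j).
have XG x : X (G x) <-> good (cube_coord x).
  exact: (XE _ _ _ _ (G x) l0 Bl (cube_coord_unit x) (GE x)).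
have TV : hausdorff_space (continua V) by exact: continua_hausdorff.
have [H [Hc HE]] : exists H : set_type (G @` setT) -> set_type (id @` [set: hilbert_cube R]),
    continuous H /\ forall y s, setT s -> set_val y = G s -> set_val (H y) = s.
  apply: quotient_map_factor => //; first exact: hilbert_cube_compact.
    by move=> ?; exact: cvg_id.
  by move=> s t _ _ /Ginj.
pose F : set T := set_val @^-1` (G @` setT).
have Fr (D : set_type F) : (G @` setT) (set_val (set_val D)) by exact: set_valP D.
have goodH (D : set_type F) : good (cube_coord (set_val (H (mk_set_type (Fr D))))).
  have [x _ xD] := Fr D.
  by rewrite (HE _ x) //; apply/XG; rewrite xD; exact: set_valP.
pose good_set := [set x : hilbert_cube R | good (cube_coord x)].
have XGx (x : set_type good_set) : X (G (set_val x)) by apply/XG; exact: (set_valP x).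
have FG (x : set_type good_set) : F (mk_set_type (XGx x)) by exists (set_val x).
exists F; split.
- by move=> D [x _ xD]; apply: (BU (cube_coord x)); [exact: cube_coord_unit|rewrite -xD; exact: GE].
- have /continuous_closedP := @set_val_continuous _ X; apply.
  apply: compact_closed => //; apply: continuous_compact; first exact: continuous_subspaceT.
  exact: hilbert_cube_compact.
exists (fun D => mk_set_type (A := good_set) (goodH D)), (fun x => mk_set_type (FG x)); split.
- move=> D; apply: val_inj; apply: val_inj => /=; have [x _ xD] := Fr D.
  by rewrite -[RHS]xD; congr G; exact: HE.
- by move=> x; apply: val_inj; exact: HE.
- apply: set_type_continuous => /=.
  have mc : continuous (fun D : set_type F => mk_set_type (Fr D)).
    apply: set_type_continuous => /=.
    exact: (cts_comp (@set_val_continuous _ F) (@set_val_continuous _ X)).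
  exact: (cts_comp (cts_comp mc Hc) (@set_val_continuous _ _)).
- apply: set_type_continuous; apply: set_type_continuous => /=.
  exact: (cts_comp (@set_val_continuous _ _) Gc).
Qed.

End HatClass.

(** * The four hyperspaces *)

Section Instances.
Context (R : realType).

Lemma eventually0_cvg (x : nat -> R) N : (forall j, (N <= j)%N -> x j = 0) -> x @ \oo --> (0 : R).
Proof.
move=> xN; apply: (cvg_trans _ (@cvg_cst _ (0 : R) nat \oo _)); apply: near_eq_cvg.
by exists N => // j /= Nj; rewrite xN.
Qed.

Lemma simple_closed_curves_hat n :
  hat_class (fun x : nat -> R => x @ \oo --> (0 : R)) (@simple_closed_curves R n.+2).
Proof.
split=> // [w l B x C l0 lB x01 CE|x N _]; last exact: eventually0_cvg.
have [_ Ec _] := hat_continuum lB x01; have [_ _ Blow] := lB.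
have h := sim_homeomorphic w (lt0r_neq0 l0) Ec.
rewrite /simple_closed_curves /= CE; split=> [hC|xc].
  by apply: (hat_scc_cvg Blow x01); exact: homeomorphic_trans (homeomorphic_sym h) hC.
exact: (homeomorphic_trans h (hat_scc lB x01 xc)).
Qed.

Lemma polygonal_simple_closed_curves_hat n :
  hat_class (fun x : nat -> R => finite_set [set j | x j != 0])
    (@polygonal_simple_closed_curves R n.+2).
Proof.
have [_ sE _] := simple_closed_curves_hat n.
have fin0 (x : nat -> R) : finite_set [set j | x j != 0] ->
    exists N, forall j, (N <= j)%N -> x j = 0.
  move=> /finite_nat_bound[N xN]; exists N => j; apply: contraTeq => /xN.
  by rewrite -ltnNge.
split=> [C []//|w l B x C l0 lB x01 CE|x N _ xN]; last first.
  apply: sub_finite_set (finite_II N) => j /=; apply: contra_neqT.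
  by rewrite -leqNgt; exact: xN.
have [_ _ Blow] := lB; have CX := sE w l B x C l0 lB x01 CE.
rewrite /polygonal_simple_closed_curves /= CX CE sim_polygonal ?gt_eqF //.
split=> [[_]|xf]; first exact: hat_polygonal_finite.
have [N xN] := fin0 x xf.
by split; [exact: eventually0_cvg xN|exact: hat_polygonal xN].
Qed.

Lemma tame_knots_hat :
  hat_class (fun x : nat -> R => x @ \oo --> (0 : R)) (@tame_knots R).
Proof.
have [_ sE _] := @simple_closed_curves_hat 1.
split=> [C []//|w l B x C l0 lB x01 CE|x N _]; last exact: eventually0_cvg.
have CX := sE w l B x C l0 lB x01 CE; split=> [[/CX]//|xc].
split; first exact/CX.
have lN : l != 0 by rewrite gt_eqF.
have x0 j : 0 <= x j by have /andP[] := x01 j.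
have s0 u : 0 <= spikes x u by exact: spikes_ge0.
have [_ _ Blow] := lB.
(* Undo the similarity, then flatten the spikes; the image is the polygon formed by [B] and the flat
   hat. *)
exists (shear (spikes x) \o sim (- (l^-1 *: w)) l^-1).
exists (to_continuum (hat_continuum lB (@unit_seq0 R))); split.
- apply: homeomorphism_comp; first by apply: sim_homeomorphism; rewrite invr_eq0.
  by apply: shear_homeomorphism => //; exact: spikes_continuous.
- split; first exact: (hat_scc lB (@unit_seq0 R) (cvg_cst _)).
  exact: (@hat_polygonal _ _ _ _ 0%N).
rewrite -[RHS](shear_hat Blow x0) CE image_comp; apply: eq_imagel => y _ /=.
by rewrite simK.
Qed.

Lemma hat_class_strong n (X : set (continua 'rV[R]_n.+2)) :
  hat_class (fun x : nat -> R => x @ \oo --> (0 : R)) X ->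
  strongly_infinite_dimensional_Cantor_manifold (set_type X).
Proof.
(* Harmonic weights are positive and tend to 0, so they send every point of the cube to a good
   sequence. *)
move=> HX; have h0 j : 0 < (harmonic j : R) <= 1.
  by rewrite /= invr_gt0 ltr0n /= invf_le1 ?ltr0n // ler1n.
apply: (hat_class_strong_Cantor_manifold HX h0) => x.
apply: (squeeze_cvgr _ (cvg_cst 0) (@cvg_harmonic R)); apply: nearW => j.
have /andP[x0 x1] := cube_coord_unit x j; have /andP[/ltW a0 _] := h0 j.
by rewrite /weighted mulr_ge0 // ler_piMr.
Qed.

End Instances.

Theorem theorem4p1 (R : realType) :
  let S_R2 := set_type (@simple_closed_curves R 2) in
  let S_P_R2 := set_type (@polygonal_simple_closed_curves R 2) in
  let K_T := set_type (@tame_knots R) in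
  let K_P := set_type (@polygonal_simple_closed_curves R 3) in
  ((strongly_infinite_dimensional_Cantor_manifold S_R2 /\
    open_sets_contain_closed_copies S_R2 (set_type (@c0_hat R))) /\
   (strongly_infinite_dimensional_Cantor_manifold K_T /\
    open_sets_contain_closed_copies K_T (set_type (@c0_hat R)))) /\
  ((infinite_dimensional_Cantor_manifold S_P_R2 /\
    open_sets_contain_closed_copies S_P_R2 (set_type (@sigma R))) /\
   (infinite_dimensional_Cantor_manifold K_P /\
    open_sets_contain_closed_copies K_P (set_type (@sigma R)))).
Proof.
move=> S_R2 S_P_R2 K_T K_P; split; split.
- have H := @simple_closed_curves_hat R 0.
  by split; [exact: hat_class_strong|exact: (hat_class_closed_copies H)].
- have H := @tame_knots_hat R.
  by split; [exact: hat_class_strong|exact: (hat_class_closed_copies H)].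
- have H := @polygonal_simple_closed_curves_hat R 0.
  by split; [exact: (hat_class_Cantor_manifold H)|exact: (hat_class_closed_copies H)].
- have H := @polygonal_simple_closed_curves_hat R 1.
  by split; [exact: (hat_class_Cantor_manifold H)|exact: (hat_class_closed_copies H)].
Qed.
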